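(* Let $F$ be a strongly convex norm on $\mathbb{R}^n$ (in the sense of the context), let $\Omega\subset\mathbb{R}^n$ be a domain with non-empty boundary, and let $d_F$ be the anisotropic distance function to $\partial\Omega$. Suppose that $d_F$ is $\Delta_F$-superharmonic in $\Omega$ and that $r_F:=\sup_{x\in\Omega}d_F(x)<+\infty$ ($r_F$ is the anisotropic inradius of $\Omega$). Then for every $u\in H_0^1(\Omega)$, $$\int_\Omega F(\nabla u)^2\,dx-\frac14\int_\Omega\frac{|u|^2}{d_F^2}\,dx\;\ge\;\frac{1}{4r_F^2}\int_\Omega|u|^2\,dx .$$
   Context: Standing assumptions on $F$: $F:\mathbb{R}^n\to[0,+\infty)$ is convex, satisfies $F(t\xi)=|t|F(\xi)$ for all $t\in\mathbb{R}$, $\xi\in\mathbb{R}^n$, and $\alpha_1|\xi|\le F(\xi)$ for all $\xi$ for some constant $\alpha_1>0$; moreover $F\in C^2(\mathbb{R}^n\setminus\{0\})$ and the Hessian $\nabla^2_\xi F^2$ is positive definite on $\mathbb{R}^n\setminus\{0\}$. $F_\xi$ denotes the gradient of $F$. Polar function: $F^o(x)=\sup_{\xi\ne0}\frac{\xi\cdot x}{F(\xi)}$. A domain is a connected open set. For a domain $\Omega$ with non-empty boundary, the anisotropic distance to the boundary is $d_F(x)=\inf_{y\in\partial\Omega}F^o(x-y)$, $x\in\overline\Omega$. It is Lipschitz and satisfies $F(\nabla d_F)=1$ a.e. in $\Omega$. Finsler Laplacian: $\Delta_F u=\operatorname{div}(F(\nabla u)F_\xi(\nabla u))$. The function $d_F$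 is $\Delta_F$-superharmonic in $\Omega$ if $-\Delta_F d_F\ge0$ in the sense of distributions, i.e. $\int_\Omega F(\nabla d_F)F_\xi(\nabla d_F)\cdot\nabla\varphi\,dx\ge0$ for all $\varphi\in C_0^\infty(\Omega)$ with $\varphi\ge0$. *)

(* Defs.v *)
From HB Require Import structures.
From mathcomp Require Import all_boot all_order all_algebra.
From mathcomp Require Import all_classical all_reals all_analysis.

Set Implicit Arguments.
Unset Strict Implicit.
Unset Printing Implicit Defensive.
Import Order.TTheory GRing.Theory Num.Theory.
Import numFieldNormedType.Exports.

Local Open Scope classical_set_scope.
Local Open Scope ring_scope.

(* The sigma-algebra generated by the coordinate functions, that is, the
   Borel sigma-algebra of [R^n]. *)
Section measurable_rV.
Context {R : realType} {n : nat}.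

Let coord (i : 'I_n) (v : 'rV[R]_n) : measurableTypeR R := v 0 i.

Let rV_set0 : g_sigma_preimage coord set0.
Proof. exact: sigma_algebra0. Qed.

Let rV_setC A : g_sigma_preimage coord A -> g_sigma_preimage coord (~` A).
Proof. exact: sigma_algebraC. Qed.

Let rV_bigcup (F : _^nat) : (forall i, g_sigma_preimage coord (F i)) ->
  g_sigma_preimage coord (\bigcup_i (F i)).
Proof. exact: sigma_algebra_bigcup. Qed.

HB.instance Definition _ :=
  @isMeasurable.Build (measure_tuple_display (R.-ocitv.-measurable).-sigma) 'rV[R]_n
    (g_sigma_preimage coord) rV_set0 rV_setC rV_bigcup.

Lemma measurable_coord_rV (i : 'I_n) :
  measurable_fun [set: 'rV[R]_n] (fun v => v 0 i : measurableTypeR R).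
Proof.
move=> _ Y mY; rewrite setTI; apply: sub_sigma_algebra => /=.
rewrite -bigcup_seq/=; exists i => /=; first by rewrite mem_index_enum.
by exists Y => //; rewrite setTI.
Qed.

Lemma measurable_fun_rV d (T : measurableType d) (f : T -> 'rV[R]_n) :
  (forall i, measurable_fun [set: T] (fun x => f x 0 i : measurableTypeR R)) ->
  measurable_fun [set: T] f.
Proof.
move=> mf.
suff fS : g_sigma_preimage coord `<=`
    [set A | measurable (f @^-1` A)].
  by move=> _ A mA; rewrite setTI; exact: fS.
apply: smallest_sub => /=.
  split => /=.
  - by rewrite preimage_set0.
  - by move=> A mA; rewrite setTD preimage_setC; exact: measurableC.
  - by move=> F mF; rewrite preimage_bigcup; exact: bigcup_measurable.
rewrite -bigcup_seq => A /= [i _ [B mB <-]] /=.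
by rewrite setTI -comp_preimage -[X in measurable X]setTI; exact: mf.
Qed.

End measurable_rV.

Section lebesgue_rV.
Context {R : realType}.

Definition cons_rV n (p : measurableTypeR R * 'rV[R]_n) : 'rV[R]_n.+1 :=
  row_mx (p.1%:M : 'rV[R]_1) p.2.

Lemma measurable_cons_rV n : measurable_fun setT (@cons_rV n).
Proof.
apply: measurable_fun_rV => i; rewrite /cons_rV.
have [->|i0] := eqVneq i ord0.
  rewrite (_ : (fun _ => _) = fst) //; apply/funext => p /=.
  by rewrite mxE; case: splitP => // j _; rewrite ord1 mxE eqxx mulr1n.
have [j ij] : exists j : 'I_n, i = rshift 1 j.
  case: (@splitP 1 n i) => [k ik|k ik].
    by move/eqP: i0; case; apply: val_inj; rewrite /= ik ord1.
  by exists k; exact: val_inj.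
rewrite (_ : (fun _ => _) = (fun v : 'rV[R]_n => v 0 j) \o snd).
  exact: (measurableT_comp (@measurable_coord_rV R n j) measurable_snd).
by apply/funext => p /=; rewrite ij; exact: row_mxEr.
Qed.

Definition uncons_rV n (v : 'rV[R]_n.+1) : measurableTypeR R * 'rV[R]_n :=
  (v 0 0, @rsubmx R 1 1 n v).

Lemma cons_rVK n : cancel (@cons_rV n) (@uncons_rV n).
Proof.
move=> [x v]; rewrite /uncons_rV /cons_rV/= row_mxKr; congr pair.
by rewrite mxE; case: splitP => // j _; rewrite ord1 mxE eqxx mulr1n.
Qed.

Lemma measurable_uncons_rV n : measurable_fun setT (@uncons_rV n).
Proof.
apply: measurable_fun_pair => /=; first exact: (measurable_coord_rV ord0).
apply: measurable_fun_rV => i.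
rewrite (_ : (fun _ => _) = fun v : 'rV[R]_n.+1 => v 0 (rshift 1 i)).
  exact: measurable_coord_rV.
by apply/funext => v; rewrite mxE.
Qed.

Section lebesgue_step.
Variables (n : nat) (m : {sigma_finite_measure set 'rV[R]_n -> \bar R}).

Definition lebesgue_step : set 'rV[R]_n.+1 -> \bar R :=
  pushforward (@lebesgue_measure R \x m)%E (@cons_rV n).

Let lebesgue_step_preimage A :
  measurable A -> measurable (@cons_rV n @^-1` A).
Proof.
by move=> mA; rewrite -[X in measurable X]setTI; exact: measurable_cons_rV.
Qed.

Let lebesgue_step0 : lebesgue_step set0 = 0%E.
Proof. by rewrite /lebesgue_step /pushforward preimage_set0 measure0. Qed.

Let lebesgue_step_ge0 A : (0 <= lebesgue_step A)%E.
Proof. exact: (measure_ge0 (lebesgue_measure \x m)%E). Qed.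

Let lebesgue_step_sigma_additive : semi_sigma_additive lebesgue_step.
Proof.
move=> F mF tF mUF; rewrite /lebesgue_step /pushforward preimage_bigcup.
apply: measure_semi_sigma_additive.
- by move=> k; exact: lebesgue_step_preimage.
- apply/trivIsetP => /= i j _ _ ij; rewrite -preimage_setI.
  by move/trivIsetP : tF => /(_ _ _ _ _ ij) ->//; rewrite preimage_set0.
- by rewrite -preimage_bigcup; exact: lebesgue_step_preimage.
Qed.

HB.instance Definition _ := isMeasure.Build _ _ _ lebesgue_step
  lebesgue_step0 lebesgue_step_ge0 lebesgue_step_sigma_additive.

Let lebesgue_step_sigma_finite : sigma_finite setT lebesgue_step.
Proof.
have /sigma_finiteP[F [TF ndF Foo]] := sigma_finiteT (@lebesgue_measure R).
have /sigma_finiteP[G [TG ndG Goo]] := sigma_finiteT m.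
exists (fun k => @uncons_rV n @^-1` (F k `*` G k)).
  rewrite -preimage_bigcup [X in _ @^-1` X](_ : _ = setT) ?preimage_setT//.
  apply/esym; rewrite -setXTT TF TG predeqE => -[x y]; split.
    move=> [/= [k _ Fkx] [l _ Gly]]; exists (maxn k l) => //; split.
    - by move: x Fkx; exact/subsetPset/ndF/leq_maxl.
    - by move: y Gly; exact/subsetPset/ndG/leq_maxr.
  by move=> [k _ []/= ? ?]; split; exists k.
move=> k; have [mF Fkoo] := Foo k; have [mG Gkoo] := Goo k.
split.
  rewrite -[X in measurable X]setTI; apply: measurable_uncons_rV => //.
  exact: measurableX.
rewrite /lebesgue_step /pushforward -comp_preimage.
rewrite (_ : _ \o _ = id); last first.
  by apply/funext => p /=; rewrite cons_rVK.
by rewrite preimage_id product_measure1E// lte_mul_pinfty// ge0_fin_numE.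
Qed.

HB.instance Definition _ := Measure_isSigmaFinite.Build _ _ _ lebesgue_step
  lebesgue_step_sigma_finite.

End lebesgue_step.

(* [lebesgue_rV n.+1] is the image of the product of the Lebesgue measures of
   [R] and [R^n] under [(x, v) |-> row_mx x%:M v]. *)
Fixpoint lebesgue_rV n : {sigma_finite_measure set 'rV[R]_n -> \bar R} :=
  match n with
  | 0 => \d_(0 : 'rV[R]_0)
  | n'.+1 => lebesgue_step (lebesgue_rV n')
  end.

End lebesgue_rV.
Arguments lebesgue_rV : clear implicits.

Section calculus.
Context {R : realType} {n : nat}.
Local Notation E := 'rV[R]_n.
Implicit Types (u v x : E) (f : E -> R) (U : set E).

(* The library norm on ['rV[R]_n] is the sup norm, hence these definitions of
   the Euclidean scalar product and norm. *)
Definition dotr u v : R := \sum_(i < n) u 0 i * v 0 i.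

Definition enorm v : R := Num.sqrt (dotr v v).

Definition grad f x : E := \row_(i < n) 'D_(delta_mx 0 i) f x.

Definition hessian f x : 'M[R]_n :=
  \matrix_(i < n, j < n) 'D_(delta_mx 0 i) ('D_(delta_mx 0 j) f) x.

(* All partial derivatives up to order [k] exist and are continuous on [U]
   (meant for open [U]). *)
Fixpoint class_C (k : nat) U f : Prop :=
  (forall x, U x -> {for x, continuous f}) /\
  if k is k'.+1 then
    forall i : 'I_n, (forall x, U x -> derivable f x (delta_mx 0 i)) /\
                     class_C k' U ('D_(delta_mx 0 i) f)
  else True.

Definition boundary U : set E := closure U `\` interior U.

Definition test_function U f : Prop :=
  [/\ forall k, class_C k setT f,
      compact (closure [set x | f x != 0]) &
      closure [set x | f x != 0] `<=` U].

End calculus.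

Section sobolev.
Context {R : realType} {n : nat}.
Local Notation E := 'rV[R]_n.
Local Notation mu := (lebesgue_rV R n).
Implicit Types (U : set E) (u : E -> R) (g : E -> E).
Local Open Scope ereal_scope.

Definition square_integrable U u : Prop :=
  measurable_fun U u /\ \int[mu]_(x in U) ((u x) ^+ 2)%:E < +oo.

Definition weak_gradient U u g : Prop :=
  forall (phi : E -> R) (i : 'I_n), test_function U phi ->
    \int[mu]_(x in U) (u x * grad phi x 0 i)%:E =
    - \int[mu]_(x in U) (g x 0 i * phi x)%:E.

(* [u] belongs to [H^1(U)] and [g] represents its weak gradient, which is
   determined almost everywhere by [u]. *)
Definition sobolev_H1 U u g : Prop :=
  [/\ square_integrable U u,
      forall i : 'I_n, square_integrable U (fun x => g x 0%R i) &
      weak_gradient U u g].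

(* [u] belongs to [H^1_0(U)], the closure of [C_0^oo(U)] in [H^1(U)], and [g]
   represents its weak gradient. *)
Definition sobolev_H10 U u g : Prop :=
  sobolev_H1 U u g /\
  exists2 phi : nat -> E -> R, (forall k, test_function U (phi k)) &
    (fun k => \int[mu]_(x in U)
       ((phi k x - u x) ^+ 2 + enorm (grad (phi k) x - g x) ^+ 2)%:E)
      @ \oo --> 0.

End sobolev.

Section anisotropic.
Context {R : realType} {n : nat}.
Local Notation E := 'rV[R]_n.
Local Notation mu := (lebesgue_rV R n).
Implicit Types (F : E -> R) (U : set E) (x : E).

Record strongly_convex_norm F : Prop := StronglyConvexNorm {
  scn_ge0 : forall xi, 0 <= F xi ;
  scn_convex : convex_function setT F ;
  scn_homogeneous : forall (t : R) xi, F (t *: xi) = `|t| * F xi ;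
  scn_coercive : exists2 alpha1 : R, 0 < alpha1 &
                   forall xi, alpha1 * enorm xi <= F xi ;
  scn_C2 : class_C 2 [set~ 0] F ;
  scn_hessian : forall xi v : E, xi != 0 -> v != 0 ->
    0 < (v *m hessian (fun z => F z ^+ 2) xi *m v^T) 0 0 }.

Definition polar F x : R := sup [set dotr xi x / F xi | xi in [set~ 0]].

Definition distF F U x : R := inf [set polar F (x - y) | y in boundary U].

Definition inradiusF F U : \bar R :=
  ereal_sup [set (distF F U x)%:E | x in U].

(* [distF F U] is Lipschitz, so its classical gradient exists almost
   everywhere; elsewhere [grad] takes an irrelevant value. Likewise the value
   of [grad F] at the origin is irrelevant, as [F 0 = 0]. *)
Definition distF_superharmonic F U : Prop :=
  forall phi : E -> R, test_function U phi -> (forall x, 0 <= phi x) ->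
    (0 <= \int[mu]_(x in U)
       (F (grad (distF F U) x) *
        dotr (grad F (grad (distF F U) x)) (grad phi x))%:E)%E.

End anisotropic.

(* Main.v *)
From HB Require Import structures.
Require Import Defs.
From mathcomp Require Import all_boot all_order all_algebra.
From mathcomp Require Import all_classical all_reals all_analysis.
From mathcomp Require Import measurable_realfun.
From mathcomp Require Import ring lra.
Import Order.TTheory GRing.Theory Num.Theory.
Import numFieldNormedType.Exports.
Local Open Scope classical_set_scope.
Local Open Scope ring_scope.
Set Implicit Arguments.
Unset Strict Implicit.
Unset Printing Implicit Defensive.

(**
Put [d] for the distance, [r] for its supremum and [g = 1 / (2 d) - 1 / (2 r)],
which is nonnegative because [d <= r]. At points where [d] is differentiable let
[V = F (grad d) * grad F (grad d)]. The eikonal equation [F (grad d) = 1] and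
Euler's identity give that the product of [V] and [grad d] is [1], and convexity
gives that the product of [V] with any vector [xi] is at most [F xi]. For a test
function [phi], the product of [V] with the gradient of [g * phi ^ 2] is therefore
[- phi ^ 2 / (2 d ^ 2) + 2 g phi b] with [`|b| <= F (grad phi)], and completing the
square ([pointwise_hardy]) bounds it by [F (grad phi) ^ 2] minus
[(1 / (4 d ^ 2) + 1 / (4 r ^ 2)) * phi ^ 2]. Superharmonicity, tested with
[g * phi ^ 2], says that its integral is nonnegative: this is the inequality for
[phi] ([hardy_test_nonzero]), and [hardy_H10] extends it to [H^1_0].

Two points need care, as the distance is only Lipschitz.

- The eikonal equation requires differentiability of [d] almost everywhere. The
  Hessian condition and compactness make [F ^ 2] uniformly convex
  ([scn_uniformly_convex]); by Legendre duality [polar F ^ 2] is semiconcave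
  ([polar_semiconcave]), and so is [d ^ 2], an infimum of its translates
  ([distF_semiconcave]). A concave function on a line is derivable off a countable
  set, so Fubini ([null_of_countable_lines]) gives the partial derivatives almost
  everywhere ([distF_gradient]), and [eikonal] holds there.

- The function [g * phi ^ 2] is not smooth, so it is mollified. The gradients of the
  mollifications have to converge to the pointwise gradient almost everywhere.
  This holds where the partial derivatives exist in a strict sense, uniformly in
  the base point ([sderiv]); for a concave function, monotonicity of slopes turns
  plain derivability along a line into strict derivability ([sderiv_concave]).
*)

(** * Lebesgue measure on row vectors *)

Section cons_rV_lemmas.
Context {R : realType}.

Lemma uncons_rVK n (v : 'rV[R]_n.+1) : @cons_rV R n (uncons_rV v) = v.
Proof.
rewrite /cons_rV /uncons_rV /=; apply/rowP => i; rewrite mxE.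
case: splitP => j ij; rewrite ?ord1 !mxE ?eqxx ?mulr1n.
  by congr (v 0 _); apply: val_inj; rewrite /= ij ord1.
by congr (v 0 _); apply: val_inj; rewrite /= ij.
Qed.

Lemma cons_rV0 n (p : measurableTypeR R * 'rV[R]_n) : @cons_rV R n p 0 ord0 = p.1.
Proof. by rewrite mxE; case: splitP => // j _; rewrite ord1 mxE eqxx mulr1n. Qed.

Lemma cons_rVS n (p : measurableTypeR R * 'rV[R]_n) (i : 'I_n) :
  @cons_rV R n p 0 (rshift 1 i) = p.2 0 i.
Proof. exact: row_mxEr. Qed.

Lemma cons_rV_line0 n (x t : R) (y : 'rV[R]_n) :
  cons_rV (x : measurableTypeR R, y) + t *: delta_mx 0 ord0 =
  cons_rV (x + t : measurableTypeR R, y).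
Proof.
apply/rowP => i; rewrite !mxE; case: (@splitP 1 n i) => j ij; rewrite ?ord1 ?mxE /=.
  by rewrite (_ : i == ord0) ?mulr1// -val_eqE /= ij ord1.
by rewrite (_ : i == ord0 = false) ?mulr0 ?addr0// -val_eqE /= ij.
Qed.

Lemma cons_rV_lineS n (x t : R) (y : 'rV[R]_n) (k : 'I_n) :
  cons_rV (x : measurableTypeR R, y) + t *: delta_mx 0 (rshift 1 k) =
  cons_rV (x : measurableTypeR R, y + t *: delta_mx 0 k).
Proof.
apply/rowP => i; rewrite !mxE; case: (@splitP 1 n i) => j ij; rewrite ?ord1 ?mxE /=.
  by rewrite (_ : i == _ = false) ?mulr0 ?addr0// -val_eqE /= ij ord1.
by congr (_ + _ * _%:R); rewrite -val_eqE /= ij eqSS val_eqE.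
Qed.

Lemma measurable_cons_preimage n (A : set 'rV[R]_n.+1) :
  measurable A -> measurable (@cons_rV R n @^-1` A).
Proof.
by move=> mA; rewrite -[X in measurable X]setTI; exact: measurable_cons_rV.
Qed.

(** The measure is defined by pushing a product measure forward; written with
  sections, it can be computed by induction on the dimension. *)
Lemma lebesgue_rVS n (A : set 'rV[R]_n.+1) :
  lebesgue_rV R n.+1 A =
  (\int[@lebesgue_measure R]_x lebesgue_rV R n (xsection (@cons_rV R n @^-1` A) x))%E.
Proof. by []. Qed.

End cons_rV_lemmas.

Section reflection.
Context {R : realType}.
Local Open Scope ereal_scope.

Lemma measurable_reflect1 (c : R) :
  measurable_fun setT (fun z : measurableTypeR R => (c - z)%R : measurableTypeR R).
Proof. exact: measurable_funB. Qed.

(** Both sides are measures that agree on half-open intervals, as the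
  reflection only exchanges which endpoint is included. *)
Lemma lebesgue_measure_reflect (c : R) (A : set (measurableTypeR R)) :
  measurable A ->
  lebesgue_measure ((fun z : measurableTypeR R => c - z)%R @^-1` A)
  = lebesgue_measure A.
Proof.
move=> mA; have mr := measurable_reflect1 c.
pose r := fun z : measurableTypeR R => (c - z)%R : measurableTypeR R.
rewrite -[LHS]/(pushforward (@lebesgue_measure R) r A).
have mm : measurable_fun setT r by exact: mr.
pose mixin := isMeasurableFun.Build _ _ _ _ _ mm.
pose rp : {mfun _ >-> _} := HB.pack r mixin.
rewrite -[LHS]/(pushforward (@lebesgue_measure R) rp A).
symmetry; apply: lebesgue_measure_unique => // X [[a b] /= _ <-].
rewrite /pushforward /=.
have -> : r @^-1` `]a, b] = `[(c - b)%R, (c - a)%R[%classic.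
  apply/seteqP; split => z /=; rewrite /r !in_itv /=; lra.
rewrite !lebesgue_measure_itv /= !lte_fin ltrD2l ltrN2.
by case: ifPn => // _; rewrite -!EFinD; congr _%:E; lra.
Qed.

Lemma measurable_reflect n (c : 'rV[R]_n) :
  measurable_fun setT (fun z : 'rV[R]_n => c - z)%R.
Proof.
apply: measurable_fun_rV => i.
rewrite (_ : (fun _ => _) = (fun z : 'rV[R]_n => c 0 i - z 0 i)%R); last first.
  by apply/funext => z; rewrite !mxE.
by apply: measurable_funB => //; exact: measurable_coord_rV.
Qed.

(** Induction on the dimension: reflect the sections by the induction hypothesis,
  then the first coordinate by the one-dimensional case. *)
Lemma lebesgue_rV_reflect n (c : 'rV[R]_n) (A : set 'rV[R]_n) :
  measurable A ->
  lebesgue_rV R n ((fun z => c - z)%R @^-1` A) = lebesgue_rV R n A.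
Proof.
elim: n c A => [|n IH] c A mA.
  congr (lebesgue_rV R 0 _); apply/seteqP; split => z; rewrite /preimage /= [z](thinmx0 z) [(c - _)%R]thinmx0 //.
rewrite !lebesgue_rVS.
have mB := measurable_cons_preimage mA.
set B := _ @^-1` A in mB *.
pose h x := lebesgue_rV R n (xsection B x).
have mh : measurable_fun setT h by exact: measurable_fun_xsection.
pose c' := uncons_rV c.
transitivity (\int[@lebesgue_measure R]_x h (c'.1 - x)%R).
  apply: eq_integral => x _; rewrite /h.
  rewrite -[RHS](IH c'.2); last exact: measurable_xsection mB.
  rewrite (_ : xsection _ x = (fun z => c'.2 - z)%R @^-1` xsection B (c'.1 - x)%R)//.
  have E z : (c - cons_rV (x, z) = cons_rV ((c'.1 - x)%R, (c'.2 - z)%R))%R.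
    rewrite -{1}[c]uncons_rVK /cons_rV /=.
    rewrite -[RHS]/(row_mx (c'.1 - x)%:M (c'.2 - z))%R raddfB.
    by rewrite -add_row_mx -opp_row_mx.
  by apply/seteqP; split => z /=; rewrite /xsection /= /B !inE /= E.
have mr := measurable_reflect1 c'.1.
pose r := fun z : measurableTypeR R => (c'.1 - z)%R : measurableTypeR R.
have := @ge0_integral_pushforward _ _ _ _ R r mr (@lebesgue_measure R) setT h measurableT mh.
rewrite preimage_setT => <-; last by move=> y _; exact: measure_ge0.
apply: eq_measure_integral => /= X mX _; exact: lebesgue_measure_reflect.
Qed.

Lemma ge0_integral_reflect n (c : 'rV[R]_n) (f : 'rV[R]_n -> \bar R) :
  measurable_fun setT f -> (forall x, 0 <= f x) ->
  \int[lebesgue_rV R n]_z f (c - z)%R = \int[lebesgue_rV R n]_z f z.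
Proof.
move=> mf f0.
have := @ge0_integral_pushforward _ _ _ _ R _ (measurable_reflect c) (lebesgue_rV R n) setT f measurableT mf.
rewrite preimage_setT => <-; last by move=> y _; exact: f0.
by apply: eq_measure_integral => [|? X mX _]; [exact: measurable_reflect|exact: lebesgue_rV_reflect].
Qed.

(** The only invariance of the Lebesgue measure that convolutions require: it
  exchanges the roles of the function and of the kernel. *)
Lemma integral_reflect n (c : 'rV[R]_n) (f : 'rV[R]_n -> \bar R) :
  measurable_fun setT f ->
  \int[lebesgue_rV R n]_z f (c - z)%R = \int[lebesgue_rV R n]_z f z.
Proof.
move=> mf; rewrite [LHS]integralE [RHS]integralE.
congr (_ - _).
- rewrite -[RHS](ge0_integral_reflect c (measurable_funepos mf)) => [|x]; last exact: funepos_ge0.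
  by apply: eq_integral => x _; rewrite !unlock.
- rewrite -[RHS](ge0_integral_reflect c (measurable_funeneg mf)) => [|x]; last exact: funeneg_ge0.
  by apply: eq_integral => x _; rewrite !unlock.
Qed.

End reflection.

Section null_lines.
Context {R : realType}.
Local Open Scope ereal_scope.

(** By Fubini in the [i]-th coordinate, since countable sets of reals are null.
  This is what replaces Rademacher's theorem in the study of the distance. *)
Lemma null_of_countable_lines n (i : 'I_n) (N : set 'rV[R]_n) : measurable N ->
  (forall x : 'rV[R]_n, countable [set t : R | N (x + t *: delta_mx 0 i)%R]) ->
  lebesgue_rV R n N = 0.
Proof.
elim: n i N => [[]//|n IH] i N mN cN.
have mB := measurable_cons_preimage mN.
rewrite lebesgue_rVS; set B := _ @^-1` N in mB *.
have [i0|i0] := eqVneq i ord0.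
  (* lines in the first coordinate: integrate over that coordinate first *)
  have := indic_fubini_tonelli (@lebesgue_measure R) (lebesgue_rV R n) mB.
  rewrite indic_fubini_tonelli_FE// indic_fubini_tonelli_GE// => ->.
  apply: integral0_eq => y _ /=; apply: countable_lebesgue_measure0.
  have := cN (cons_rV (0%R : measurableTypeR R, y)).
  congr countable; apply/seteqP; split => t /=; rewrite /ysection /= /B !inE /=;
    by rewrite i0 cons_rV_line0 add0r.
have [j ij] : exists j : 'I_n, i = rshift 1 j.
  case: (@splitP 1 n i) => [k ik|k ik].
    by move/eqP: i0; case; apply: val_inj; rewrite /= ik ord1.
  by exists k; exact: val_inj.
apply: integral0_eq => x _; apply: (IH j); first exact: measurable_xsection.
move=> y; have := cN (cons_rV (x, y)); congr countable.
apply/seteqP; split => t /=; rewrite /xsection /= /B !inE /=;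
  by rewrite ij cons_rV_lineS.
Qed.

End null_lines.

(** * Borel sets and balls of the sup norm *)

Section rV_norm.
Context {R : realType}.

Lemma rV_norm_leP n (x : 'rV[R]_n) (s : R) : 0 <= s ->
  reflect (forall i, `|x 0 i| <= s) (`|x| <= s).
Proof.
move=> s0; rewrite -[`|x|]/(mx_norm x) mx_normrE; apply: (iffP (bigmax_leP _ _ _ _)).
  by move=> [_ H] i; exact: (H (0, i)).
by move=> H; split => // -[i j] _ /=; rewrite ord1.
Qed.

Lemma rV_norm_ltP n (x : 'rV[R]_n) (s : R) : 0 < s ->
  reflect (forall i, `|x 0 i| < s) (`|x| < s).
Proof.
move=> s0; rewrite -[`|x|]/(mx_norm x) mx_normrE; apply: (iffP (bigmax_ltP _ _ _ _)).
  by move=> [_ H] i; exact: (H (0, i)).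
by move=> H; split => // -[i j] _ /=; rewrite ord1.
Qed.

Lemma le_coord_norm n (x : 'rV[R]_n) i : `|x 0 i| <= `|x|.
Proof. by move: i; apply/rV_norm_leP. Qed.

Lemma norm_delta_mx n (i : 'I_n) : `|delta_mx 0 i : 'rV[R]_n| <= 1.
Proof.
apply/rV_norm_leP => // j; rewrite mxE; case: (_ && _); rewrite ?normr1 ?normr0//.
Qed.

End rV_norm.

Section measurable_rV.
Context {R : realType} {n : nat}.
Local Notation E := 'rV[R]_n.

Lemma measurable_box (P : 'I_n -> set (measurableTypeR R)) :
  (forall i, measurable (P i)) -> measurable [set z : E | forall i, P i (z 0 i)].
Proof.
move=> mP.
rewrite (_ : [set z | _] = \bigcap_(i in [set: 'I_n])
    ((fun z : E => z 0 i : measurableTypeR R) @^-1` P i)).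
  apply: fin_bigcap_measurable => // i _.
  by rewrite -[X in measurable X]setTI; exact: measurable_coord_rV.
by apply/seteqP; split => z /= H i; [move=> _|]; exact: H.
Qed.

(** The sigma-algebra is generated by the coordinates, so open sets have to be
  recovered as countable unions of boxes with rational centres and radii
  [1 / (m + 1)]. *)
Lemma open_measurable_rV (U : set E) : open U -> measurable U.
Proof.
move=> oU.
pose box (p : 'rV[rat]_n * nat) : set E :=
  [set z | forall i, `|z 0 i - ratr (p.1 0 i)| < p.2.+1%:R^-1].
have mbox p : measurable (box p).
  pose P i : set (measurableTypeR R) := ball (ratr (p.1 0 i) : R) p.2.+1%:R^-1.
  rewrite (_ : box p = [set z : E | forall i, P i (z 0 i)]).
    by apply: measurable_box => i; exact: measurable_ball.
  by apply/seteqP; split => z /= H i; have := H i; rewrite /P /= -ball_normE /= distrC.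
pose F k := if (unpickle k : option ('rV[rat]_n * nat)) is Some p then
  if `[< box p `<=` U >] then box p else set0 else set0.
rewrite (_ : U = \bigcup_k F k).
  apply: bigcupT_measurable => k; rewrite /F.
  by case: unpickle => // p; case: ifP.
apply/seteqP; split => x.
  move=> Ux; have /nbhs_ballP[e /= e0 He] : nbhs x U by exact: open_nbhs_nbhs.
  have [m Hm] : exists m, m.+1%:R^-1 < e / 2.
    have e20 : 0 < e / 2 by lra.
    by have [m _ Hm] := near_infty_natSinv_lt (PosNum e20); exists m; exact: Hm (leqnn m).
  have m0 : 0 < m.+1%:R^-1 :> R by rewrite invr_gt0.
  have /choice[q Hq] (i : 'I_n) : exists q : rat, `|x 0 i - ratr q| < m.+1%:R^-1.
    have Hlt : x 0 i - m.+1%:R^-1 < x 0 i + m.+1%:R^-1.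
      by move: m0; set t := _^-1; lra.
    by have [q] := rat_in_itvoo Hlt; rewrite in_itv /= => Hq; exists q; rewrite ltr_distlC.
  pose p := ((\row_i q i) : 'rV[rat]_n, m).
  exists (pickle p) => //; rewrite /F pickleK ifT.
    by move=> i; rewrite !mxE.
  apply/asboolP => z /= Hz; apply: He; rewrite -ball_normE /=.
  apply/rV_norm_ltP => // i; rewrite !mxE.
  have := Hz i; rewrite mxE /= => h1; have h2 := Hq i.
  rewrite (_ : _ - _ = x 0 i - ratr (q i) - (z 0 i - ratr (q i))); last by ring.
  apply: le_lt_trans (ler_normB _ _) _; rewrite (splitr e).
  by apply: ltrD; apply: lt_trans Hm.
move=> [k _]; rewrite /F; case: unpickle => // p; case: ifP => // /asboolP; exact.
Qed.

Lemma closed_measurable_rV (U : set E) : closed U -> measurable U.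
Proof.
by move=> cU; rewrite -[U]setCK; apply: measurableC; apply: open_measurable_rV; exact: closed_openC.
Qed.

Lemma continuous_measurable_rV (f : E -> R) (U : set E) : open U ->
  (forall x, U x -> {for x, continuous f}) -> measurable_fun U f.
Proof.
move=> oU cf; apply: (measurability (@RGenOInfty.G R)).
  exact: RGenOInfty.measurableE.
move=> _ [_ [a ->] <-]; apply: open_measurable_rV.
rewrite openE => x [Ux /=]; rewrite in_itv /= andbT => fa.
apply: filterI; first exact: open_nbhs_nbhs.
have : nbhs (f x) `]a, +oo[%classic.
  by apply: open_nbhs_nbhs; split => //=; rewrite in_itv /= andbT.
exact: cf.
Qed.

Lemma measurable_fun_rV_in d (T : measurableType d) (D : set T) (f : T -> E) :
  measurable D ->
  (forall i, measurable_fun D (fun x => f x 0 i : measurableTypeR R)) ->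
  measurable_fun D f.
Proof.
move=> mD mf; apply/(measurable_restrictT _ mD)/measurable_fun_rV => i.
rewrite (_ : (fun _ => _) = (fun x => f x 0 i : measurableTypeR R) \_ D).
  exact/(measurable_restrictT _ mD).
by apply/funext => x; rewrite !patchE; case: ifP => // _; rewrite mxE.
Qed.

Lemma measurable_fun_comp_rV d (T : measurableType d) (D : set T) (f : T -> E)
    (h : E -> R) : measurable D -> measurable_fun setT h ->
  (forall i, measurable_fun D (fun x => f x 0 i : measurableTypeR R)) ->
  measurable_fun D (h \o f).
Proof.
move=> mD mh mf; apply: measurableT_comp => //; exact: measurable_fun_rV_in.
Qed.

End measurable_rV.

Section ball_measure.
Context {R : realType}.

Lemma lebesgue_rV_box n (c : 'rV[R]_n) (s : R) : 0 <= s ->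
  lebesgue_rV R n [set z : 'rV[R]_n | forall i, `|z 0 i - c 0 i| <= s] = ((2 * s) ^+ n)%:E.
Proof.
move=> s0; elim: n c => [|n IH] c.
  by rewrite /= diracE expr0 mem_set// => -[].
have mB m (c' : 'rV[R]_m) : measurable [set z : 'rV[R]_m | forall i, `|z 0 i - c' 0 i| <= s].
  pose P i : set (measurableTypeR R) := closed_ball_ Num.norm (c' 0 i) s.
  rewrite (_ : [set _ | _] = [set z : 'rV_m | forall i, P i (z 0 i)]).
    apply: measurable_box => i; apply: closed_measurable.
    exact: closed_closed_ball_.
  by apply/seteqP; split => z /= H i; have := H i; rewrite distrC.
pose p := uncons_rV c.
set S : set 'rV[R]_n.+1 := [set z : 'rV[R]_n.+1 | _].
rewrite -[LHS]/((@lebesgue_measure R \x lebesgue_rV R n)%E (@cons_rV R n @^-1` S)).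
rewrite (_ : @cons_rV R n @^-1` S = `[p.1 - s, p.1 + s]%classic `*`
   [set z : 'rV[R]_n | forall i, `|z 0 i - p.2 0 i| <= s]).
  rewrite product_measure1E// ?IH; last exact: mB.
  rewrite [X in (X * _)%E]/= lebesgue_measure_itv /= lte_fin.
  case: ltP => [_|H].
    by rewrite -EFinB -EFinM exprS; congr (_ * _)%:E; lra.
  have -> : s = 0 by lra.
  by rewrite mul0e mulr0 expr0n.
apply/seteqP; split => -[x y] /=.
  move=> H; split; first by have := H ord0; rewrite cons_rV0 /= in_itv /= ler_distlC; lra.
  by move=> i; have := H (rshift 1 i); rewrite cons_rVS /p /= mxE.
rewrite in_itv /= => -[H1 H2] i; rewrite -[c]uncons_rVK.
case: (@splitP 1 n i) => j ij.
  have -> : i = ord0 by apply: val_inj; rewrite /= ij ord1.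
  by rewrite !cons_rV0 /= ler_distlC; move: H1; rewrite /p /=; lra.
have -> : i = rshift 1 j by exact: val_inj.
by rewrite !cons_rVS; exact: H2.
Qed.

Lemma lebesgue_rV_closed_ball n (c : 'rV[R]_n) (s : R) : 0 <= s ->
  lebesgue_rV R n [set z | `|z - c| <= s] = ((2 * s) ^+ n)%:E.
Proof.
move=> s0; rewrite -(lebesgue_rV_box c s0); congr (lebesgue_rV R n _).
apply/seteqP; split => z /=.
  by move=> /(rV_norm_leP _ s0) H i; have := H i; rewrite !mxE.
by move=> H; apply/rV_norm_leP => // i; rewrite !mxE.
Qed.

End ball_measure.

(** * Strict derivability *)

Section strict_derivability.
Context {R : realType} {n : nat}.
Local Notation E := 'rV[R]_n.
Implicit Types (f g : E -> R) (x y v : E).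

Definition diff_quotient f v (p : E * R) : R := p.2^-1 * (f (p.1 + p.2 *: v) - f p.1).

(** Directional derivability uniformly in the base point near [x]. It is stable
  under averaging the function over small translations, so mollifications have
  partial derivatives that converge at such a point; and in the coordinate
  directions it implies Frechet differentiability. *)
Definition sderiv f x v (l : R) := diff_quotient f v @ filter_prod (nbhs x) (0 : R)^' --> l.

Lemma sderivP f x v l : sderiv f x v l <->
  forall e, 0 < e -> exists2 d, 0 < d & forall y t, `|y - x| < d -> `|t| < d ->
    `|f (y + t *: v) - f y - t * l| <= e * `|t|.
Proof.
split => [H e e0|H].
  have /cvgrPdist_le/(_ _ e0) := H.
  move=> [[A B] /= [/nbhs_ballP[a /= a0 Ha]]].
  rewrite /dnbhs /within /= => /nbhs_ballP[b /= b0 Hb] HAB.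
  exists (Num.min a b) => [|y t]; first by rewrite lt_min a0.
  rewrite !lt_min => /andP[ya _] /andP[_ tb].
  have [->|t0] := eqVneq t 0.
    by rewrite scale0r addr0 subrr mul0r subr0 normr0 mulr0.
  have := HAB (y, t); rewrite /diff_quotient /=.
  have Ay : A y by apply: Ha; rewrite -ball_normE /= distrC.
  have Bt : B t by apply: Hb => //; rewrite -ball_normE /= sub0r normrN.
  have tp : 0 < `|t| by rewrite normr_gt0.
  move=> /(_ (conj Ay Bt)); rewrite -(ler_pM2r tp) -normrM mulrBl mulrAC mulVf//.
  by rewrite mul1r distrC [l * t]mulrC.
apply/cvgrPdist_le => e e0; have [d d0 {}H] := H _ e0.
exists ([set y | `|y - x| < d], [set t | `|t| < d /\ t != 0]).
  split => /=.
    apply/nbhs_ballP; exists d => //= y; by rewrite -ball_normE /= distrC.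
  rewrite /dnbhs /within /=; apply/nbhs_ballP; exists d => //= t.
  by rewrite -ball_normE /= sub0r normrN.
move=> [y t] /= [yd [td t0]]; rewrite /diff_quotient /=.
have tp : 0 < `|t| by rewrite normr_gt0.
rewrite -(ler_pM2r tp) -normrM mulrBl mulrAC mulVf// mul1r distrC [l * t]mulrC.
exact: H.
Qed.

Lemma sderiv_is_derive f x v l : sderiv f x v l -> is_derive x v f l.
Proof.
move=> H; have C : (fun h => h^-1 *: ((f \o shift x) (h *: v) - f x)) @ (0 : R)^' --> l.
  rewrite (_ : (fun h => _) = (fun h => diff_quotient f v (x, h))); last first.
    by apply/funext => h; rewrite /diff_quotient /= [x + _]addrC.
  apply: (@cvg_comp _ _ _ (fun h : R => (x, h)) (diff_quotient f v) _ _ _ _ H).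
  move=> P [[A B] /= [Ax B0] AB]; apply: (filterS _ B0) => h Bh ; by apply: AB; split => //=; exact: nbhs_singleton.
by split; [apply/cvg_ex; exists l|exact: cvg_lim C].
Qed.

Section rules.
Variables (x v : E).
Let FF := filter_prod (nbhs x) (0 : R)^'.

Let cvg_fst_FF : (fst : E * R -> E) @ FF --> x.
Proof. exact: cvg_fst. Qed.

Let cvg_shift_FF : (fun p : E * R => p.1 + p.2 *: v) @ FF --> x.
Proof.
rewrite -[X in _ --> X](addr0) -(scale0r v); apply: cvgD; first exact: cvg_fst_FF.
apply: cvgZl; apply: cvg_trans; first exact: cvg_snd.
exact: nbhs_dnbhs.
Qed.

Lemma sderivM f g lf lg : {for x, continuous f} -> {for x, continuous g} ->
  sderiv f x v lf -> sderiv g x v lg ->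
  sderiv (fun y => f y * g y) x v (lf * g x + f x * lg).
Proof.
move=> cf cg df dg; rewrite /sderiv.
rewrite (_ : diff_quotient _ v = (fun p => diff_quotient f v p * g (p.1 + p.2 *: v) + f p.1 * diff_quotient g v p)).
  apply: cvgD; apply: cvgM => //.
    by apply: (cvg_comp _ _ cvg_shift_FF); exact: cg.
  by apply: (cvg_comp _ _ cvg_fst_FF); exact: cf.
by apply/funext => p; rewrite /diff_quotient; ring.
Qed.

Lemma sderivD f g lf lg : sderiv f x v lf -> sderiv g x v lg ->
  sderiv (fun y => f y + g y) x v (lf + lg).
Proof.
move=> df dg; rewrite /sderiv.
rewrite (_ : diff_quotient _ v = (fun p => diff_quotient f v p + diff_quotient g v p)); first exact: cvgD.
by apply/funext => p; rewrite /diff_quotient; ring.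
Qed.

Lemma sderiv_cst (c : R) : sderiv (fun=> c) x v 0.
Proof.
rewrite /sderiv (_ : diff_quotient _ v = (fun=> 0)); first exact: cvg_cst.
by apply/funext => p; rewrite /diff_quotient subrr mulr0.
Qed.

Lemma sderivZ f l (c : R) : sderiv f x v l ->
  sderiv (fun y => c * f y) x v (c * l).
Proof.
move=> H; have [->|c0] := eqVneq c 0.
  rewrite mul0r; rewrite (_ : (fun y => 0 * f y) = fun=> 0); first exact: sderiv_cst.
  by apply/funext => y; rewrite mul0r.
have cp : 0 < `|c| by rewrite normr_gt0.
apply/sderivP => e e0; have /sderivP/(_ _ (divr_gt0 e0 cp))[d d0 Hd] := H.
exists d => // y t yd td.
rewrite (_ : _ - _ = c * (f (y + t *: v) - f y - t * l)); last by ring.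
by rewrite normrM -ler_pdivlMl// mulrA [_^-1 * _]mulrC Hd.
Qed.

Lemma sderiv_near f g l : {near x, f =1 g} -> sderiv f x v l -> sderiv g x v l.
Proof.
move=> fg; apply: cvg_trans; apply: near_eq_cvg.
have A : \forall p \near FF, f p.1 = g p.1 by exact: (cvg_fst_FF fg).
have B : \forall p \near FF, f (p.1 + p.2 *: v) = g (p.1 + p.2 *: v).
  exact: (cvg_shift_FF fg).
near=> p; have e1 : f p.1 = g p.1 by near: p.
have e2 : f (p.1 + p.2 *: v) = g (p.1 + p.2 *: v) by near: p.
by rewrite /diff_quotient e1 e2.
Unshelve. all: by end_near. Qed.

(** A square root inherits strict derivability: the increment of [f ^ 2] is the
  increment of [f] times [f y' + f y], which tends to [2 * f x]. *)
Lemma sderiv_of_sqr f l : {for x, continuous f} -> f x != 0 ->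
  sderiv (fun y => f y ^+ 2) x v l -> sderiv f x v (l / (2 * f x)).
Proof.
move=> cf fx0 df; rewrite /sderiv.
have C1 : (fun p : E * R => f (p.1 + p.2 *: v) + f p.1) @ FF --> 2 * f x.
  rewrite mulr_natl mulr2n; apply: cvgD.
    by apply: (cvg_comp _ _ cvg_shift_FF); exact: cf.
  by apply: (cvg_comp _ _ cvg_fst_FF); exact: cf.
have f2 : 2 * f x != 0 by rewrite mulf_neq0.
have : (fun p => diff_quotient (fun y => f y ^+ 2) v p / (f (p.1 + p.2 *: v) + f p.1)) @ FF --> l / (2 * f x).
  by apply: cvgM => //; apply: cvgV.
apply: cvg_trans; apply: near_eq_cvg.
have N : \forall p \near FF, f (p.1 + p.2 *: v) + f p.1 != 0.
  have := C1 [set t | t != 0]; apply.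
  by apply: open_nbhs_nbhs; split => //; exact: open_neq.
near=> p; rewrite /diff_quotient; have p0 : f (p.1 + p.2 *: v) + f p.1 != 0 by near: p.
by rewrite subr_sqr mulrA mulfK.
Unshelve. all: by end_near. Qed.

Lemma sderivV f l : {for x, continuous f} -> f x != 0 ->
  sderiv f x v l -> sderiv (fun y => (f y)^-1) x v (- l / f x ^+ 2).
Proof.
move=> cf fx0 df; rewrite /sderiv.
have C1 : (fun p : E * R => f (p.1 + p.2 *: v)) @ FF --> f x.
  by apply: (cvg_comp _ _ cvg_shift_FF); exact: cf.
have C2 : (fun p : E * R => f p.1) @ FF --> f x.
  by apply: (cvg_comp _ _ cvg_fst_FF); exact: cf.
have : (fun p => - diff_quotient f v p / (f (p.1 + p.2 *: v) * f p.1)) @ FF --> - l / f x ^+ 2.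
  apply: cvgM; first exact: cvgN.
  by apply: cvgV; [rewrite expf_neq0|rewrite expr2; apply: cvgM].
apply: cvg_trans; apply: near_eq_cvg.
have N1 : \forall p \near FF, f (p.1 + p.2 *: v) != 0.
  by have := C1 [set t | t != 0]; apply; apply: open_nbhs_nbhs; split => //; exact: open_neq.
have N2 : \forall p \near FF, f p.1 != 0.
  by have := C2 [set t | t != 0]; apply; apply: open_nbhs_nbhs; split => //; exact: open_neq.
near=> p; have p1 : f (p.1 + p.2 *: v) != 0 by near: p.
have p2 : f p.1 != 0 by near: p.
by rewrite /diff_quotient -mulrN -mulrA; congr (_ * _); field; rewrite p1 p2.
Unshelve. all: by end_near. Qed.

End rules.

End strict_derivability.

(** * Calculus along lines *)

Section calculus_along_lines.
Context {R : realType} {n : nat}.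
Local Notation E := 'rV[R]_n.
Implicit Types (f g : E -> R) (x y v : E).

Lemma continuous_distP f x : {for x, continuous f} <->
  forall e, 0 < e -> exists2 d, 0 < d & forall y, `|y - x| < d -> `|f y - f x| <= e.
Proof.
have FF : Filter (nbhs x) by exact: nbhs_filter.
split => [H e e0|H].
  have /cvgrPdist_le/(_ _ e0) /nbhs_ballP[d /= d0 Hd] := H.
  exists d => // y yd; rewrite distrC; apply: Hd.
  by rewrite -ball_normE /= distrC.
apply: (iffRL (@cvgrPdist_le _ _ _ (nbhs x) FF f (f x))) => e e0.
have [d d0 Hd] := H _ e0; apply/nbhs_ballP; exists d => // y.
by rewrite -ball_normE /= distrC => /Hd; rewrite distrC.
Qed.

Lemma continuous_cst_for (c : R) x : {for x, continuous (fun _ : E => c)}.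
Proof.
by apply/continuous_distP => e e0; exists 1 => // y _; rewrite subrr normr0 ltW.
Qed.

Lemma is_derive_line f x v (s l : R) : is_derive (x + s *: v) v f l ->
  is_derive s 1 (fun t : R => f (x + t *: v)) l.
Proof.
move=> [df <-].
have E : (fun h : R => h^-1 *: (((fun t : R => f (x + t *: v)) \o shift s) (h *: 1) - f (x + s *: v)))
  = (fun h => h^-1 *: ((f \o shift (x + s *: v)) (h *: v) - f (x + s *: v))).
  apply/funext => h /=; congr (_ *: (f _ - _)).
  by rewrite [h *: 1]mulr1 scalerDl addrCA.
by split; [rewrite /derivable E|rewrite /derive E].
Qed.

Lemma derive_line f x v (t : R) :
  (forall s, `|s| <= `|t| -> derivable f (x + s *: v) v) ->
  exists2 s, `|s| <= `|t| & f (x + t *: v) - f x = t * 'D_v f (x + s *: v).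
Proof.
move=> df.
have dg (s : R) : `|s| <= `|t| -> is_derive s 1 (fun t : R => f (x + t *: v)) ('D_v f (x + s *: v)).
  by move=> st; apply: is_derive_line; apply: derivableP; exact: df.
have cg (s : R) : `|s| <= `|t| -> {for s, continuous (fun t : R => f (x + t *: v))}.
  move=> /dg[D _]; apply: differentiable_continuous; exact/derivable1_diffP.
have [t0|t0|t0] := ltgtP t 0.
- have [||c + H] := @MVT R (fun t : R => f (x + t *: v)) (fun s => 'D_v f (x + s *: v)) t 0 t0.
  + move=> s; rewrite in_itv /= => /andP[a b]; apply: dg; rewrite !ltr0_norm//; lra.
  + apply: continuous_in_subspaceT => s; rewrite inE /= in_itv /= => /andP[a b].
    by apply: cg; rewrite !ler0_norm//; lra.
  rewrite in_itv /= => /andP[a b]; exists c; first by rewrite !ltr0_norm//; lra.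
  move: H; rewrite scale0r addr0 sub0r mulrN => H.
  by rewrite [t * _]mulrC -[RHS]opprK -H opprB.
- have [||c + H] := @MVT R (fun t : R => f (x + t *: v)) (fun s => 'D_v f (x + s *: v)) 0 t t0.
  + move=> s; rewrite in_itv /= => /andP[a b]; apply: dg; rewrite !gtr0_norm//; lra.
  + apply: continuous_in_subspaceT => s; rewrite inE /= in_itv /= => /andP[a b].
    by apply: cg; rewrite !ger0_norm//; lra.
  rewrite in_itv /= => /andP[a b]; exists c; first by rewrite !gtr0_norm//; lra.
  by move: H; rewrite scale0r addr0 subr0 mulrC.
- by exists 0; [rewrite normr0|rewrite t0 scale0r addr0 subrr mul0r].
Qed.

(** Mean value theorem along the line through the moving base point. *)
Lemma sderiv_of_C1 f (U : set E) x v : open U -> U x ->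
  (forall y, U y -> derivable f y v) -> {for x, continuous ('D_v f)} ->
  sderiv f x v ('D_v f x).
Proof.
move=> oU Ux df cf; apply/sderivP => e e0.
have /cvgrPdist_le/(_ _ e0) /nbhs_ballP[a /= a0 Ha] := cf.
have /nbhs_ballP[b /= b0 Hb] : nbhs x U by exact: open_nbhs_nbhs.
pose m := Num.min a b; have m0 : 0 < m by rewrite lt_min a0.
have v1 : 0 < 1 + `|v| by rewrite ltr_pwDl.
exists (m / 2 / (1 + `|v|)) => [|y t yd td]; first by rewrite !divr_gt0.
have near_x s : `|s| <= `|t| -> `|y + s *: v - x| < m.
  move=> st; rewrite addrAC; apply: le_lt_trans (ler_normD _ _) _.
  rewrite normrZ; rewrite ltr_pdivlMr// in yd; rewrite ltr_pdivlMr// in td.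
  have := normr_ge0 v; have := normr_ge0 (y - x); have := normr_ge0 s; nra.
have [s st|s st ->] := @derive_line f y v t.
  apply/df/Hb; rewrite -ball_normE /= distrC.
  by have := near_x _ st; rewrite lt_min => /andP[].
rewrite -mulrBr normrM mulrC ler_wpM2r// distrC; apply: Ha.
by rewrite -ball_normE /= distrC; have := near_x _ st; rewrite lt_min => /andP[].
Qed.

(** The sums of the first coordinate components of [h] are the vertices of a path
  from [0] to [h] that follows the axes and stays in the ball of radius [`|h|]. *)
Let psum (h : E) (s : seq 'I_n) : E := \sum_(i <- s) h 0 i *: delta_mx 0 i.

Let psumE h : h = psum h (index_enum 'I_n).
Proof. exact: row_sum_delta. Qed.

Let psum_cons h i s : psum h (i :: s) = psum h s + h 0 i *: delta_mx 0 i.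
Proof. by rewrite /psum big_cons addrC. Qed.

Let norm_psum h s : uniq s -> `|psum h s| <= `|h|.
Proof.
move=> us; apply/rV_norm_leP => // j; rewrite /psum summxE.
under eq_bigr do rewrite mxE mxE eqxx /=.
have [js|js] := boolP (j \in s).
  rewrite (bigD1_seq j)//= eqxx mulr1 big1 ?addr0 ?le_coord_norm//.
  by move=> i; rewrite eq_sym => /negbTE ->; rewrite mulr0.
rewrite big1_seq ?normr0// => i /= si; rewrite (_ : j == i = false) ?mulr0//.
by apply: contraNF js => /eqP ->.
Qed.

Lemma le_coord_sum h : \sum_(i < n) `|(h : E) 0 i| <= n%:R * `|h|.
Proof.
apply: (@le_trans _ _ (\sum_(i < n) `|h|)); first by apply: ler_sum => i _; exact: le_coord_norm.
by rewrite sumr_const card_ord mulr_natl.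
Qed.

Lemma lipschitz_of_partials f M : 0 <= M ->
  (forall x i (t : R), `|f (x + t *: delta_mx 0 i) - f x| <= M * `|t|) ->
  forall x y, `|f x - f y| <= M * n%:R * `|x - y|.
Proof.
move=> M0 H x y; rewrite -mulrA.
apply: le_trans (ler_wpM2l M0 (le_coord_sum (x - y))).
rewrite -{1}(subrKC y x) {1}(psumE (x - y)); elim: index_enum => [|i s IH].
  by rewrite /psum !big_nil addr0 subrr normr0 mulr0.
rewrite psum_cons addrA big_cons mulrDr.
set z := y + psum _ s; rewrite -(subrK (f z) (f (z + _))) -addrA.
by apply: le_trans (ler_normD _ _) _; apply: lerD; [exact: H|exact: IH].
Qed.

(** Strict derivability in the coordinate directions gives Frechet
  differentiability, by moving one coordinate at a time. *)
Lemma sderiv_total f x (p : E) :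
  (forall i, sderiv f x (delta_mx 0 i) (p 0 i)) ->
  forall e, 0 < e -> exists2 d, 0 < d & forall h : E, `|h| < d ->
    `|f (x + h) - f x - dotr h p| <= e * `|h|.
Proof.
move=> H e e0; pose e' := e / n.+1%:R.
have e'0 : 0 < e' by rewrite divr_gt0.
have /choice[D HD] (i : 'I_n) : exists d : R, 0 < d /\ forall y t, `|y - x| < d -> `|t| < d ->
    `|f (y + t *: delta_mx 0 i) - f y - t * p 0 i| <= e' * `|t|.
  by have /sderivP/(_ _ e'0)[d d0 Hd] := H i; exists d.
pose d := \big[Num.min/1]_(i < n) D i.
exists d => [|h hd].
  by apply/bigmin_gtP => /=; split => // i _; have [] := HD i.
have dD i : d <= D i by exact: bigmin_le_cond.
apply: (@le_trans _ _ (e' * \sum_(i < n) `|h 0 i|)).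
  rewrite /dotr {1}(psumE h); have := index_enum_uniq 'I_n.
  elim: index_enum => [_|i s IH /= /andP[_ us]].
    by rewrite /psum !big_nil addr0 !subrr normr0 mulr0.
  rewrite psum_cons addrA 2!big_cons mulrDr.
  rewrite (_ : _ - _ = (f (x + psum h s + h 0 i *: delta_mx 0 i) - f (x + psum h s) - h 0 i * p 0 i)
     + (f (x + psum h s) - f x - \sum_(j <- s) h 0 j * p 0 j)); last by ring.
  apply: le_trans (ler_normD _ _) _; apply: lerD; last exact: IH.
  apply: (HD i).2.
    by rewrite addrC addKr; apply: le_lt_trans (norm_psum h us) _; apply: lt_le_trans hd _.
  by apply: le_lt_trans (le_coord_norm h i) _; apply: lt_le_trans hd _.
apply: (@le_trans _ _ (e' * (n%:R * `|h|))).
  by apply: ler_wpM2l; [exact: ltW|exact: le_coord_sum].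
rewrite mulrA ler_wpM2r// /e' mulrAC ler_pdivrMr// ler_wpM2l ?(ltW e0)//.
by rewrite ler_nat.
Qed.

Lemma is_derive_total f x (p v : E) :
  (forall i, sderiv f x (delta_mx 0 i) (p 0 i)) -> is_derive x v f (dotr v p).
Proof.
move=> H.
have C : (fun h => h^-1 *: ((f \o shift x) (h *: v) - f x)) @ (0 : R)^' --> dotr v p.
  apply/cvgrPdist_le => e e0.
  have v1 : 0 < 1 + `|v| by rewrite ltr_pwDl.
  have [d d0 Hd] := sderiv_total H (divr_gt0 e0 v1).
  rewrite near_withinE; apply/nbhs_ballP; exists (d / (1 + `|v|)); first by rewrite /= divr_gt0.
  move=> t; rewrite -ball_normE /= sub0r normrN ltr_pdivlMr// => td t0.
  have tp : 0 < `|t| by rewrite normr_gt0.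
  have hv : `|t *: v| < d.
    by rewrite normrZ; apply: le_lt_trans td; rewrite ler_wpM2l// lerDr.
  rewrite -(ler_pM2r tp) -normrM mulrBl [_ *: _]/(_ * _) mulrAC mulVf// mul1r distrC.
  have := Hd _ hv; rewrite (_ : dotr (t *: v) p = dotr v p * t); last first.
    by rewrite /dotr mulr_suml; apply: eq_bigr => i _; rewrite mxE; ring.
  rewrite [x + _]addrC => /le_trans; apply.
  by rewrite normrZ mulrAC ler_pdivrMr// -!mulrA ler_pM2l// ler_pM2l// lerDr.
by split; [apply/cvg_ex; exists (dotr v p)|exact: cvg_lim C].
Qed.

Lemma sderiv_continuous f x (p : E) :
  (forall i, sderiv f x (delta_mx 0 i) (p 0 i)) -> {for x, continuous f}.
Proof.
move=> H; apply/continuous_distP => e e0.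
have [d d0 Hd] := sderiv_total H ltr01.
pose M := \sum_(i < n) `|p 0 i|.
have M0 : 0 <= M by apply: sumr_ge0.
exists (Num.min d (e / (1 + M))) => [|y].
  by rewrite lt_min d0 divr_gt0// ltr_pwDl.
rewrite lt_min => /andP[yd ye].
have := Hd _ yd; rewrite subrKC mul1r => H1.
rewrite -(subrK (dotr (y - x) p) (f y - f x)).
apply: le_trans (ler_normD _ _) _.
rewrite ltr_pdivlMr ?ltr_pwDl// mulrDr mulr1 in ye.
apply: le_trans (ltW ye); apply: lerD => //.
rewrite /dotr /M mulr_sumr; apply: le_trans (ler_norm_sum _ _ _) _.
by apply: ler_sum => i _; rewrite normrM ler_wpM2r// le_coord_norm.
Qed.

End calculus_along_lines.

(** * Second derivatives and convexity *)

Section one_dim.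
Context {R : realType}.

Lemma MVT_cc (g g' : R -> R) (a b : R) : a < b ->
  (forall s : R, a <= s <= b -> is_derive s 1 g (g' s)) ->
  exists2 c, a < c < b & g b - g a = g' c * (b - a).
Proof.
move=> ab dg; have [||c] := @MVT R g g' a b ab.
- by move=> s; rewrite in_itv /= => /andP[? ?]; apply: dg; rewrite !ltW.
- apply: continuous_in_subspaceT => s; rewrite inE /= in_itv /= => /dg[D _].
  by apply: differentiable_continuous; exact/derivable1_diffP.
by rewrite in_itv /= => cab H; exists c.
Qed.

(** The slopes of [r] from [0] to [t] and from [t] to [1] are values of [r'], which
  is nondecreasing. *)
Lemma convex_of_derive2 (r r' r'' : R -> R) :
  (forall s : R, 0 <= s <= 1 -> is_derive s 1 r (r' s)) ->
  (forall s : R, 0 <= s <= 1 -> is_derive s 1 r' (r'' s)) ->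
  (forall s : R, 0 <= s <= 1 -> 0 <= r'' s) ->
  forall t, 0 <= t <= 1 -> r t <= t * r 1 + (1 - t) * r 0.
Proof.
move=> dr dr' r''0 t /andP[]; rewrite le_eqVlt => /predU1P[<-|t0]; first lra.
rewrite le_eqVlt => /predU1P[->|t1]; first lra.
have [|c1 /andP[c10 c1t] H1] := @MVT_cc r r' 0 t t0.
  by move=> s /andP[? ?]; apply: dr; lra.
have [|c2 /andP[c2t c21] H2] := @MVT_cc r r' t 1 t1.
  by move=> s /andP[? ?]; apply: dr; lra.
have [||c /andP[cc1 cc2] H3] := @MVT_cc r' r'' c1 c2; first lra.
  by move=> s /andP[? ?]; apply: dr'; lra.
have r''c : 0 <= r'' c by apply: r''0; lra.
have c12 : 0 <= r' c2 - r' c1 by rewrite H3 mulr_ge0//; lra.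
have : 0 <= t * (1 - t) * (r' c2 - r' c1) by rewrite mulr_ge0// mulr_ge0//; lra.
suff -> : t * (1 - t) * (r' c2 - r' c1) = t * r 1 + (1 - t) * r 0 - r t by rewrite subr_ge0.
have -> : t * (1 - t) * (r' c2 - r' c1) =
  t * (r' c2 * (1 - t)) - (1 - t) * (r' c1 * (t - 0)) by ring.
by rewrite -H1 -H2; ring.
Qed.

(** Subtracting [k * s ^ 2] leaves a convex function. *)
Lemma uniformly_convex_of_derive2 (q q' q'' : R -> R) (k : R) :
  (forall s : R, 0 <= s <= 1 -> is_derive s 1 q (q' s)) ->
  (forall s : R, 0 <= s <= 1 -> is_derive s 1 q' (q'' s)) ->
  (forall s : R, 0 <= s <= 1 -> 2 * k <= q'' s) ->
  forall t, 0 <= t <= 1 -> q t <= t * q 1 + (1 - t) * q 0 - k * t * (1 - t).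
Proof.
move=> dq dq' kq t t01.
pose r (s : R) := q s - k * (s * s).
suff : r t <= t * r 1 + (1 - t) * r 0 by rewrite /r; lra.
apply: (@convex_of_derive2 r (fun s => q' s - (2 * k) * s) (fun s => q'' s - 2 * k)) => //.
- move=> s s01; have ? := dq _ s01.
  have D : is_derive s 1 (fun s : R => k * (s * s)) (2 * k * s).
    have ? : is_derive s 1 (fun x : R => x * x) (s *: 1 + s *: 1) by exact: is_deriveM.
    have ? : is_derive s 1 (fun x : R => k * (x * x)) (k *: (s *: 1 + s *: 1)) by exact: is_deriveZ.
    by apply: is_derive_eq; rewrite /GRing.scale /=; ring.
  exact: is_deriveB.
- move=> s s01; have ? := dq' _ s01.
  have D : is_derive s 1 (fun s : R => 2 * k * s) (2 * k).
    have ? : is_derive s 1 (fun x : R => 2 * k * x) ((2 * k) *: 1) by exact: is_deriveZ.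
    by apply: is_derive_eq; rewrite /GRing.scale /=; ring.
  exact: is_deriveB.
- by move=> s /kq; rewrite subr_ge0.
Qed.

End one_dim.

(** * The Euclidean scalar product *)

Section dot.
Context {R : realType} {n : nat}.
Local Notation E := 'rV[R]_n.
Implicit Types (u v w x : E).

Lemma dotrC u v : dotr u v = dotr v u.
Proof. by apply: eq_bigr => i _; rewrite mulrC. Qed.

Lemma dotrDl u v w : dotr (u + v) w = dotr u w + dotr v w.
Proof. by rewrite /dotr -big_split; apply: eq_bigr => i _; rewrite mxE mulrDl. Qed.

Lemma dotrZl (a : R) u w : dotr (a *: u) w = a * dotr u w.
Proof. by rewrite /dotr mulr_sumr; apply: eq_bigr => i _; rewrite mxE mulrA. Qed.

Lemma dotrDr u v w : dotr w (u + v) = dotr w u + dotr w v.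
Proof. by rewrite !(dotrC w) dotrDl. Qed.

Lemma dotrZr (a : R) u w : dotr w (a *: u) = a * dotr w u.
Proof. by rewrite !(dotrC w) dotrZl. Qed.

Lemma dotrNl u w : dotr (- u) w = - dotr u w.
Proof. by rewrite -scaleN1r dotrZl mulN1r. Qed.

Lemma dotrNr u w : dotr w (- u) = - dotr w u.
Proof. by rewrite !(dotrC w) dotrNl. Qed.

Lemma dotr0l w : dotr 0 w = 0.
Proof. by rewrite -(scale0r 0) dotrZl mul0r. Qed.

Lemma dotr_ge0 v : 0 <= dotr v v.
Proof. by apply: sumr_ge0 => i _; rewrite -expr2 sqr_ge0. Qed.

Lemma dotr_delta i w : dotr (delta_mx 0 i) w = w 0 i.
Proof.
rewrite /dotr (bigD1 i)//= big1 ?addr0 ?mxE ?eqxx ?mul1r//.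
by move=> j /negbTE ji; rewrite mxE eqxx /= ji mul0r.
Qed.

Lemma le_coord_dotr v i : v 0 i ^+ 2 <= dotr v v.
Proof.
rewrite /dotr (bigD1 i)//= -expr2 lerDl; apply: sumr_ge0 => j _.
by rewrite -expr2 sqr_ge0.
Qed.

Lemma norm_le_dotr v : `|v| ^+ 2 <= dotr v v.
Proof.
rewrite -(sqr_sqrtr (dotr_ge0 v)) lerXn2r ?nnegrE ?sqrtr_ge0//.
apply/rV_norm_leP => [|i]; first exact: sqrtr_ge0.
by rewrite -sqrtr_sqr ler_wsqrtr// le_coord_dotr.
Qed.

Lemma dotr_le_norm v : dotr v v <= n%:R * `|v| ^+ 2.
Proof.
apply: (@le_trans _ _ (\sum_(i < n) `|v| ^+ 2)).
  apply: ler_sum => i _; rewrite -expr2 -[X in X <= _](real_normK (num_real _)).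
  by rewrite lerXn2r ?nnegrE// le_coord_norm.
by rewrite sumr_const card_ord mulr_natl.
Qed.

Lemma dotr_gt0 v : v != 0 -> 0 < dotr v v.
Proof.
by move=> v0; apply: lt_le_trans (norm_le_dotr v); rewrite exprn_gt0// normr_gt0.
Qed.

Lemma enorm_sqr v : enorm v ^+ 2 = dotr v v.
Proof. by rewrite sqr_sqrtr// dotr_ge0. Qed.

Lemma enorm_ge0 v : 0 <= enorm v. Proof. exact: sqrtr_ge0. Qed.

Lemma norm_le_enorm v : `|v| <= enorm v.
Proof.
by rewrite -ler_sqr ?nnegrE ?enorm_ge0// enorm_sqr norm_le_dotr.
Qed.

Lemma enorm_le_norm v : enorm v <= (1 + n%:R) * `|v|.
Proof.
rewrite -ler_sqr ?nnegrE ?enorm_ge0 ?mulr_ge0// ?addr_ge0// enorm_sqr exprMn.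
apply: le_trans (dotr_le_norm v) _; rewrite ler_wpM2r ?exprn_ge0//.
have : 0 <= n%:R :> R by []. nra.
Qed.

Lemma cauchy_schwarz u v : dotr u v <= enorm u * enorm v.
Proof.
have [->|v0] := eqVneq v 0.
  by rewrite dotrC dotr0l mulr_ge0// enorm_ge0.
have d0 := dotr_gt0 v0.
have H : dotr u v ^+ 2 <= (enorm u * enorm v) ^+ 2.
  rewrite exprMn !enorm_sqr.
  have := dotr_ge0 (dotr v v *: u - dotr u v *: v).
  rewrite !(dotrDl, dotrDr, dotrNl, dotrNr, dotrZl, dotrZr) (dotrC v u).
  set a := dotr u u; set b := dotr v v in d0 *; set c := dotr u v => H.
  have : 0 <= b * (a * b - c ^+ 2) by apply: le_trans H _; lra.
  by rewrite pmulr_rge0// subr_ge0.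
apply: le_trans (ler_norm _) _.
by rewrite -ler_sqr ?nnegrE ?mulr_ge0 ?enorm_ge0// real_normK ?num_real.
Qed.

(** The exact convexity defect of the square norm: it turns an upper bound of
  this shape on the defect of a function into the concavity of the difference. *)
Lemma dotr_convex (t : R) u v :
  t * dotr u u + (1 - t) * dotr v v
  - dotr (t *: u + (1 - t) *: v) (t *: u + (1 - t) *: v)
  = t * (1 - t) * dotr (u - v) (u - v).
Proof.
rewrite !(dotrDl, dotrDr, dotrNl, dotrNr, dotrZl, dotrZr) (dotrC v u); ring.
Qed.

Lemma is_derive_scale (f : E -> R) (s : R) x v (p : E) :
  (forall i, sderiv f (s *: x) (delta_mx 0 i) (p 0 i)) ->
  is_derive x v (fun y => f (s *: y)) (s * dotr v p).
Proof.
move=> Hs; have := is_derive_total (s *: v) Hs; rewrite dotrZl => -[D1 D2].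
have e : (fun t : R => t^-1 *: (((fun y => f (s *: y)) \o shift x) (t *: v) - f (s *: x)))
  = (fun t : R => t^-1 *: ((f \o shift (s *: x)) (t *: (s *: v)) - f (s *: x))).
  by apply/funext => t /=; congr (_ *: (f _ - _)); rewrite scalerDr !scalerA [s * t]mulrC.
by split; rewrite /derivable /derive e.
Qed.

End dot.

(** * The norm F *)

Section norm_basics.
Context {R : realType} {n : nat}.
Local Notation E := 'rV[R]_n.
Variable (F : E -> R).
Hypothesis hF : strongly_convex_norm F.
Implicit Types (x y p xi v : E).

Lemma scnZ (t : R) x : F (t *: x) = `|t| * F x.
Proof. exact: scn_homogeneous. Qed.

Lemma scn0 : F 0 = 0.
Proof. by rewrite -(scale0r 0) scnZ normr0 mul0r. Qed.

Lemma scnN x : F (- x) = F x.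
Proof. by rewrite -scaleN1r scnZ normrN1 mul1r. Qed.

Lemma scn_le_coercive : exists2 a : R, 0 < a & forall x, a * `|x| <= F x.
Proof.
have [a a0 Ha] := scn_coercive hF; exists a => // x; apply: le_trans (Ha x).
by rewrite ler_wpM2l ?(ltW a0)// norm_le_enorm.
Qed.

Lemma scn_gt0 x : x != 0 -> 0 < F x.
Proof.
move=> x0; have [a a0 Ha] := scn_le_coercive.
by apply: lt_le_trans (Ha x); rewrite mulr_gt0// normr_gt0.
Qed.

Lemma scnD x y : F (x + y) <= F x + F y.
Proof.
have h0 : 0 <= (1 / 2 : R) by lra.
have h1 : (1 / 2 : R) <= 1 by lra.
have H : F ((1 / 2) *: (2 *: x) + (1 - 1 / 2) *: (2 *: y)) <=
    (1 / 2) * F (2 *: x) + (1 - 1 / 2) * F (2 *: y).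
  have := @scn_convex _ _ _ hF (Itv01 h0 h1) (2 *: x) (2 *: y).
  by rewrite !inE => /(_ I I).
have e1 : (1 / 2) *: (2 *: x) = x by rewrite scalerA mulfVK ?scale1r// pnatr_eq0.
have e2 : (1 - 1 / 2) *: (2 *: y) = y.
  rewrite scalerA (_ : (1 - 1 / 2) * 2 = 1) ?scale1r//; lra.
by move: H; rewrite e1 e2 !scnZ ger0_norm//; lra.
Qed.

Lemma scn_le_norm : exists2 C : R, 0 < C & forall x, F x <= C * `|x|.
Proof.
pose S := \sum_(i < n) F (delta_mx 0 i).
have S0 : 0 <= S by apply: sumr_ge0 => i _; exact: scn_ge0.
exists (1 + S) => [|x]; first by rewrite ltr_pwDl.
apply: (@le_trans _ _ (\sum_(i < n) `|x 0 i| * F (delta_mx 0 i))).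
  rewrite [in leLHS](row_sum_delta x); elim/big_rec2: _ => [|i a b _ H].
    by rewrite scn0.
  by apply: le_trans (scnD _ _) _; rewrite scnZ lerD2l.
apply: (@le_trans _ _ (S * `|x|)).
  rewrite /S mulr_suml; apply: ler_sum => i _.
  by rewrite mulrC ler_wpM2l ?le_coord_norm// scn_ge0.
by rewrite ler_wpM2r// lerDr.
Qed.

Lemma scn_dist x y : `|F x - F y| <= F (x - y).
Proof.
rewrite ler_norml; have := scnD (x - y) y; rewrite subrK.
have := scnD (y - x) x; rewrite subrK -(scnN (y - x)) opprB; lra.
Qed.

Lemma scn_continuous x : {for x, continuous F}.
Proof.
have [C C0 HC] := scn_le_norm; apply/continuous_distP => e e0.
exists (e / C) => [|y]; first by rewrite divr_gt0.
rewrite ltr_pdivlMr// mulrC => /ltW; apply: le_trans.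
by apply: le_trans (scn_dist _ _) _.
Qed.

Lemma open_neq0 : open [set~ (0 : E)].
Proof. by apply: closed_openC; apply: accessible_closed_set1; apply: hausdorff_accessible; exact: norm_hausdorff. Qed.

Lemma scn_sderiv p i : p != 0 -> sderiv F p (delta_mx 0 i) (grad F p 0 i).
Proof.
move=> /eqP p0; rewrite mxE.
have [_ /(_ i)[dF [cF _]]] := scn_C2 hF.
by apply: (@sderiv_of_C1 _ _ F [set~ 0]) => //; [exact: open_neq0|exact: cF].
Qed.

(** Compare the differential of [F] at [p] with the bound
  [F (p + t xi) <= F p + t F xi] for small positive [t]. *)
Lemma dotr_grad_le p xi : p != 0 -> dotr xi (grad F p) <= F xi.
Proof.
move=> p0; apply/ler_addgt0Pr => e e0.
have n0 : 0 < 1 + `|xi| by rewrite ltr_pwDl.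
have [d d0 Hd] := sderiv_total (fun i => @scn_sderiv p i p0) (divr_gt0 e0 n0).
pose t := d / 2 / (1 + `|xi|).
have t0 : 0 < t by rewrite !divr_gt0.
have tx : `|t *: xi| < d.
  rewrite normrZ gtr0_norm// /t mulrAC ltr_pdivrMr//.
  have := normr_ge0 xi; nra.
have := Hd _ tx; rewrite ler_norml => /andP[H _].
have := scnD p (t *: xi); rewrite scnZ dotrZl normrZ !(gtr0_norm t0) in H * => H2.
rewrite -(ler_pM2l t0).
have : e / (1 + `|xi|) * (t * `|xi|) <= t * e.
  by rewrite mulrAC ler_pdivrMr//; have := mulr_gt0 e0 t0; lra.
lra.
Qed.

(** Euler's identity for a function that is homogeneous of degree one. *)
Lemma dotr_grad p : p != 0 -> dotr p (grad F p) = F p.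
Proof.
move=> p0; apply/eqP; rewrite eq_le dotr_grad_le//=.
have := dotr_grad_le (- p) p0; rewrite dotrNl scnN => H0.
apply/ler_addgt0Pr => e e0.
have n0 : 0 < 1 + `|p| by rewrite ltr_pwDl.
have [d d0 Hd] := sderiv_total (fun i => @scn_sderiv p i p0) (divr_gt0 e0 n0).
pose t := d / 2 / (1 + `|p|).
have t0 : 0 < t by rewrite !divr_gt0.
have tx : `|t *: p| < d.
  rewrite normrZ gtr0_norm// /t mulrAC ltr_pdivrMr//.
  have := normr_ge0 p; nra.
have := Hd _ tx; rewrite ler_norml => /andP[_ H].
have t1 : 0 < 1 + t by lra.
rewrite -{1}(scale1r p) -scalerDl scnZ dotrZl normrZ (gtr0_norm t0) (gtr0_norm t1) in H.
rewrite -(ler_pM2l t0).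
have : e / (1 + `|p|) * (t * `|p|) <= t * e.
  by rewrite mulrAC ler_pdivrMr//; have := mulr_gt0 e0 t0; lra.
lra.
Qed.

Lemma grad_coord_bound p i : p != 0 -> `|grad F p 0 i| <= F (delta_mx 0 i).
Proof.
move=> p0; rewrite ler_norml.
have := dotr_grad_le (delta_mx 0 i) p0; have := dotr_grad_le (- delta_mx 0 i) p0.
by rewrite dotrNl !dotr_delta scnN => ? ?; lra.
Qed.

End norm_basics.

(** * Uniform convexity of the square of F *)

Lemma cvg_sum {R : realType} (I : Type) (r : seq I) (T : Type)
    (FF : set_system T) (f : I -> T -> R) (a : I -> R) : Filter FF ->
  (forall i, f i x @[x --> FF] --> a i) ->
  (\sum_(i <- r) f i x) @[x --> FF] --> \sum_(i <- r) a i.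
Proof.
move=> FFF H; apply: (@cvg_big R I +%R 0 predT) => //; exact: add_continuous.
Qed.

Section uniform_convexity.
Context {R : realType} {n : nat}.
Local Notation E := 'rV[R]_n.
Variable (F : E -> R).
Hypothesis hF : strongly_convex_norm F.
Implicit Types (x y p xi v : E).

Let f z := F z ^+ 2.
Let g j := 'D_(delta_mx 0 j) f.
Let DF j := 'D_(delta_mx 0 j) F.
Let H xi (i j : 'I_n) := hessian f xi i j.

Let near_neq0 xi : xi != 0 -> \forall z \near xi, z != 0.
Proof.
move=> /eqP xi0; have : nbhs xi [set~ (0 : E)] by apply: open_nbhs_nbhs; split => //; exact: open_neq0.
by apply: filterS => z /eqP.
Qed.

Let DF_continuous j xi : xi != 0 -> {for xi, continuous (DF j)}.
Proof. by move=> /eqP xi0; have [_ /(_ j)[_ [+ _]]] := scn_C2 hF; exact. Qed.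

Let DF_sderiv j i xi : xi != 0 ->
  sderiv (DF j) xi (delta_mx 0 i) ('D_(delta_mx 0 i) (DF j) xi).
Proof.
move=> /eqP xi0; have [_ /(_ j)[_ [_ /(_ i)[dD [cD _]]]]] := scn_C2 hF.
by apply: (@sderiv_of_C1 _ _ (DF j) [set~ 0]) => //; [exact: open_neq0|exact: cD].
Qed.

Let DDF_continuous j i xi : xi != 0 ->
  {for xi, continuous ('D_(delta_mx 0 i) (DF j))}.
Proof.
move=> /eqP xi0; have [_ /(_ j)[_ [_ /(_ i)[_ [cD _]]]]] := scn_C2 hF; exact: cD.
Qed.

Let f_sderiv j xi : xi != 0 -> sderiv f xi (delta_mx 0 j) (g j xi).
Proof.
move=> xi0; have cF := @scn_continuous _ _ _ hF xi.
have dF := scn_sderiv hF (i:=j) xi0.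
have D := sderivM cF cF dF dF.
have [_ e] := sderiv_is_derive D.
by rewrite /g /f; rewrite -e in D; exact: D.
Qed.

Let gE j xi : xi != 0 -> g j xi = 2 * (F xi * DF j xi).
Proof.
move=> xi0; have cF := @scn_continuous _ _ _ hF xi.
have dF := scn_sderiv hF (i:=j) xi0.
have [_ e] := sderiv_is_derive (sderivM cF cF dF dF).
by rewrite [LHS]e mxE /DF; ring.
Qed.

(** The Hessian of [F ^ 2] computed from the derivatives of [F]; its continuity is
  read off this formula. *)
Let l xi i j := 2 * (DF i xi * DF j xi + F xi * 'D_(delta_mx 0 i) (DF j) xi).

Let g_sderiv_l j i xi : xi != 0 -> sderiv (g j) xi (delta_mx 0 i) (l xi i j).
Proof.
move=> xi0; have cF := @scn_continuous _ _ _ hF xi.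
have dF := scn_sderiv hF (i:=i) xi0.
have D := sderivM cF (@DF_continuous j _ xi0) dF (@DF_sderiv j i _ xi0).
have c2 : {for xi, continuous (fun=> 2 : R)} := @continuous_cst_for _ _ 2 xi.
have cFD : {for xi, continuous (fun y => F y * DF j y)}.
  exact: (continuousM cF (@DF_continuous j _ xi0)).
have D2 := sderivM c2 cFD (sderiv_cst xi (delta_mx 0 i) 2) D.
rewrite mul0r add0r mxE in D2; apply: sderiv_near D2.
by apply: filterS (near_neq0 xi0) => z z0; rewrite gE.
Qed.

Let HE xi i j : xi != 0 -> H xi i j = l xi i j.
Proof.
by move=> xi0; rewrite /H mxE; have [_] := sderiv_is_derive (@g_sderiv_l j i _ xi0).
Qed.

Let g_sderiv j i xi : xi != 0 -> sderiv (g j) xi (delta_mx 0 i) (H xi i j).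
Proof. by move=> xi0; rewrite HE//; exact: g_sderiv_l. Qed.

Let H_continuous xi i j : xi != 0 -> (fun z => H z i j) @ xi --> H xi i j.
Proof.
move=> xi0; have c2 : {for xi, continuous (fun=> 2 : R)} := @continuous_cst_for _ _ 2 xi.
have C : (fun z => l z i j) @ xi --> l xi i j.
  exact: (continuousM c2 (continuousD
    (continuousM (@DF_continuous i _ xi0) (@DF_continuous j _ xi0))
    (continuousM (@scn_continuous _ _ _ hF xi) (@DDF_continuous j i _ xi0)))).
have xp : 0 < `|xi| by rewrite normr_gt0.
apply/(@continuous_distP _ _ (fun z => H z i j)) => e e0.
have [d d0 Hd] := (continuous_distP (fun z => l z i j) xi).1 C e e0.
exists (Num.min d `|xi|) => [|y]; first by rewrite lt_min d0.
rewrite lt_min => /andP[yd yx]; rewrite !HE ?Hd//.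
by apply: contraTneq yx => ->; rewrite sub0r normrN ltxx.
Qed.

Let gZ (s : R) j xi : 0 < s -> xi != 0 -> g j (s *: xi) = s * g j xi.
Proof.
move=> s0 xi0; have sx0 : s *: xi != 0 by rewrite scaler_eq0 (gt_eqF s0).
have [|_ D1] := @is_derive_scale _ _ f s xi (delta_mx 0 j) (\row_i g i (s *: xi)).
  by move=> i; rewrite mxE; exact: f_sderiv.
have [df _] := sderiv_is_derive (@f_sderiv j _ xi0).
have D2 : 'D_(delta_mx 0 j) (s ^+ 2 \*: f) xi = s ^+ 2 *: g j xi by exact: deriveZ.
have ffs : (fun y => f (s *: y)) = s ^+ 2 \*: f.
  by apply/funext => y; rewrite /f (scnZ hF) exprMn gtr0_norm.
apply: (mulfI (lt0r_neq0 s0)).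
by rewrite -ffs D1 dotr_delta mxE /GRing.scale /= in D2; rewrite D2 expr2 mulrA.
Qed.

Let HZ (s : R) i j xi : 0 < s -> xi != 0 -> H (s *: xi) i j = H xi i j.
Proof.
move=> s0 xi0; have sx0 : s *: xi != 0 by rewrite scaler_eq0 (gt_eqF s0).
have [|_ D1] := @is_derive_scale _ _ (g j) s xi (delta_mx 0 i) (\row_i H (s *: xi) i j).
  by move=> k; rewrite mxE; exact: g_sderiv.
have [df D0] := sderiv_is_derive (@g_sderiv j i _ xi0).
have D2 : 'D_(delta_mx 0 i) (s \*: g j) xi = s *: H xi i j by rewrite deriveZ// D0.
have D3 : 'D_(delta_mx 0 i) (fun y => g j (s *: y)) xi = 'D_(delta_mx 0 i) (s \*: g j) xi.
  apply: near_eq_derive; apply: filterS (near_neq0 xi0) => z z0.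
  by rewrite gZ.
apply: (mulfI (lt0r_neq0 s0)).
by rewrite D2 D1 dotr_delta mxE in D3.
Qed.

Let Q xi v := \sum_(i < n) \sum_(j < n) v 0 i * v 0 j * H xi i j.

Let QE xi v : (v *m hessian f xi *m v^T) 0 0 = Q xi v.
Proof.
rewrite mxE; under eq_bigr do rewrite mxE mxE mulr_suml.
rewrite exchange_big; apply: eq_bigr => i _; apply: eq_bigr => j _.
by rewrite /H; ring.
Qed.

Let Q_gt0 xi v : xi != 0 -> v != 0 -> 0 < Q xi v.
Proof. by rewrite -QE; exact: scn_hessian. Qed.

Let unit_sphere := [set x : E | `|x| = 1].

Let compact_unit_sphere : compact unit_sphere.
Proof.
apply: bounded_closed_compact.
  by exists 1; split => // M M1 x /= ->; exact: ltW.
apply: (@preimage_closed _ _ (fun x : E => `|x|) [set 1]) => //.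
  by move=> x _; exact: norm_continuous.
Qed.

Let Q_continuous xi v : xi != 0 -> {for (xi, v), continuous (fun q : E * E => Q q.1 q.2)}.
Proof.
move=> xi0; rewrite /prop_for /continuous_at /Q /=.
have coordc i : (fun q : E * E => q.2 0 i) @ (xi, v) --> v 0 i.
  apply: (cvg_comp (fun q : E * E => q.2) (fun w : E => w 0 i)); first exact: cvg_snd.
  exact: coord_continuous.
have Hc i j : (fun q : E * E => H q.1 i j) @ (xi, v) --> H xi i j.
  by apply: (cvg_comp (fun q : E * E => q.1) (fun w : E => H w i j)); [exact: cvg_fst|exact: H_continuous].
apply: cvg_sum => i; apply: cvg_sum => j.
by apply: cvgM; [apply: cvgM|exact: Hc].
Qed.

(** The Hessian of [F ^ 2] is homogeneous of degree zero, so its lower bound may be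
  computed on a product of two unit spheres, where compactness applies. *)
Let Q_lower : (0 < n)%N -> exists2 m, 0 < m & forall xi v, xi != 0 -> m * dotr v v <= Q xi v.
Proof.
move=> n0; pose i0 := Ordinal n0.
have A0 : unit_sphere `*` unit_sphere !=set0.
  have e1 : `|delta_mx 0 i0 : E| = 1.
    apply/eqP; rewrite eq_le norm_delta_mx /=.
    by apply: le_trans (le_coord_norm _ i0); rewrite mxE !eqxx normr1.
  by exists (delta_mx 0 i0, delta_mx 0 i0).
have cA : compact (unit_sphere `*` unit_sphere) by exact: compact_setX compact_unit_sphere compact_unit_sphere.
have nz x : unit_sphere x -> x != 0 by move=> x1; rewrite -normr_gt0 x1.
have [|[xi0 v0] /= + Hmin] := compact_EVT_min A0 cA (f := fun q : E * E => Q q.1 q.2).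
  apply: continuous_in_subspaceT => -[xi v]; rewrite inE => -[/= /nz xi1 _].
  exact: Q_continuous.
rewrite inE => -[/= /nz x1 /nz v1].
exists (Q xi0 v0 / n%:R) => [|xi v xi1].
  by rewrite divr_gt0 ?Q_gt0// ltr0n.
have [->|vn0] := eqVneq v 0.
  by rewrite dotr0l mulr0 /Q big1// => i _; rewrite big1// => j _; rewrite mxE !mul0r.
have vp : 0 < `|v| by rewrite normr_gt0.
have xp : 0 < `|xi| by rewrite normr_gt0.
have unit y : 0 < `|y : E| -> `|(`|y|^-1 *: y)| = 1.
  by move=> yp; rewrite normrZ normfV normr_id mulVf// lt0r_neq0.
have H0 : Q xi0 v0 <= Q (`|xi|^-1 *: xi) (`|v|^-1 *: v).
  apply: (Hmin (`|xi|^-1 *: xi, `|v|^-1 *: v)).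
  by rewrite inE; split; exact: unit.
have eQ : Q (`|xi|^-1 *: xi) (`|v|^-1 *: v) = `|v| ^- 2 * Q xi v.
  rewrite /Q mulr_sumr; apply: eq_bigr => i _; rewrite mulr_sumr; apply: eq_bigr => j _.
  rewrite HZ ?invr_gt0// !mxE; field; exact: lt0r_neq0.
have H1 : `|v| ^+ 2 * Q xi0 v0 <= Q xi v.
  have := ler_wpM2l (ltW (exprn_gt0 2 vp)) H0.
  by rewrite eQ mulrA mulfV ?mul1r// expf_neq0// lt0r_neq0.
apply: le_trans H1; rewrite mulrAC ler_pdivrMr ?ltr0n//.
rewrite (_ : _ * n%:R = Q xi0 v0 * (n%:R * `|v| ^+ 2)); last by ring.
have Q0 := Q_gt0 x1 v1.
apply: ler_wpM2l; [exact: ltW|exact: dotr_le_norm].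
Qed.

(** Segments that avoid the origin, where [F ^ 2] is of class C^2. *)
Let uniform_convexity_away m a v : (forall xi v, xi != 0 -> m * dotr v v <= Q xi v) ->
  (forall s : R, 0 <= s <= 1 -> a + s *: v != 0) ->
  forall t, 0 <= t <= 1 ->
    f (a + t *: v) <= t * f (a + v) + (1 - t) * f a - m / 2 * dotr v v * t * (1 - t).
Proof.
move=> HQ Hs t t01.
pose q (s : R) := f (a + s *: v).
have q1 : q 1 = f (a + v) by rewrite /q scale1r.
have q0 : q 0 = f a by rewrite /q scale0r addr0.
rewrite -q1 -q0 -/(q t); apply: (@uniformly_convex_of_derive2 _ q (fun s => \sum_(j < n) v 0 j * g j (a + s *: v))
   (fun s => \sum_(j < n) v 0 j * \sum_(i < n) v 0 i * H (a + s *: v) i j)) => //.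
- move=> s s01; apply: is_derive_line.
  rewrite (_ : \sum_(j < n) _ = dotr v (\row_j g j (a + s *: v))); last first.
    by apply: eq_bigr => j _; rewrite mxE.
  by apply: is_derive_total => i; rewrite mxE; apply: f_sderiv; exact: Hs.
- move=> s s01.
  have D j : is_derive s 1 (fun s : R => v 0 j * g j (a + s *: v))
      (v 0 j * \sum_(i < n) v 0 i * H (a + s *: v) i j).
    apply: is_deriveZ; apply: is_derive_line.
    rewrite (_ : \sum_(i < n) _ = dotr v (\row_i H (a + s *: v) i j)); last first.
      by apply: eq_bigr => i _; rewrite mxE.
    by apply: is_derive_total => i; rewrite mxE; apply: g_sderiv; exact: Hs.
  have := is_derive_sum D.
  rewrite (_ : \sum_(j < n) (fun s => _) = (fun s : R => \sum_(j < n) v 0 j * g j (a + s *: v)))//.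
  by apply/funext => r; rewrite fct_sumE.
- move=> s s01; rewrite mulrA mulrCA mulfV// mulr1; apply: le_trans (HQ _ v (Hs _ s01)) _.
  rewrite /Q exchange_big; apply: ler_sum => j _; rewrite mulr_sumr.
  by apply: ler_sum => i _; rewrite [X in X <= _]mulrAC mulrC mulrA mulrAC.
Qed.

(** On a segment that meets the origin, where [F ^ 2] need not be twice
  differentiable, it is a multiple of [s ^ 2] and the coercivity of [F] gives the
  bound. *)
Lemma scn_uniformly_convex : (0 < n)%N ->
  exists2 k, 0 < k & forall x y t, 0 <= t <= 1 ->
    F (t *: x + (1 - t) *: y) ^+ 2 <= t * F x ^+ 2 + (1 - t) * F y ^+ 2
       - k * dotr (x - y) (x - y) * t * (1 - t).
Proof.
move=> n0; have [m m0 HQ] := Q_lower n0; have [al al0 Hal] := scn_coercive hF.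
pose k := Num.min (m / 2) (al ^+ 2).
have k0 : 0 < k by rewrite lt_min exprn_gt0// divr_gt0.
exists k => // x y t t01; have /andP[t0 t1] := t01.
have d0 := dotr_ge0 (x - y).
have lin : t *: x + (1 - t) *: y = y + t *: (x - y).
  by apply/rowP => i; rewrite !mxE; ring.
have [[s [s01 /eqP Hs]]|Hno] := pselect (exists s : R, 0 <= s <= 1 /\ y + s *: (x - y) == 0).
  (* the segment meets the origin, so its ends are multiples of one vector *)
  pose w := x - y.
  have yE : y = (- s) *: w by rewrite scaleNr; apply/eqP; rewrite -addr_eq0 Hs.
  have xE : x = (1 - s) *: w by rewrite scalerBl scale1r -scaleNr -yE subrK.
  rewrite lin -/w {1}yE -scalerDl [in F x]xE [in F y]yE !(scnZ hF) !exprMn !real_normK ?num_real//.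
  have Hw : k * dotr w w <= F w ^+ 2.
    apply: (@le_trans _ _ (al ^+ 2 * dotr w w)).
      by rewrite ler_wpM2r// ge_min lexx orbT.
    rewrite -enorm_sqr -exprMn lerXn2r ?nnegrE ?mulr_ge0 ?(ltW al0) ?enorm_ge0//.
    exact: scn_ge0.
  have := mulr_ge0 (mulr_ge0 t0 (_ : 0 <= 1 - t)) (_ : 0 <= F w ^+ 2 - k * dotr w w).
  rewrite !subr_ge0 => /(_ t1 Hw) H1.
  rewrite -subr_ge0; apply: le_trans H1 _; rewrite le_eqVlt; apply/orP; left; apply/eqP; ring.
rewrite lin.
have Hs s : 0 <= s <= 1 -> y + s *: (x - y) != 0.
  by move=> s01; apply/negP => Hs; apply: Hno; exists s.
have := uniform_convexity_away HQ Hs t01; rewrite subrKC => /le_trans; apply.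
rewrite lerD2l lerN2; apply: ler_wpM2r; first by rewrite subr_ge0.
by apply: ler_wpM2r => //; apply: ler_wpM2r => //; rewrite ge_min lexx.
Qed.

End uniform_convexity.

(** * The polar norm *)

Section polar_norm.
Context {R : realType} {n : nat}.
Local Notation E := 'rV[R]_n.
Variable (F : E -> R).
Hypothesis hF : strongly_convex_norm F.
Hypothesis n_gt0 : (0 < n)%N.
Implicit Types (x y z xi : E).

Let polar_set x := [set dotr xi x / F xi | xi in [set~ (0 : E)]].

Let polar_set_neq0 x : polar_set x !=set0.
Proof.
pose i0 := Ordinal n_gt0.
exists (dotr (delta_mx 0 i0) x / F (delta_mx 0 i0)); exists (delta_mx 0 i0) => //= /rowP/(_ i0).
by rewrite !mxE !eqxx => /eqP; rewrite oner_eq0.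
Qed.

Let polar_ub : exists2 C : R, 0 < C & forall x, ubound (polar_set x) (C * `|x|).
Proof.
have [a a0 Ha] := scn_coercive hF.
exists ((1 + n%:R) / a) => [|x _ [xi /= /eqP xi0 <-]].
  by rewrite divr_gt0// ltr_pwDl.
have Fx := scn_gt0 hF xi0.
rewrite ler_pdivrMr//; apply: le_trans (cauchy_schwarz _ _) _.
apply: (@le_trans _ _ (enorm xi * ((1 + n%:R) * `|x|))).
  by rewrite ler_wpM2l ?enorm_ge0 ?enorm_le_norm.
have -> : (1 + n%:R) / a * `|x| * F xi = ((1 + n%:R) * `|x|) * (a^-1 * F xi) by ring.
rewrite [X in X <= _]mulrC ler_wpM2l ?mulr_ge0// ?addr_ge0//.
by rewrite ler_pdivlMl.
Qed.

Let polar_has_sup x : has_sup (polar_set x).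
Proof.
split; first exact: polar_set_neq0.
by have [C _ HC] := polar_ub; exists (C * `|x|); exact: HC.
Qed.

Lemma dotr_le_polar xi x : dotr xi x <= F xi * polar F x.
Proof.
have [->|xi0] := eqVneq xi 0; first by rewrite dotr0l (scn0 hF) mul0r.
rewrite mulrC -ler_pdivrMr ?(scn_gt0 hF)//.
by apply: sup_upper_bound; [exact: polar_has_sup|exists xi => //; exact/eqP].
Qed.

Lemma polar_le x B : (forall xi, dotr xi x <= F xi * B) -> polar F x <= B.
Proof.
move=> H; apply: ge_sup; first exact: polar_set_neq0.
by move=> _ [xi /= /eqP xi0 <-]; rewrite ler_pdivrMr ?(scn_gt0 hF)// mulrC.
Qed.

Lemma polar_ge0 x : 0 <= polar F x.
Proof.
have [_ [xi /= /eqP xi0 _]] := polar_set_neq0 x.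
have Fx := scn_gt0 hF xi0; have := dotr_le_polar xi x.
have := dotr_le_polar (- xi) x; rewrite dotrNl (scnN hF) => H1 H2.
have : 0 <= F xi * polar F x by lra.
by rewrite pmulr_rge0.
Qed.

Lemma polarD x y : polar F (x + y) <= polar F x + polar F y.
Proof.
by apply: polar_le => xi; rewrite dotrDr mulrDr lerD// dotr_le_polar.
Qed.

Lemma polarZ_le (t : R) x : 0 <= t -> polar F (t *: x) <= t * polar F x.
Proof.
move=> t0; apply: polar_le => xi; rewrite dotrZr mulrCA ler_wpM2l//.
exact: dotr_le_polar.
Qed.

Lemma polarN x : polar F (- x) = polar F x.
Proof.
have H y : polar F (- y) <= polar F y.
  by apply: polar_le => xi; rewrite dotrNr -dotrNl -(scnN hF) dotr_le_polar.
by apply/eqP; rewrite eq_le H/= -{1}(opprK x) H.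
Qed.

Lemma polar_le_norm : exists2 C : R, 0 < C & forall x, polar F x <= C * `|x|.
Proof.
have [C C0 HC] := polar_ub; exists C => // x.
by apply: ge_sup; [exact: polar_set_neq0|exact: HC].
Qed.

Lemma norm_le_polar : exists2 c : R, 0 < c & forall x, c * `|x| <= polar F x.
Proof.
have [C C0 HC] := scn_le_norm hF; exists C^-1 => [|x]; first by rewrite invr_gt0.
have [->|x0] := eqVneq x 0; first by rewrite normr0 mulr0 polar_ge0.
have xp : 0 < `|x| by rewrite normr_gt0.
rewrite ler_pdivrMl// -(ler_pM2l xp).
apply: le_trans (_ : dotr x x <= _); first by rewrite -expr2 norm_le_dotr.
apply: le_trans (dotr_le_polar x x) _; rewrite mulrA ler_wpM2r ?polar_ge0//.
by rewrite mulrC.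
Qed.

Lemma polar_dist x y : `|polar F x - polar F y| <= polar F (x - y).
Proof.
rewrite ler_norml; have := polarD (x - y) y; rewrite subrK.
have := polarD (y - x) x; rewrite subrK -(polarN (y - x)) opprB; lra.
Qed.

(** An approximate maximizer in the Legendre transform: [polar F ^ 2 / 2] is the
  conjugate of [F ^ 2 / 2]. *)
Lemma polar_gradient x (e : R) : 0 < e ->
  exists xi, polar F x ^+ 2 / 2 - e <= dotr xi x - F xi ^+ 2 / 2.
Proof.
move=> e0; have := polar_ge0 x; rewrite le_eqVlt => /predU1P[p0|p0].
  exists 0; rewrite dotr0l (scn0 hF) -p0 expr2; lra.
have [_ [xi /= /eqP xi0 <-] H] := sup_adherent (divr_gt0 e0 p0) (polar_has_sup x).
have Fx := scn_gt0 hF xi0.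
exists ((polar F x / F xi) *: xi).
rewrite (scnZ hF) dotrZl gtr0_norm ?divr_gt0// mulfVK ?gt_eqF//.
rewrite -/(polar F x) in H; rewrite -mulrA [_^-1 * _]mulrC.
have : polar F x * (polar F x - e / polar F x) <= polar F x * (dotr xi x / F xi).
  by rewrite ler_pM2l// ltW.
rewrite mulrBr [_ * (e / _)]mulrC mulfVK ?gt_eqF// => ?.
lra.
Qed.

(** The Legendre transform turns the uniform convexity of [F ^ 2] into an upper
  bound on the convexity of [polar F ^ 2]: take maximizers [xi], [et] for [x], [y]
  and test the conjugate at the middle point with their convex combination. *)
Lemma polar_semiconcave : exists2 K : R, 0 < K & forall x y t, 0 <= t <= 1 ->
  t * polar F x ^+ 2 + (1 - t) * polar F y ^+ 2
  - polar F (t *: x + (1 - t) *: y) ^+ 2 <= K * (t * (1 - t) * dotr (x - y) (x - y)).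
Proof.
have [k k0 Hk] := scn_uniformly_convex hF n_gt0.
exists k^-1 => [|x y t t01]; first by rewrite invr_gt0.
have /andP[t0 t1] := t01.
apply/ler_addgt0Pr => e e0.
have [xi Hxi] := polar_gradient x (divr_gt0 e0 (ltr0Sn R 1)).
have [et Het] := polar_gradient y (divr_gt0 e0 (ltr0Sn R 1)).
set z := t *: x + (1 - t) *: y; pose ze := t *: xi + (1 - t) *: et.
have H1 : dotr ze z <= F ze ^+ 2 / 2 + polar F z ^+ 2 / 2.
  apply: le_trans (dotr_le_polar ze z) _.
  have := sqr_ge0 (F ze - polar F z); rewrite sqrrB; lra.
have H2 := Hk xi et _ t01; rewrite -/ze in H2.
have H3 : t * dotr xi x + (1 - t) * dotr et y - dotr ze z
    = t * (1 - t) * dotr (xi - et) (x - y).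
  by rewrite /ze /z !(dotrDl, dotrDr, dotrNl, dotrNr, dotrZl, dotrZr); ring.
have H4 (u v : E) : dotr u v - k / 2 * dotr u u <= k^-1 / 2 * dotr v v.
  have := dotr_ge0 (k *: u - v).
  rewrite !(dotrDl, dotrDr, dotrZl, dotrZr, dotrNl, dotrNr) (dotrC v u) => H5.
  rewrite -(ler_pM2l k0).
  have -> : k * (k^-1 / 2 * dotr v v) = dotr v v / 2 by field; exact: lt0r_neq0.
  lra.
have tt : 0 <= t * (1 - t) by rewrite mulr_ge0// subr_ge0.
have H6 := ler_wpM2l tt (H4 (xi - et) (x - y)).
have H7 := ler_wpM2l t0 Hxi.
have t1' : 0 <= 1 - t by rewrite subr_ge0.
have H8 := ler_wpM2l t1' Het.
lra.
Qed.

End polar_norm.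

(** * The distance to the boundary *)

Section distance.
Context {R : realType} {n : nat}.
Local Notation E := 'rV[R]_n.
Variable (F : E -> R).
Hypothesis hF : strongly_convex_norm F.
Hypothesis n_gt0 : (0 < n)%N.
Variable (U : set E).
Hypothesis bd_U : boundary U !=set0.
Implicit Types (x y z xi : E).
Local Notation d := (distF F U).

Let dist_set x := [set polar F (x - y) | y in boundary U].

Let dist_has_inf x : has_inf (dist_set x).
Proof.
split; first by have [y Uy] := bd_U; exists (polar F (x - y)); exists y.
by exists 0 => _ [y _ <-]; exact: polar_ge0.
Qed.

Lemma distF_le x y : boundary U y -> d x <= polar F (x - y).
Proof. by move=> Uy; apply: ge_inf; [exact: (dist_has_inf x).2|exists y]. Qed.

Lemma distF_ge0 x : 0 <= d x.
Proof.
by apply: lb_le_inf; [exact: (dist_has_inf x).1|move=> _ [y _ <-]; exact: polar_ge0].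
Qed.

Lemma boundary_closed : closed (boundary U).
Proof.
rewrite /boundary setDE; apply: closedI; first exact: closed_closure.
by apply: open_closedC; exact: open_interior.
Qed.

Lemma distF_attained x : exists2 y, boundary U y & d x = polar F (x - y).
Proof.
have [y0 Uy0] := bd_U; have [c c0 Hc] := norm_le_polar hF n_gt0.
have [C C0 HC] := polar_le_norm hF n_gt0.
pose M := polar F (x - y0) / c.
pose A := boundary U `&` [set y | `|x - y| <= M].
have A0 : A !=set0 by exists y0; split => //=; rewrite ler_pdivlMr// mulrC.
have cA : compact A.
  apply: bounded_closed_compact.
    exists (`|x| + M); split; [exact: num_real|] => M' HM y [_ /= Hy]; apply: le_trans (ltW HM).
    by rewrite -lerBlDl; apply: le_trans Hy; rewrite distrC lerB_dist.
  apply: closedI; first exact: boundary_closed.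
  rewrite (_ : [set y | _] = (fun y => `|x - y|) @^-1` [set r | r <= M])//.
  apply: preimage_closed; last exact: closed_le.
  move=> y _; apply: continuous_comp; last exact: norm_continuous.
  by apply: continuousB; [exact: cst_continuous|].
have cp y : {for y, continuous (fun y => polar F (x - y))}.
  apply/continuous_distP => e e0; exists (e / C) => [|z]; first by rewrite divr_gt0.
  rewrite ltr_pdivlMr// mulrC => /ltW; apply: le_trans.
  apply: le_trans (polar_dist hF n_gt0 _ _) _; apply: le_trans (HC _) _.
  by rewrite ler_wpM2l ?(ltW C0)// opprB addrC subrKA distrC.
have [|y + Hmin] := compact_EVT_min A0 cA (f := fun y => polar F (x - y)).
  by apply: continuous_in_subspaceT => y _; exact: cp.
rewrite inE => -[Uy _]; exists y => //; apply/eqP; rewrite eq_le distF_le//=.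
apply: lb_le_inf; first exact: (dist_has_inf x).1.
move=> _ [z Uz <-]; have [zM|zM] := leP `|x - z| M.
  by apply: Hmin; rewrite inE.
apply: le_trans (Hmin y0 _) _.
  by rewrite inE; split => //=; rewrite ler_pdivlMr// mulrC.
by apply: le_trans (Hc _); rewrite -ler_pdivrMl// mulrC ltW.
Qed.

Lemma distF_lip x y : d x <= d y + polar F (x - y).
Proof.
have [z Uz ->] := distF_attained y; apply: le_trans (distF_le x Uz) _.
by rewrite -(subrKA y) addrC polarD.
Qed.

Lemma distF_lipschitz : exists2 C : R, 0 < C & forall x y, `|d x - d y| <= C * `|x - y|.
Proof.
have [C C0 HC] := polar_le_norm hF n_gt0; exists C => // x y.
apply: le_trans (HC (x - y)); rewrite ler_norml.
have := distF_lip x y; have := distF_lip y x.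
rewrite -(polarN hF n_gt0 (y - x)) opprB; lra.
Qed.

Lemma distF_continuous x : {for x, continuous d}.
Proof.
have [C C0 HC] := distF_lipschitz; apply/continuous_distP => e e0.
exists (e / C) => [|y]; first by rewrite divr_gt0.
rewrite ltr_pdivlMr// mulrC => /ltW; exact: le_trans.
Qed.

Lemma distF_gt0 x : open U -> U x -> 0 < d x.
Proof.
move=> oU Ux; rewrite lt_neqAle distF_ge0 andbT eq_sym; apply/eqP => d0.
have [y Uy] := distF_attained x; rewrite d0 => p0.
have [c c0 Hc] := norm_le_polar hF n_gt0.
have := Hc (x - y); rewrite -p0 pmulr_rle0// normr_le0 subr_eq0 => /eqP xy.
by case: Uy => _; rewrite (interior_id _).1// -xy.
Qed.

Lemma measurable_distF_inv : open U -> measurable_fun U (fun x => (d x)^-1).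
Proof.
move=> oU; apply: continuous_measurable_rV => // x Ux.
have cdx : {for x, continuous d} := @distF_continuous x.
exact: (continuousV (lt0r_neq0 (distF_gt0 oU Ux)) cdx).
Qed.

(** An infimum of functions with a common bound on their convexity satisfies the
  same bound: compare both ends with the boundary point nearest to the middle. *)
Lemma distF_semiconcave : exists2 K : R, 0 < K & forall x y t, 0 <= t <= 1 ->
  t * d x ^+ 2 + (1 - t) * d y ^+ 2
  - d (t *: x + (1 - t) *: y) ^+ 2 <= K * (t * (1 - t) * dotr (x - y) (x - y)).
Proof.
have [K K0 HK] := polar_semiconcave hF n_gt0; exists K => // x y t t01.
have /andP[t0 t1] := t01.
have [z Uz ->] := distF_attained (t *: x + (1 - t) *: y).
have := HK (x - z) (y - z) t t01.
rewrite (_ : x - z - (y - z) = x - y); last by rewrite opprB addrA subrK.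
rewrite (_ : t *: (x - z) + (1 - t) *: (y - z) = t *: x + (1 - t) *: y - z); last first.
  by apply/rowP => i; rewrite !mxE; ring.
apply: le_trans; rewrite lerD2r; apply: lerD; apply: ler_wpM2l.
- by [].
- by rewrite lerXn2r ?nnegrE ?distF_ge0 ?polar_ge0// distF_le.
- by rewrite subr_ge0.
- by rewrite lerXn2r ?nnegrE ?distF_ge0 ?polar_ge0// distF_le.
Qed.

End distance.

(** * Concave functions along lines *)

Section concave.
Context {R : realType} {n : nat}.
Local Notation E := 'rV[R]_n.
Variables (w : E -> R) (v : E).
Hypothesis w_concave : forall x y t, 0 <= t <= 1 ->
  t * w x + (1 - t) * w y <= w (t *: x + (1 - t) *: y).
Hypothesis w_continuous : forall x, {for x, continuous w}.
Implicit Types (x y : E) (h k : R).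

Local Notation slope := (diff_quotient w v).

Lemma slope_continuous k x : {for x, continuous (fun y => slope (y, k))}.
Proof.
have [->|k0] := eqVneq k 0.
  apply/continuous_distP => e e0; exists 1 => // y _.
  by rewrite /diff_quotient /= invr0 !mul0r subrr normr0 ltW.
have kp : 0 < `|k| by rewrite normr_gt0.
apply/continuous_distP => e e0.
have e'0 : 0 < e / 2 * `|k| by rewrite mulr_gt0// divr_gt0.
have [d0 d00 Hd0] := (continuous_distP w x).1 (@w_continuous x) _ e'0.
have [d1 d10 Hd1] := (continuous_distP w (x + k *: v)).1 (@w_continuous _) _ e'0.
exists (Num.min d0 d1) => [|y]; first by rewrite lt_min d00.
rewrite lt_min => /andP[y0 y1].
rewrite /diff_quotient /= -mulrBr normrM normfV ler_pdivrMl//.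
rewrite (_ : _ - _ = (w (y + k *: v) - w (x + k *: v)) - (w y - w x)); last by ring.
apply: le_trans (ler_normB _ _) _.
have := Hd0 _ y0; have := Hd1 (y + k *: v).
rewrite (_ : y + k *: v - (x + k *: v) = y - x); last by rewrite opprD addrACA subrr addr0.
move=> /(_ y1); lra.
Qed.

Lemma slope_nincr x h k : h != 0 -> k != 0 -> h < k -> slope (x, k) <= slope (x, h).
Proof.
move=> h0 k0 hk; rewrite /diff_quotient /=.
have line (a b t : R) : 0 <= t <= 1 ->
    t * w (x + a *: v) + (1 - t) * w (x + b *: v) <= w (x + (t * a + (1 - t) * b) *: v).
  move=> t01; rewrite (_ : x + (t * a + (1 - t) * b) *: v =
    t *: (x + a *: v) + (1 - t) *: (x + b *: v)); first exact: w_concave.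
  by apply/rowP => i; rewrite !mxE; ring.
have w0 : w x = w (x + 0 *: v) by rewrite scale0r addr0.
have [hn|hp|/eqP] := ltgtP h 0; last by rewrite (negbTE h0).
  have [kn|kp|/eqP] := ltgtP k 0; last by rewrite (negbTE k0).
    have t01 : 0 <= k / h <= 1 by rewrite ler_ndivrMr ?ler_ndivlMr//; lra.
    have := line h 0 (k / h) t01; rewrite mulr0 addr0 mulfVK// -w0 => H.
    have hkp : 0 < h * k by rewrite nmulr_rgt0.
    rewrite -(ler_pM2l hkp).
    have -> : h * k * (h^-1 * (w (x + h *: v) - w x)) = k * (w (x + h *: v) - w x) by field.
    have -> : h * k * (k^-1 * (w (x + k *: v) - w x)) = h * (w (x + k *: v) - w x) by field.
    rewrite -(ler_nM2l hn) in H.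
    have e : h * (k / h * w (x + h *: v) + (1 - k / h) * w x) =
      k * w (x + h *: v) + (h - k) * w x by field.
    rewrite e in H; lra.
  have kh : 0 < k - h by lra.
  have t01 : 0 <= k / (k - h) <= 1 by rewrite ler_pdivlMr ?ler_pdivrMr//; lra.
  have := line h k (k / (k - h)) t01.
  rewrite (_ : k / (k - h) * h + _ = 0); last by field; lra.
  rewrite -w0 -(ler_pM2l kh) => H.
  have {}H : k * w (x + h *: v) - h * w (x + k *: v) <= (k - h) * w x.
    apply: le_trans H; rewrite le_eqVlt; apply/orP; left; apply/eqP; field; lra.
  have hkn : h * k < 0 by rewrite nmulr_rlt0.
  rewrite -(ler_nM2l hkn).
  have -> : h * k * (h^-1 * (w (x + h *: v) - w x)) = k * (w (x + h *: v) - w x) by field.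
  have -> : h * k * (k^-1 * (w (x + k *: v) - w x)) = h * (w (x + k *: v) - w x) by field.
  lra.
have kp : 0 < k by lra.
have t01 : 0 <= h / k <= 1 by rewrite ler_pdivlMr ?ler_pdivrMr//; lra.
have := line k 0 (h / k) t01; rewrite mulr0 addr0 mulfVK// -w0 => H.
have hkp : 0 < h * k by rewrite mulr_gt0.
rewrite -(ler_pM2l hkp).
have -> : h * k * (h^-1 * (w (x + h *: v) - w x)) = k * (w (x + h *: v) - w x) by field.
have -> : h * k * (k^-1 * (w (x + k *: v) - w x)) = h * (w (x + k *: v) - w x) by field.
rewrite -(ler_pM2l kp) in H.
have e : k * (h / k * w (x + k *: v) + (1 - h / k) * w x) =
  h * w (x + k *: v) + (k - h) * w x by field.
rewrite e in H; lra.
Qed.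

Let qp x m := slope (x, m.+1%:R^-1).
Let qm x m := slope (x, - m.+1%:R^-1).

(** The increments [1 / (m + 1)] make the one-sided derivatives limits of sequences
  of continuous functions, hence measurable. *)
Definition right_derive x : R := limn (qp x).
Definition left_derive x : R := limn (qm x).

Let invSp m : 0 < m.+1%:R^-1 :> R. Proof. by rewrite invr_gt0. Qed.

Let qp_nd x : nondecreasing_seq (qp x).
Proof.
apply/nondecreasing_seqP => m; apply: slope_nincr => //.
by rewrite ltf_pV2 ?posrE// ltr_nat.
Qed.

Let qm_ni x : nonincreasing_seq (qm x).
Proof.
apply/nonincreasing_seqP => m; apply: slope_nincr; rewrite ?oppr_eq0//.
by rewrite ltrN2 ltf_pV2 ?posrE// ltr_nat.
Qed.

Lemma cvg_right_derive x : qp x @ \oo --> right_derive x.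
Proof.
apply: nondecreasing_is_cvgn; first exact: qp_nd.
exists (slope (x, -1)) => _ [m _ <-].
by apply: slope_nincr; rewrite ?oppr_eq0 ?oner_eq0//; apply: (@lt_trans _ _ 0); rewrite ?oppr_lt0.
Qed.

Lemma cvg_left_derive x : qm x @ \oo --> left_derive x.
Proof.
apply: nonincreasing_is_cvgn; first exact: qm_ni.
exists (slope (x, 1)) => _ [m _ <-].
by apply: slope_nincr; rewrite ?oppr_eq0 ?oner_eq0//; apply: (@lt_trans _ _ 0); rewrite ?oppr_lt0.
Qed.

Let archi h : 0 < h -> exists m, m.+1%:R^-1 < h.
Proof.
move=> h0; have [m _ Hm] := near_infty_natSinv_lt (PosNum h0).
by exists m; exact: Hm (leqnn m).
Qed.

Lemma slope_le_right_derive x h : 0 < h -> slope (x, h) <= right_derive x.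
Proof.
move=> h0; have [m Hm] := archi h0.
apply: le_trans (slope_nincr _ _ _ Hm) _ => //; first exact: lt0r_neq0.
by apply: nondecreasing_cvgn_le; [exact: qp_nd|apply/cvg_ex; eexists; exact: cvg_right_derive].
Qed.

Lemma left_derive_le_slope x h : 0 < h -> left_derive x <= slope (x, - h).
Proof.
move=> h0; have [m Hm] := archi h0.
apply: le_trans (_ : qm x m <= _).
  by apply: nonincreasing_cvgn_ge; [exact: qm_ni|apply/cvg_ex; eexists; exact: cvg_left_derive].
by apply: slope_nincr; rewrite ?oppr_eq0 ?lt0r_neq0// ltrN2.
Qed.

Lemma right_derive_le_left x : right_derive x <= left_derive x.
Proof.
apply: ler_lim; [exact: (cvgP _ (@cvg_right_derive x))|exact: (cvgP _ (@cvg_left_derive x))|].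
near=> m; apply: slope_nincr; rewrite ?oppr_eq0//.
by apply: (@lt_trans _ _ 0); rewrite ?oppr_lt0.
Unshelve. all: by end_near. Qed.

Lemma is_derive_one_sided x l : is_derive x v w l ->
  right_derive x = l /\ left_derive x = l.
Proof.
move=> [dw dl].
have C : (fun h => h^-1 *: ((w \o shift x) (h *: v) - w x)) @ (0 : R)^' --> l by rewrite -dl.
have H e : 0 < e -> l - e <= right_derive x /\ left_derive x <= l + e.
  move=> e0; have /cvgrPdist_le/(_ _ e0) := C.
  rewrite near_withinE => /nbhs_ballP[d /= d0 Hd].
  have d2 : 0 < d / 2 by rewrite divr_gt0.
  have Hs t : `|t| < d -> t != 0 -> `|l - slope (x, t)| <= e.
    move=> td t0; have := Hd t; rewrite -ball_normE /= sub0r normrN => /(_ td t0).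
    by rewrite [_ + x]addrC.
  have := slope_le_right_derive x d2; have := left_derive_le_slope x d2.
  have := Hs (d / 2); rewrite gtr0_norm// => /(_ _ (lt0r_neq0 d2)).
  have dd : d / 2 < d by lra.
  move=> /(_ dd); have := Hs (- (d / 2)); rewrite normrN gtr0_norm// oppr_eq0.
  move=> /(_ dd (lt0r_neq0 d2)); rewrite !ler_distl; lra.
have rl := right_derive_le_left x.
split; apply/eqP; rewrite eq_le; apply/andP; split; apply/ler_addgt0Pr => e /H; lra.
Qed.

(** At a point where a concave function is derivable along a line it is strictly
  derivable: slopes at nearby points are squeezed between two fixed increments. *)
Lemma sderiv_concave x : right_derive x = left_derive x -> sderiv w x v (left_derive x).
Proof.
move=> rl; set l := left_derive x; apply/sderivP => e e0.
have e2 : 0 < e / 2 by rewrite divr_gt0.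
have /cvgrPdist_lt/(_ _ e2) Hp := @cvg_right_derive x.
have /cvgrPdist_lt/(_ _ e2) Hm := @cvg_left_derive x.
have [m [Hmp Hmm]] : exists m, `|right_derive x - qp x m| < e / 2 /\ `|left_derive x - qm x m| < e / 2.
  by have [m _ /(_ m (leqnn m))] := filterI Hp Hm; exists m.
rewrite rl -/l in Hmp; rewrite -/l in Hmm.
pose h := m.+1%:R^-1 : R; have h0 : 0 < h by exact: invSp.
have [d1 d10 Hd1] := (continuous_distP _ x).1 (@slope_continuous h x) _ e2.
have [d2 d20 Hd2] := (continuous_distP _ x).1 (@slope_continuous (- h) x) _ e2.
exists (Num.min h (Num.min d1 d2)) => [|y t]; first by rewrite !lt_min h0 d10.
rewrite !lt_min => /and3P[_ y1 y2] /and3P[th _ _].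
have [->|t0] := eqVneq t 0.
  by rewrite scale0r addr0 mul0r subrr subr0 normr0 mulr0.
have tp : 0 < `|t| by rewrite normr_gt0.
have /andP[th1 th2] : - h < t < h by rewrite -ltr_norml.
have hn : h != 0 := lt0r_neq0 h0.
have hn' : - h != 0 by rewrite oppr_eq0.
have S1 : slope (y, h) <= slope (y, t) by exact: slope_nincr.
have S2 : slope (y, t) <= slope (y, - h).
  by exact: slope_nincr.
have -> : w (y + t *: v) - w y - t * l = (slope (y, t) - l) * t.
  by rewrite /diff_quotient /=; field.
rewrite normrM ler_wpM2r//.
have : `|l - slope (x, h)| < e / 2 := Hmp; have : `|l - slope (x, - h)| < e / 2 := Hmm.
have := Hd1 _ y1; have := Hd2 _ y2; move: S1 S2; rewrite !ltr_distl !ler_distl.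
move: (slope (x, h)) (slope (x, - h)) (slope (y, h)) (slope (y, - h)) (slope (y, t)) => a b c d f.
lra.
Qed.

(** Slopes decrease along a line, so distinct points of non-derivability have
  disjoint nonempty jump intervals, each of which contains a rational. *)
Lemma countable_non_derivable x :
  countable [set t : R | right_derive (x + t *: v) != left_derive (x + t *: v)].
Proof.
set A := [set t | _].
have jump t : exists q : rat, A t -> right_derive (x + t *: v) < ratr q < left_derive (x + t *: v).
  have [At|nAt] := pselect (A t); last by exists 0.
  have H : right_derive (x + t *: v) < left_derive (x + t *: v).
    by rewrite lt_neqAle right_derive_le_left andbT.
  by have [q] := rat_in_itvoo H; rewrite in_itv /= => Hq; exists q.
have [q Hq] := choice jump.
apply/countable_injP; exists (pickle \o q) => s t; rewrite !inE => As At /= /(pcan_inj pickleK) qst.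
have order a b : a < b -> left_derive (x + b *: v) <= right_derive (x + a *: v).
  move=> ab; have ba : 0 < b - a by rewrite subr_gt0.
  apply: le_trans (left_derive_le_slope _ ba) _.
  apply: le_trans (slope_le_right_derive _ ba).
  rewrite /diff_quotient /= -!addrA -!scalerDl (_ : b + - (b - a) = a); last by ring.
  rewrite (_ : a + (b - a) = b); last by ring.
  by rewrite -[X in X * _ <= _]/((- (b - a))^-1) invrN mulNr -mulrN opprB.
have := Hq _ As; have := Hq _ At; rewrite qst => /andP[a1 a2] /andP[b1 b2].
have [st|ts|//] := ltgtP s t.
- by have := order _ _ st; rewrite leNgt (lt_trans b1 a2).
- by have := order _ _ ts; rewrite leNgt (lt_trans a1 b2).
Qed.

Lemma measurable_slope k : measurable_fun setT (fun x => slope (x, k)).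
Proof.
by apply: continuous_measurable_rV => [|x _]; [exact: openT|exact: slope_continuous].
Qed.

Lemma measurable_right_derive : measurable_fun setT right_derive.
Proof.
apply: (@measurable_fun_cvg _ _ _ _ (fun m x => qp x m)) => [m|x _].
  exact: measurable_slope.
exact: cvg_right_derive.
Qed.

Lemma measurable_left_derive : measurable_fun setT left_derive.
Proof.
apply: (@measurable_fun_cvg _ _ _ _ (fun m x => qm x m)) => [m|x _].
  exact: measurable_slope.
exact: cvg_left_derive.
Qed.

End concave.

(** * The gradient of the distance *)

Section distance_gradient.
Context {R : realType} {n : nat}.
Local Notation E := 'rV[R]_n.
Local Notation mu := (lebesgue_rV R n).
Implicit Types (x y v : E).

Lemma sderiv_dotr x (i : 'I_n) : sderiv (fun y : E => dotr y y) x (delta_mx 0 i) (2 * x 0 i).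
Proof.
apply/sderivP => e e0; exists (e / 3) => [|y t yd td]; first by rewrite divr_gt0.
have yi := le_lt_trans (le_coord_norm (y - x) i) yd; rewrite !mxE in yi.
have -> : dotr (y + t *: delta_mx 0 i) (y + t *: delta_mx 0 i) - dotr y y - t * (2 * x 0 i)
   = (2 * (y 0 i - x 0 i) + t) * t.
  rewrite !(dotrDl, dotrDr, dotrZl, dotrZr) (dotrC y (delta_mx 0 i)) !dotr_delta mxE !eqxx /=; ring.
rewrite normrM ler_wpM2r//; apply: le_trans (ler_normD _ _) _.
rewrite normrM ger0_norm//; lra.
Qed.

Variable (F : E -> R).
Hypothesis hF : strongly_convex_norm F.
Hypothesis n_gt0 : (0 < n)%N.
Variable (U : set E).
Hypothesis bd_U : boundary U !=set0.
Hypothesis oU : open U.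
Local Notation d := (distF F U).

(** The Lipschitz bound gives [dotr v p <= polar F v] for all [v]; for [v = grad F p],
  whose polar norm is at most [1], it reads [F p <= 1]. Along the segment towards a
  nearest boundary point the distance decreases as fast as that bound allows,
  which gives [1 <= F p]. *)
Lemma eikonal x (p : E) : U x -> (forall i, sderiv d x (delta_mx 0 i) (p 0 i)) -> F p = 1.
Proof.
move=> Ux dp.
have dir v B : (forall t, 0 < t <= 1 -> d (x + t *: v) - d x <= t * B) -> dotr v p <= B.
  move=> HB; apply/ler_addgt0Pr => e e0.
  have n1 : 0 < 1 + `|v| by rewrite ltr_pwDl.
  have [de de0 Hde] := sderiv_total dp (divr_gt0 e0 n1).
  pose t := Num.min 1 (de / 2 / (1 + `|v|)).
  have t0 : 0 < t by rewrite lt_min !divr_gt0//= ltr01.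
  have tv : `|t *: v| < de.
    rewrite normrZ gtr0_norm//; apply: (@le_lt_trans _ _ (de / 2 / (1 + `|v|) * `|v|)).
      by rewrite ler_wpM2r// ge_min lexx orbT.
    by rewrite mulrAC ltr_pdivrMr//; have := normr_ge0 v; nra.
  have := Hde _ tv; rewrite ler_norml dotrZl normrZ (gtr0_norm t0) => /andP[H _].
  have t1 : 0 < t <= 1 by rewrite t0 ge_min lexx.
  have H2 := HB t t1.
  have H3 : e / (1 + `|v|) * (t * `|v|) <= t * e.
    by rewrite mulrAC ler_pdivrMr//; have := mulr_gt0 e0 t0; lra.
  rewrite -(ler_pM2l t0); lra.
have d0 := distF_gt0 hF n_gt0 bd_U oU Ux.
have up v : dotr v p <= polar F v.
  apply: dir => t /andP[t0 _]; rewrite lerBlDl.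
  apply: le_trans (distF_lip hF n_gt0 bd_U _ x) _; rewrite lerD2l addrC addKr.
  by apply: polarZ_le => //; exact: ltW.
have [y Uy dy] := distF_attained hF n_gt0 bd_U x.
have lo : d x <= dotr (x - y) p.
  rewrite -lerN2 -dotrNl opprB; apply: dir => t /andP[t0 t1].
  have : d (x + t *: (y - x)) <= (1 - t) * d x.
    apply: le_trans (distF_le hF n_gt0 bd_U _ Uy) _.
    rewrite dy (_ : x + t *: (y - x) - y = (1 - t) *: (x - y)); last first.
      by apply/rowP => i; rewrite !mxE; ring.
    by apply: polarZ_le => //; rewrite subr_ge0.
  lra.
have p1 : 1 <= F p.
  have := dotr_le_polar hF n_gt0 p (x - y); rewrite -dy dotrC => H.
  by rewrite -(ler_pM2r d0) mul1r; exact: le_trans lo H.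
have p0 : p != 0 by apply: contraTneq p1 => ->; rewrite (scn0 hF) -ltNge ltr01.
apply/eqP; rewrite eq_le p1 andbT -(dotr_grad hF p0) dotrC.
apply: le_trans (up _) _; apply: polar_le => // xi; rewrite mulr1.
exact: dotr_grad_le.
Qed.

(** Subtracting a multiple of the square of the Euclidean norm from [d ^ 2] leaves a
  concave function [w]. On each line parallel to an axis, [w] is derivable off a
  countable set; hence [w] is strictly derivable in the axis directions almost
  everywhere, and so is [d], as a square root. *)
Lemma distF_gradient : exists S : set E,
  [/\ measurable S, mu (~` S) = 0%E,
   (forall x i, U x -> S x -> sderiv d x (delta_mx 0 i) (grad d x 0 i)) &
   (forall i, measurable_fun U (fun x => grad d x 0 i))].
Proof.
have [K K0 HK] := distF_semiconcave hF n_gt0 bd_U.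
pose w y := d y ^+ 2 - K * dotr y y.
have w_concave x y t : 0 <= t <= 1 ->
    t * w x + (1 - t) * w y <= w (t *: x + (1 - t) *: y).
  move=> t01; have := HK x y t t01; rewrite -dotr_convex /w; lra.
have cd x : {for x, continuous d} := distF_continuous hF n_gt0 bd_U (x:=x).
have w_cont x : {for x, continuous w}.
  have c1 : {for x, continuous (fun y => d y ^+ 2)} := continuousM (cd x) (cd x).
  have c2 : {for x, continuous (fun y : E => K * dotr y y)}.
    apply: (@sderiv_continuous _ _ _ x (K *: (2 *: x))) => i; rewrite !mxE.
    by apply: sderivZ; exact: sderiv_dotr.
  exact: (continuousB c1 c2).
pose Dp i := right_derive w (delta_mx 0 i).
pose Dm i := left_derive w (delta_mx 0 i).
have mDp i : measurable_fun setT (Dp i) by exact: measurable_right_derive.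
have mDm i : measurable_fun setT (Dm i) by exact: measurable_left_derive.
pose S i := [set x | Dp i x = Dm i x].
have mS i : measurable (S i).
  have := measurable_fun_eqr (mDp i) (mDm i).
  move=> /(_ measurableT [set true] I); rewrite setTI.
  by congr measurable; apply/seteqP; split => x /= /eqP.
have nS i : mu (~` S i) = 0%E.
  apply: (null_of_countable_lines (i:=i)); first exact: measurableC.
  move=> x; have := countable_non_derivable (delta_mx 0 i) w_concave x.
  by congr countable; apply/seteqP; split => t /= /eqP.
have dKK x i : sderiv (fun y : E => K * dotr y y) x (delta_mx 0 i) (K * (2 * x 0 i)).
  by apply: sderivZ; exact: sderiv_dotr.
have dS i x : U x -> S i x -> sderiv d x (delta_mx 0 i) ((Dm i x + 2 * K * x 0 i) / (2 * d x)).
  move=> Ux Sx; have d0 := distF_gt0 hF n_gt0 bd_U oU Ux.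
  apply: sderiv_of_sqr; [exact: cd|exact: lt0r_neq0|].
  have H := sderivD (sderiv_concave w_concave w_cont Sx) (dKK x i).
  rewrite (_ : (fun y => d y ^+ 2) = (fun y => w y + K * dotr y y)); last first.
    by apply/funext => y; rewrite /w subrK.
  by rewrite -mulrA [2 * (K * _)]mulrCA.
have gradS i x : U x -> S i x -> grad d x 0 i = (Dm i x + 2 * K * x 0 i) / (2 * d x).
  by move=> Ux Sx; rewrite mxE; have [_] := sderiv_is_derive (dS i x Ux Sx).
(* off [S i] the partial derivative does not exist, and has its default value *)
have gradNS i x : U x -> ~ S i x -> grad d x 0 i = point.
  move=> Ux nSx; rewrite mxE; apply: dvgP => D; apply: nSx.
  have dd : is_derive x (delta_mx 0 i) d ('D_(delta_mx 0 i) d x) by split.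
  have dq : is_derive x (delta_mx 0 i) (fun y => K * dotr y y) (K * (2 * x 0 i)).
    exact: sderiv_is_derive (dKK x i).
  have dd2 : is_derive x (delta_mx 0 i) (fun y => d y * d y) _ := is_deriveM dd dd.
  have [e1 e2] := is_derive_one_sided w_concave (is_deriveB dd2 dq).
  by rewrite /S /= /Dp /Dm [LHS]e1 [RHS]e2.
exists (\bigcap_(i in [set: 'I_n]) S i); split.
- by apply: fin_bigcap_measurable.
- apply: measure_negligible.
    by apply: measurableC; exact: fin_bigcap_measurable.
  pose N k := if insub k is Some i then ~` S (i : 'I_n) else set0.
  apply: (@negligibleS _ _ _ _ (\bigcup_k N k)).
    move=> x /= nSx; have [i nSi] : exists i, ~ S i x.
      by apply: contrapT => H; apply: nSx => i _; apply: contrapT => Hi; apply: H; exists i.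
    by exists (i : nat) => //; rewrite /N valK.
  apply: negligible_bigcup => k; rewrite /N; case: insubP => [i _ _|_].
    by apply/negligibleP; [exact: measurableC|exact: nS].
  exact: negligible_set0.
- move=> x i Ux Sx; have Six : S i x by exact: Sx.
  by rewrite gradS//; exact: dS.
- move=> i; apply: (eq_measurable_fun (fun x => if Dp i x == Dm i x
      then (Dm i x + 2 * K * x 0 i) / (2 * d x) else point)).
    move=> x; rewrite inE => Ux; case: eqP => Sx; first by rewrite gradS.
    by rewrite gradNS.
  have mU : measurable U by exact: open_measurable_rV.
  apply: measurable_fun_if => //.
  + apply: measurable_fun_eqr; apply: measurable_funTS; [exact: mDp|exact: mDm].
  + apply: (measurable_funS mU (@subIsetl _ U _)).
    apply: measurable_funM.
      apply: measurable_funTS; apply: measurable_funD; first exact: mDm.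
      by apply: measurable_funM; [exact: measurable_cst|exact: measurable_coord_rV].
    apply: continuous_measurable_rV => // x Ux.
    have d0 := distF_gt0 hF n_gt0 bd_U oU Ux.
    have c2 : {for x, continuous (fun y => 2 * d y)}.
      have c0 : {for x, continuous (fun=> 2 : R)} := @continuous_cst_for _ _ 2 x.
      exact: (continuousM c0 (cd x)).
    apply: continuousV => //; first by rewrite mulf_neq0// lt0r_neq0.
Qed.

End distance_gradient.

(** * Smooth functions *)

Section smooth_functions.
Context {R : realType} {n : nat}.
Local Notation E := 'rV[R]_n.
Implicit Types (f g : E -> R) (x y v : E).

Definition smooth f := forall k, class_C k setT f.

(** Weaker than a compact support inside an open set, and stable under derivation
  and rescaling. *)
Definition bounded_support f := exists M : R, forall x, M < `|x| -> f x = 0.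

Lemma compact_norm_bounded (K : set E) : compact K ->
  exists M : R, forall x, K x -> `|x| <= M.
Proof.
move=> /compact_bounded[M [_ HM]]; exists (M + 1) => x Kx.
by apply: HM => //; rewrite ltrDl.
Qed.

Lemma class_C_continuous k f x : class_C k setT f -> {for x, continuous f}.
Proof. by case: k => [|k] [cf _]; exact: cf. Qed.

Lemma smooth_continuous f x : smooth f -> {for x, continuous f}.
Proof. by move=> /(_ 0%N); exact: class_C_continuous. Qed.

Lemma smooth_derivable f x i : smooth f -> derivable f x (delta_mx 0 i).
Proof. by move=> /(_ 1%N)[_ /(_ i)[+ _]]; exact. Qed.

Lemma smooth_derive f i : smooth f -> smooth ('D_(delta_mx 0 i) f).
Proof. by move=> sf k; have [_ /(_ i)[_]] := sf k.+1. Qed.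

Lemma smooth_sderiv f x i : smooth f -> sderiv f x (delta_mx 0 i) ('D_(delta_mx 0 i) f x).
Proof.
move=> sf; apply: (@sderiv_of_C1 _ _ f setT) => //; first exact: openT.
  by move=> y _; exact: smooth_derivable.
exact/smooth_continuous/smooth_derive.
Qed.

Lemma class_CW k f : class_C k.+1 setT f -> class_C k setT f.
Proof.
elim: k f => [|k IH] f [cf df]; split => // i; have [d1 d2] := df i.
by split => //; exact: IH.
Qed.

Lemma class_CD k f g : class_C k setT f -> class_C k setT g -> class_C k setT (f + g).
Proof.
elim: k f g => [|k IH] f g [cf df] [cg dg]; split=> //;
  try by move=> x _; exact: (continuousD (cf x I) (cg x I)).
move=> i; have [d1 d2] := df i; have [d3 d4] := dg i; split.
  by move=> x _; apply: derivableD; [exact: d1|exact: d3].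
rewrite (_ : 'D_(delta_mx 0 i) (f + g) = 'D_(delta_mx 0 i) f + 'D_(delta_mx 0 i) g); first exact: IH.
by apply/funext => x; rewrite deriveD//; [exact: d1|exact: d3].
Qed.

Lemma class_CM k f g : class_C k setT f -> class_C k setT g -> class_C k setT (f * g).
Proof.
elim: k f g => [|k IH] f g Cf Cg; have [cf df] := Cf; have [cg dg] := Cg; split=> //;
  try by move=> x _; exact: (continuousM (cf x I) (cg x I)).
move=> i; have [d1 d2] := df i; have [d3 d4] := dg i; split.
  by move=> x _; apply: derivableM; [exact: d1|exact: d3].
rewrite (_ : 'D_(delta_mx 0 i) (f * g) = f * 'D_(delta_mx 0 i) g + g * 'D_(delta_mx 0 i) f).
  by apply: class_CD; apply: IH => //; exact: class_CW.
by apply/funext => x; rewrite deriveM//; [exact: d1|exact: d3].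
Qed.

Lemma class_C_cst k (c : R) : class_C k setT (cst c : E -> R).
Proof.
elim: k c => [|k IH] c; split => //; try by move=> x _; exact: cst_continuous.
move=> i; split; first by move=> x _; exact: derivable_cst.
rewrite (_ : 'D_(delta_mx 0 i) (cst c) = cst 0); first exact: IH.
by apply/funext => x; rewrite derive_cst.
Qed.

Lemma smooth_scale f (s : R) : smooth f -> smooth (fun y => f (s *: y)).
Proof.
move=> sf k; elim: k f sf => [|k IH] f sf; split => //; try (move=> x _;
  by apply: (continuous_comp (f := fun y : E => s *: y));
    [exact: scaler_continuous|exact: smooth_continuous]).
move=> i; have D x : is_derive x (delta_mx 0 i) (fun y => f (s *: y)) (s * 'D_(delta_mx 0 i) f (s *: x)).
  have := @is_derive_scale _ _ f s x (delta_mx 0 i) (grad f (s *: x)).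
  rewrite dotr_delta mxE; apply => j; rewrite mxE; exact: smooth_sderiv.
split; first by move=> x _; have [] := D x.
rewrite (_ : 'D_(delta_mx 0 i) _ = cst s * (fun y => 'D_(delta_mx 0 i) f (s *: y))).
  by apply: class_CM; [exact: class_C_cst|exact: (IH _ (smooth_derive i sf))].
by apply/funext => x; have [_ ->] := D x.
Qed.

Lemma smoothM f g : smooth f -> smooth g -> smooth (f * g).
Proof. by move=> sf sg k; exact: class_CM. Qed.

Lemma smooth_cst (c : R) : smooth (cst c : E -> R).
Proof. by move=> k; exact: class_C_cst. Qed.

Lemma derive_bounded_support f i : bounded_support f ->
  bounded_support ('D_(delta_mx 0 i) f).
Proof.
move=> [M HM]; exists M => x Mx.
have N : \forall y \near x, f y = (cst 0 : E -> R) y.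
  apply/nbhs_ballP; exists (`|x| - M); first by rewrite /= subr_gt0.
  move=> y; rewrite -ball_normE /= => H; apply: HM.
  by have := lerB_dist x y; lra.
by rewrite (near_eq_derive _ N) derive_cst.
Qed.

Lemma bounded_of_support f : (forall x, {for x, continuous f}) -> bounded_support f ->
  exists2 B : R, 0 <= B & forall x, `|f x| <= B.
Proof.
move=> cf [M HM]; pose A := [set x : E | `|x| <= `|M|].
have A0 : A !=set0 by exists 0; rewrite /A /= normr0.
have cA : compact A.
  apply: bounded_closed_compact.
    by exists `|M|; split; [exact: num_real|] => B HB x /= /le_trans; apply; exact: ltW.
  rewrite (_ : A = (fun x : E => `|x|) @^-1` [set r | r <= `|M|])//.
  by apply: preimage_closed; [move=> x _; exact: norm_continuous|exact: closed_le].
have [|x _ Hmax] := compact_EVT_max A0 cA (f := fun x => `|f x|).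
  apply: continuous_in_subspaceT => x _.
  by apply: (continuous_comp (f := f)); [exact: cf|exact: norm_continuous].
exists `|f x| => // y; have [yM|yM] := leP `|y| `|M|; first by apply: Hmax; rewrite inE.
by rewrite HM ?normr0//; apply: le_lt_trans yM; exact: ler_norm.
Qed.

Lemma smooth_lipschitz f : smooth f -> bounded_support f ->
  exists2 L : R, 0 <= L & forall x y, `|f x - f y| <= L * `|x - y|.
Proof.
move=> sf bf.
have /choice[B HB] (i : 'I_n) : exists B : R, 0 <= B /\ forall x, `|'D_(delta_mx 0 i) f x| <= B.
  have [|B B0 HB] := @bounded_of_support ('D_(delta_mx 0 i) f) _ (derive_bounded_support i bf).
    by move=> x; exact/smooth_continuous/smooth_derive.
  by exists B.
pose M := \sum_(i < n) B i.
have M0 : 0 <= M by apply: sumr_ge0 => i _; have [] := HB i.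
exists (M * n%:R); first by rewrite mulr_ge0.
apply: lipschitz_of_partials => // x i t.
have [s _|s _ ->] := @derive_line _ _ f x (delta_mx 0 i) t; first exact: smooth_derivable.
rewrite normrM mulrC ler_wpM2r//; have [B0 /(_ (x + s *: delta_mx 0 i))] := HB i.
move=> /le_trans; apply; rewrite /M (bigD1 i)//= lerDl.
by apply: sumr_ge0 => j _; have [] := HB j.
Qed.

Lemma test_function_smooth (U : set E) f : test_function U f -> smooth f.
Proof. by case. Qed.

Lemma test_function_bounded_support (U : set E) f : test_function U f -> bounded_support f.
Proof.
move=> [_ cf _]; have [M HM] := compact_norm_bounded cf.
exists M => x Mx; apply: contraTeq Mx => fx0; rewrite -leNgt; apply: HM.
exact: subset_closure.
Qed.

End smooth_functions.

(** * Convolution with a smooth kernel *)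

Section convolution.
Context {R : realType} {n : nat}.
Local Notation E := 'rV[R]_n.
Local Notation mu := (lebesgue_rV R n).
Implicit Types (f g psi rho : E -> R) (x y v : E).

Lemma measurable_norm_ball (M : R) : measurable [set x : E | `|x| <= M].
Proof.
apply: closed_measurable_rV.
rewrite (_ : [set x : E | _] = (fun x : E => `|x|) @^-1` [set r | r <= M])//.
by apply: preimage_closed; [move=> x _; exact: norm_continuous|exact: closed_le].
Qed.

Lemma norm_ball_finite (M : R) : (mu [set x : E | (`|x| <= M)%R] < +oo)%E.
Proof.
have [M0|M0] := leP 0 M.
  rewrite (_ : [set x : E | _] = [set z | `|z - 0| <= M]).
    by rewrite lebesgue_rV_closed_ball// ltry.
  by apply/seteqP; split => x /=; rewrite subr0.
rewrite (_ : [set x : E | _] = set0) ?measure0//.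
by apply/seteqP; split => x //= /(le_trans (normr_ge0 _)); rewrite leNgt M0.
Qed.

Lemma bounded_support_integrable f (D : set E) : measurable D -> measurable_fun D f ->
  (exists B : R, forall x, D x -> `|f x| <= B) ->
  (exists M : R, forall x, D x -> M < `|x| -> f x = 0) ->
  mu.-integrable D (EFin \o f).
Proof.
move=> mD mf [B HB] [M HM].
pose A := [set x : E | `|x| <= M].
have mA : measurable A by exact: measurable_norm_ball.
have mDA : measurable (D `&` A) by exact: measurableI.
have int1 : mu.-integrable (D `&` A) (EFin \o f).
  apply: measurable_bounded_integrable => //.
  - apply: le_lt_trans (norm_ball_finite M); apply: le_measure; rewrite ?inE//.
  - exact: (measurable_funS mD (@subIsetl _ D A)).
  - by exists B; split; [exact: num_real|] => C BC x [Dx _]; apply: le_trans (HB _ Dx) (ltW BC).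
rewrite integrable_mkcond// in int1; rewrite integrable_mkcond//.
congr (mu.-integrable _ _) : int1; apply/funext => x; rewrite !patchE.
have [xD|xD] := boolP (x \in D).
  have [xA|xA] := boolP (x \in A); first by rewrite ifT// in_setI xD.
  rewrite ifF; last by rewrite in_setI (negbTE xA) andbF.
  rewrite /= HM//; first by move: xD; rewrite inE.
  by move: xA; rewrite notin_setE /A /= => /negP; rewrite -ltNge.
by rewrite ifF// in_setI (negbTE xD).
Qed.

Variable psi : E -> R.
Hypothesis mpsi : measurable_fun setT psi.
Hypothesis bpsi : exists B : R, forall x, `|psi x| <= B.
Hypothesis spsi : bounded_support psi.

Let A := \int[mu]_y `|psi y|.

Let A_ge0 : 0 <= A.
Proof. by apply: Rintegral_ge0. Qed.

Let psiM_integrable (h : E -> R) : measurable_fun setT h -> (exists B : R, forall x, `|h x| <= B) ->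
  mu.-integrable setT (EFin \o (fun y => psi y * h y)).
Proof.
move=> mh [B HB]; have [C HC] := bpsi; have [M HM] := spsi.
apply: bounded_support_integrable => //.
- exact: measurable_funM.
- by exists (C * B) => x _; rewrite normrM ler_pM.
- by exists M => x _ /HM ->; rewrite mul0r.
Qed.

Let le_psiM (h : E -> R) c : measurable_fun setT h -> (forall x, `|h x| <= c) ->
  `|\int[mu]_y (psi y * h y)| <= c * A.
Proof.
move=> mh hc.
have int1 := psiM_integrable mh (ex_intro _ c hc).
have mn : measurable_fun setT (fun y => `|psi y|).
  exact: measurableT_comp.
have int2 : mu.-integrable setT (EFin \o (fun y => `|psi y|)).
  have [C HC] := bpsi; have [M HM] := spsi.
  apply: bounded_support_integrable => //.
    by exists C => x _; rewrite normr_id.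
  by exists M => x _ /HM ->; rewrite normr0.
apply: le_trans (le_normr_Rintegral _ int1) _ => //.
rewrite -RintegralZl//; apply: le_Rintegral => //.
- have [B HB] := bpsi; have [M HM] := spsi.
  apply: bounded_support_integrable => //.
  + by apply: measurableT_comp => //; exact: measurable_funM.
  + by exists (B * c) => x _; rewrite normr_id normrM ler_pM.
  + by exists M => x _ /HM ->; rewrite mul0r normr0.
- by have := @integrableZl _ _ _ mu setT measurableT c _ int2.
- by move=> x _; rewrite normrM mulrC ler_wpM2r.
Qed.

Definition convolution rho x := \int[mu]_y (psi y * rho (x - y)).

Let kernel_measurable rho x : smooth rho -> measurable_fun setT (fun y => rho (x - y)).
Proof.
move=> sr; apply: measurableT_comp; last exact: measurable_reflect.
by apply: continuous_measurable_rV => [|y _]; [exact: openT|exact: smooth_continuous].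
Qed.

Let kernel_bounded rho x : smooth rho -> bounded_support rho ->
  exists B : R, forall y, `|rho (x - y)| <= B.
Proof.
move=> sr br; have [|B _ HB] := @bounded_of_support _ _ rho _ br.
  by move=> z; exact: smooth_continuous.
by exists B => y; exact: HB.
Qed.

Let conv_integrable rho x : smooth rho -> bounded_support rho ->
  mu.-integrable setT (EFin \o (fun y => psi y * rho (x - y))).
Proof.
by move=> sr br; apply: psiM_integrable; [exact: kernel_measurable|exact: kernel_bounded].
Qed.

Let convB_le rho x x' c : smooth rho -> bounded_support rho ->
  (forall y, `|rho (x - y) - rho (x' - y)| <= c) ->
  `|convolution rho x - convolution rho x'| <= c * A.
Proof.
move=> sr br H; rewrite /convolution -RintegralB//; try exact: conv_integrable.
have -> : (fun y => psi y * rho (x - y) - psi y * rho (x' - y)) =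
  (fun y => psi y * (rho (x - y) - rho (x' - y))) by apply/funext => y; rewrite mulrBr.
by apply: le_psiM => //; apply: measurable_funB; exact: kernel_measurable.
Qed.

Lemma conv_continuous rho x : smooth rho -> bounded_support rho ->
  {for x, continuous (convolution rho)}.
Proof.
move=> sr br; have [L L0 HL] := smooth_lipschitz sr br.
apply/continuous_distP => e e0.
have LA : 0 < 1 + L * A by rewrite ltr_pwDl// mulr_ge0.
exists (e / (1 + L * A)) => [|x' xx']; first by rewrite divr_gt0.
apply: (@le_trans _ _ ((L * `|x' - x|) * A)).
  apply: convB_le => // y; apply: le_trans (HL _ _) _.
  by rewrite opprB addrA subrK.
rewrite ltr_pdivlMr// in xx'; have := normr_ge0 (x' - x); nra.
Qed.

(** The difference quotients of the kernel converge uniformly, because its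
  derivative is Lipschitz; this takes the derivative under the integral. *)
Lemma conv_is_derive rho x i : smooth rho -> bounded_support rho ->
  is_derive x (delta_mx 0 i) (convolution rho) (convolution ('D_(delta_mx 0 i) rho) x).
Proof.
move=> sr br; set rho' := 'D_(delta_mx 0 i) rho.
have sr' : smooth rho' by exact: smooth_derive.
have br' : bounded_support rho' by exact: derive_bounded_support.
have [L L0 HL] := smooth_lipschitz sr' br'.
have H z (t : R) : `|rho (z + t *: delta_mx 0 i) - rho z - t * rho' z| <= L * `|t| * `|t|.
  have [s _|s st ->] := @derive_line _ _ rho z (delta_mx 0 i) t; first exact: smooth_derivable.
  rewrite -mulrBr normrM mulrC ler_wpM2r//; apply: le_trans (HL _ _) _.
  rewrite addrC addKr normrZ ler_wpM2l//; apply: le_trans st.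
  by rewrite -[leRHS]mulr1 ler_wpM2l// norm_delta_mx.
have C : (fun h : R => h^-1 *: ((convolution rho \o shift x) (h *: delta_mx 0 i) - convolution rho x)) @ (0 : R)^'
    --> convolution rho' x.
  apply/cvgrPdist_le => e e0.
  have LA : 0 < 1 + L * A by rewrite ltr_pwDl// mulr_ge0.
  rewrite near_withinE; apply/nbhs_ballP; exists (e / (1 + L * A)); first by rewrite /= divr_gt0.
  move=> t; rewrite -ball_normE /= sub0r normrN ltr_pdivlMr// => td t0.
  have tp : 0 < `|t| by rewrite normr_gt0.
  rewrite -(ler_pM2r tp) -normrM mulrBl [_ *: _]/(_ * _) mulrAC mulVf// mul1r distrC [_ + x]addrC.
  apply: (@le_trans _ _ (L * `|t| * `|t| * A)); last first.
    by have := A_ge0; have := normr_ge0 t; nra.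
  have -> : convolution rho (x + t *: delta_mx 0 i) - convolution rho x - convolution rho' x * t =
    \int[mu]_y (psi y * (rho (x - y + t *: delta_mx 0 i) - rho (x - y) - t * rho' (x - y))).
    rewrite [convolution rho' x * t]mulrC /convolution -RintegralZl//; last exact: conv_integrable.
    rewrite -RintegralB//; try exact: conv_integrable.
    rewrite -RintegralB//; last 2 first.
    - by have := @integrableB _ _ _ mu setT measurableT _ _
        (conv_integrable (x + t *: delta_mx 0 i) sr br) (conv_integrable x sr br).
    - by have := @integrableZl _ _ _ mu setT measurableT t _ (conv_integrable x sr' br').
    by congr (Rintegral mu setT _); apply/funext => y; rewrite [x + _ - y]addrAC; ring.
  apply: le_psiM => // ; apply: measurable_funB.
    apply: measurable_funB; last exact: kernel_measurable.
    rewrite (_ : (fun y => _) = (fun y => rho ((x + t *: delta_mx 0 i) - y))).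
      exact: kernel_measurable.
    by apply/funext => y; rewrite addrAC.
  by apply: measurable_funM; [exact: measurable_cst|exact: kernel_measurable].
by split; [apply/cvg_ex; exists (convolution rho' x)|exact: cvg_lim C].
Qed.

Lemma conv_smooth rho : smooth rho -> bounded_support rho -> smooth (convolution rho).
Proof.
move=> sr br k; elim: k rho sr br => [|k IH] rho sr br; split => //;
  try (by move=> x _; exact: conv_continuous).
move=> i; split; first by move=> x _; have [] := conv_is_derive x i sr br.
rewrite (_ : 'D_(delta_mx 0 i) (convolution rho) = convolution ('D_(delta_mx 0 i) rho)).
  by apply: IH; [exact: smooth_derive|exact: derive_bounded_support].
by apply/funext => x; have [_ ->] := conv_is_derive x i sr br.
Qed.

(** With the kernel centred at the origin, bounds on increments of [psi] pass to
  the convolution. *)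
Lemma convE rho x : smooth rho -> convolution rho x = \int[mu]_z (psi (x - z) * rho z).
Proof.
move=> sr; rewrite /convolution /Rintegral; congr fine.
rewrite -(integral_reflect x).
  by apply: eq_integral => z _; rewrite opprB addrCA subrr addr0.
apply/measurable_EFinP; apply: measurable_funM => //; exact: kernel_measurable.
Qed.

End convolution.

(** * Mollification *)

Section mollification.
Context {R : realType} {n : nat}.
Local Notation E := 'rV[R]_n.
Local Notation mu := (lebesgue_rV R n).
Implicit Types (f g phi psi rho : E -> R) (x y z v : E).

(** Cover [K] by balls half the size of balls contained in [U]. *)
Lemma compact_thickening (K U : set E) : compact K -> open U -> K `<=` U ->
  exists2 d : R, 0 < d & forall y x, K y -> `|x - y| < d -> U x.
Proof.
move=> /compact_near_coveringP cK oU KU.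
have := cK _ (0 : R)^'+ (fun d y => forall x, `|x - y| < d -> U x) _.
case.
  move=> y Ky; have /nbhs_ballP[e /= e0 He] : nbhs y U by apply: open_nbhs_nbhs; split => //; exact: KU.
  exists (ball y (e / 2), [set d | d < e / 2]).
    split => /=; first by apply: nbhsx_ballx; rewrite divr_gt0.
    by apply: nbhs_right_lt; rewrite divr_gt0.
  move=> [y' d] [/= yy' de] x xy'; apply: He; rewrite -ball_normE /=.
  rewrite -ball_normE /= in yy'.
  rewrite (_ : y - x = (y - y') - (x - y')); last by rewrite opprB addrA subrK.
  by apply: le_lt_trans (ler_normB _ _) _; lra.
move=> e /= e0 He; exists (e / 2); first by rewrite divr_gt0.
move=> y x Ky xy; apply: (He (e / 2)) Ky x xy => /=.
  by rewrite sub0r normrN gtr0_norm ?divr_gt0//; lra.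
by rewrite divr_gt0.
Qed.

Lemma continuous_integral_gt0 f x0 : (forall x, {for x, continuous f}) ->
  (forall x, 0 <= f x) -> 0 < f x0 -> bounded_support f -> 0 < \int[mu]_x f x.
Proof.
move=> cf f0 fx0 bf.
have f20 : 0 < f x0 / 2 by rewrite divr_gt0.
have [r r0 Hr] := (continuous_distP f x0).1 (cf x0) _ f20.
pose B := [set z : E | `|z - x0| <= r / 2].
have r20 : 0 <= r / 2 by rewrite divr_ge0// ltW.
have mB : measurable B.
  apply: closed_measurable_rV.
  rewrite (_ : B = (fun x : E => `|x - x0|) @^-1` [set s | s <= r / 2])//.
  apply: preimage_closed; last exact: closed_le.
  move=> y _; apply: continuous_comp; last exact: norm_continuous.
  by apply: continuousB; [|exact: cst_continuous].
have muB : mu B = ((2 * (r / 2)) ^+ n)%:E by exact: lebesgue_rV_closed_ball.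
have mf : measurable_fun setT f by apply: continuous_measurable_rV => //; exact: openT.
have intf : mu.-integrable setT (EFin \o f).
  apply: bounded_support_integrable => //.
    by have [C _ HC] := bounded_of_support cf bf; exists C => x _.
  by have [M HM] := bf; exists M => x _; exact: HM.
apply: (@lt_le_trans _ _ (f x0 / 2 * (2 * (r / 2)) ^+ n)).
  by rewrite mulr_gt0// exprn_gt0//; lra.
rewrite -lee_fin /Rintegral fineK; last exact: integrable_fin_num.
rewrite EFinM -muB -integral_cst//.
apply: (@le_trans _ _ (\int[mu]_(x in B) (f x)%:E)%E).
  apply: ge0_le_integral => //.
  - by move=> x _; rewrite lee_fin ltW.
  - by apply/measurable_EFinP; exact: measurable_funTS.
  - move=> x /= Bx; rewrite lee_fin; have xr : `|x - x0| < r by apply: le_lt_trans Bx _; lra.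
    by have := Hr _ xr; rewrite ler_norml; lra.
apply: ge0_subset_integral => //; first exact/measurable_EFinP.
by move=> x _; rewrite lee_fin.
Qed.

(** The square of any rescaled nonzero smooth function with bounded support, once
  normalised, is a mollifier. As a nonzero test function is at hand when this
  is used, no bump function has to be constructed. *)
Lemma approximate_identity phi x0 (d : R) : smooth phi -> bounded_support phi ->
  phi x0 != 0 -> 0 < d -> exists rho : E -> R,
  [/\ smooth rho, forall z, 0 <= rho z, forall z, d <= `|z| -> rho z = 0 &
      \int[mu]_z rho z = 1].
Proof.
move=> sp [M HM] px0 d0.
pose s := (`|M| + 1) / d.
have s0 : 0 < s by rewrite divr_gt0// ltr_wpDl.
pose phis z := phi (s *: z).
pose rho0 : E -> R := phis * phis.
have sphis : smooth phis by exact: smooth_scale.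
have srho0 : smooth rho0 by exact: smoothM.
have rho00 z : 0 <= rho0 z by exact: (sqr_ge0 (phis z)).
have rho0d z : d <= `|z| -> rho0 z = 0.
  move=> dz; suff H : phis z = 0 by rewrite [LHS](_ : _ = phis z * phis z)// H mul0r.
  apply: HM.
  rewrite normrZ gtr0_norm// /s mulrAC ltr_pdivlMr//.
  have := ler_norm M; have := normr_ge0 M; nra.
have brho0 : bounded_support rho0 by exists d => z /ltW; exact: rho0d.
have c0 : 0 < \int[mu]_z rho0 z.
  apply: (@continuous_integral_gt0 _ (s^-1 *: x0)) => //.
    by move=> x; exact: smooth_continuous.
  have e : phis (s^-1 *: x0) = phi x0 by rewrite /phis scalerA mulfV ?gt_eqF// scale1r.
  have : 0 < phis (s^-1 *: x0) ^+ 2 by rewrite e exprn_even_gt0.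
  exact.
set c := (X in 0 < X) in c0.
have rhoE z : (cst c^-1 * rho0) z = c^-1 * rho0 z by [].
exists (cst c^-1 * rho0); split.
- by apply: smoothM => //; exact: smooth_cst.
- by move=> z; rewrite rhoE mulr_ge0// invr_ge0 ltW.
- by move=> z /rho0d H; rewrite rhoE H mulr0.
- rewrite -(mulVf (lt0r_neq0 c0)) -RintegralZl//.
  apply: bounded_support_integrable => //.
  + by apply: continuous_measurable_rV => [|x _]; [exact: openT|exact: smooth_continuous].
  + have [|C _ HC] := @bounded_of_support _ _ rho0 _ brho0.
      by move=> x; exact: smooth_continuous.
    by exists C => x _.
  + by have [C HC] := brho0; exists C => x _; exact: HC.
Qed.

(** Estimates of increments, even with an error proportional to the step, pass to
  the derivative; so derivatives of mollifications can be estimated from the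
  increments of a function that is not differentiable everywhere. *)
Lemma is_derive_approx f x v l (c e : R) : is_derive x v f l ->
  (exists2 d : R, 0 < d & forall t : R, `|t| < d -> `|f (x + t *: v) - f x - t * c| <= e * `|t|) ->
  `|l - c| <= e.
Proof.
move=> [dw dl] [d d0 Hd].
have C : (fun h => h^-1 *: ((f \o shift x) (h *: v) - f x)) @ (0 : R)^' --> l by rewrite -dl.
apply/ler_addgt0Pr => eta eta0.
have /cvgrPdist_le/(_ _ eta0) := C.
rewrite near_withinE => /nbhs_ballP[d' /= d'0 Hd'].
pose t := Num.min d d' / 2.
have m0 : 0 < Num.min d d' by rewrite lt_min d0.
have t0 : 0 < t by rewrite divr_gt0.
have td : t < Num.min d d' by rewrite /t; lra.
move: td; rewrite lt_min => /andP[td td'].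
have H1 : `|l - t^-1 * (f (x + t *: v) - f x)| <= eta.
  have := Hd' t; rewrite -ball_normE /= sub0r normrN gtr0_norm// => /(_ td' (lt0r_neq0 t0)).
  by rewrite [_ + x]addrC.
have H2 : `|t^-1 * (f (x + t *: v) - f x) - c| <= e.
  have := Hd t; rewrite gtr0_norm// => /(_ td) H.
  rewrite -(ler_pM2r t0) -[X in `|_| * X](gtr0_norm t0) -normrM mulrBl mulrAC mulVf ?gt_eqF// mul1r.
  by rewrite [c * t]mulrC.
have -> : l - c = (l - t^-1 * (f (x + t *: v) - f x)) + (t^-1 * (f (x + t *: v) - f x) - c) by ring.
by apply: le_trans (ler_normD _ _) _; rewrite [e + _]addrC lerD.
Qed.

Section mollify.
Variables (psi : E -> R) (L : R).
Hypothesis mpsi : measurable_fun setT psi.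
Hypothesis psi_ge0 : forall x, 0 <= psi x.
Hypothesis bpsi : exists B : R, forall x, `|psi x| <= B.
Hypothesis psiL : forall x i (t : R), `|psi (x + t *: delta_mx 0 i) - psi x| <= L * `|t|.
Variables (K U : set E).
Hypothesis cK : compact K.
Hypothesis oU : open U.
Hypothesis KU : K `<=` U.
Hypothesis psiK : forall x, ~ K x -> psi x = 0.

Let psi_supp : bounded_support psi.
Proof.
have [M HM] := compact_norm_bounded cK; exists M => x Mx; apply: psiK => /HM.
by rewrite leNgt Mx.
Qed.

Variables (d : R) (rho : E -> R).
Hypothesis srho : smooth rho.
Hypothesis rho_ge0 : forall z, 0 <= rho z.
Hypothesis rho_supp : forall z, d <= `|z| -> rho z = 0.
Hypothesis rho1 : \int[mu]_z rho z = 1.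
Hypothesis d0 : 0 < d.
Hypothesis dU : forall y x, K y -> `|x - y| < 2 * d -> U x.

Let brho : bounded_support rho.
Proof. by exists d => z /ltW; exact: rho_supp. Qed.

Let mrho : measurable_fun setT rho.
Proof. by apply: continuous_measurable_rV => [|x _]; [exact: openT|exact: smooth_continuous]. Qed.

Let rhoM_integrable (h : E -> R) : measurable_fun setT h -> (exists B : R, forall x, `|h x| <= B) ->
  mu.-integrable setT (EFin \o (fun z => h z * rho z)).
Proof.
move=> mh [B HB].
have [|C _ HC] := @bounded_of_support _ _ rho _ brho; first by move=> x; exact: smooth_continuous.
apply: bounded_support_integrable => //.
- exact: measurable_funM.
- by exists (B * C) => x _; rewrite normrM ler_pM.
- by exists d => x _ /ltW /rho_supp ->; rewrite mulr0.
Qed.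

Let rho_integrable : mu.-integrable setT (EFin \o (fun z => rho z)).
Proof.
have := @rhoM_integrable (fun=> 1) (measurable_cst _) _.
rewrite (_ : (fun z => 1 * rho z) = rho); last by apply/funext => z; rewrite mul1r.
by apply; exists 1 => z; rewrite normr1.
Qed.

Let psi_shift_measurable x : measurable_fun setT (fun z => psi (x - z)).
Proof. by apply: measurableT_comp => //; exact: measurable_reflect. Qed.

Let psi_shift_bounded x : exists B : R, forall z, `|psi (x - z)| <= B.
Proof. by have [B HB] := bpsi; exists B => z. Qed.

Let Psi := convolution psi rho.

Let PsiB x i (t l : R) : Psi (x + t *: delta_mx 0 i) - Psi x - t * l =
  \int[mu]_z ((psi (x - z + t *: delta_mx 0 i) - psi (x - z) - t * l) * rho z).
Proof.
have E : t * l = t * l * \int[mu]_z rho z by rewrite rho1 mulr1.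
rewrite /Psi !convE// {1}E.
have i1 y := rhoM_integrable (psi_shift_measurable y) (psi_shift_bounded y).
rewrite -RintegralB// -RintegralZl// -RintegralB//; last 2 first.
- by have := @integrableB _ _ _ mu setT measurableT _ _ (i1 (x + t *: delta_mx 0 i)) (i1 x).
- by have := @integrableZl _ _ _ mu setT measurableT (t * l) _ rho_integrable.
congr (Rintegral mu setT _); apply/funext => z.
by rewrite [x + _ - z]addrAC; ring.
Qed.

Let PsiB_le x i (t l e : R) :
  (forall z, `|z| < d -> `|psi (x - z + t *: delta_mx 0 i) - psi (x - z) - t * l| <= e) ->
  `|Psi (x + t *: delta_mx 0 i) - Psi x - t * l| <= e.
Proof.
move=> H; rewrite PsiB.
have mh : measurable_fun setT (fun z => psi (x - z + t *: delta_mx 0 i) - psi (x - z) - t * l).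
  apply: measurable_funB => //; apply: measurable_funB => //.
  rewrite (_ : (fun z => _) = (fun z => psi ((x + t *: delta_mx 0 i) - z))) //.
  by apply/funext => z; rewrite addrAC.
have bh : exists B : R, forall z, `|psi (x - z + t *: delta_mx 0 i) - psi (x - z) - t * l| <= B.
  have [B HB] := bpsi; exists (B + B + `|t * l|) => z.
  by apply: le_trans (ler_normB _ _) _; rewrite lerD2r; apply: le_trans (ler_normB _ _) _; exact: lerD.
have i1 := rhoM_integrable mh bh.
apply: le_trans (le_normr_Rintegral _ i1) _ => //.
rewrite -[leRHS]mulr1 -rho1.
rewrite -RintegralZl//; apply: le_Rintegral => //.
- have := @integrable_norm _ _ _ mu setT _ i1; exact.
- by have := @integrableZl _ _ _ mu setT measurableT e _ rho_integrable.
move=> z _; rewrite normrM (ger0_norm (rho_ge0 z)).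
have [zd|zd] := ltP `|z| d; first by rewrite ler_wpM2r// H.
by rewrite rho_supp// !mulr0.
Qed.

Let Psi_is_derive x i : is_derive x (delta_mx 0 i) Psi ('D_(delta_mx 0 i) Psi x).
Proof.
by apply: derivableP; have [] := conv_is_derive mpsi bpsi psi_supp x i srho brho.
Qed.

Lemma mollify_derive_bound x i : `|'D_(delta_mx 0 i) Psi x| <= L.
Proof.
rewrite -[X in `|X|]subr0; apply: (is_derive_approx (Psi_is_derive x i)).
exists 1 => // t _; apply: PsiB_le => z _; rewrite mulr0 subr0; exact: psiL.
Qed.

Lemma mollify_derive_approx x i l e (d' : R) : d <= d' ->
  (forall y t, `|y - x| < d' -> `|t| < d' ->
    `|psi (y + t *: delta_mx 0 i) - psi y - t * l| <= e * `|t|) ->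
  `|'D_(delta_mx 0 i) Psi x - l| <= e.
Proof.
move=> dd' H; apply: (is_derive_approx (Psi_is_derive x i)).
exists d => // t td; apply: PsiB_le => z zd; apply: H; last exact: lt_le_trans dd'.
by rewrite addrC addKr normrN; exact: lt_le_trans dd'.
Qed.

Let Psi_supp x : Psi x != 0 -> exists2 y, K y & `|x - y| < d.
Proof.
move=> Psi0; apply: contrapT => H; move/eqP: Psi0; apply.
rewrite /Psi /convolution (_ : (fun y => _) = fun=> 0); first by rewrite Rintegral_cst// mul0r.
apply/funext => y; have [Ky|nKy] := pselect (K y); last by rewrite psiK// mul0r.
rewrite rho_supp ?mulr0// leNgt; apply/negP => xy; apply: H; by exists y.
Qed.

Lemma mollify_ge0 x : 0 <= Psi x.
Proof. by apply: Rintegral_ge0 => y _; rewrite mulr_ge0. Qed.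

Lemma mollify_derive_supp x i (M : R) : (forall y, K y -> `|y| <= M) -> M + d < `|x| ->
  'D_(delta_mx 0 i) Psi x = 0.
Proof.
move=> HM Mx.
have N : \forall y \near x, Psi y = (cst 0 : E -> R) y.
  apply/nbhs_ballP; exists (`|x| - (M + d)); first by rewrite /= subr_gt0.
  move=> y; rewrite -ball_normE /= => H; apply/eqP; apply: contraPT H => /Psi_supp[z Kz yz].
  apply/negP; rewrite -leNgt; have := HM _ Kz.
  have := lerB_dist x y; have := lerB_dist y z; lra.
by rewrite (near_eq_derive _ N) derive_cst.
Qed.

Lemma mollify_test_function : test_function U Psi.
Proof.
have near_K x : closure [set x | Psi x != 0] x -> exists2 y, K y & `|x - y| < 2 * d.
  move=> /(_ (ball x d) (nbhsx_ballx _ _ d0))[x' [/= /Psi_supp[y Ky x'y]]].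
  rewrite -ball_normE /= => xx'; exists y => //.
  by rewrite -(subrKA x'); apply: le_lt_trans (ler_normD _ _) _; lra.
split; first exact: conv_smooth.
- apply: bounded_closed_compact; last exact: closed_closure.
  have [M HM] := compact_norm_bounded cK; exists (M + 2 * d); split; first exact: num_real.
  move=> B HB x /near_K[y Ky xy] /=; apply: le_trans (ltW HB).
  have := HM _ Ky; have := lerB_dist x y; lra.
- by move=> x /near_K[y Ky]; exact: dU.
Qed.

End mollify.

(** The interface of mollification for a nonnegative function [psi] that is Lipschitz
  along the axes and vanishes off a compact subset of [U]: nonnegative test
  functions whose partial derivatives are bounded, supported in a common ball,
  and converge wherever [psi] is strictly derivable, as dominated convergence
  requires. The nonzero function [phi] provides the kernels. *)
Lemma mollify_exists phi x0 psi (L : R) (K U : set E) : smooth phi -> bounded_support phi ->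
  phi x0 != 0 ->
  measurable_fun setT psi -> (forall x, 0 <= psi x) -> (exists B : R, forall x, `|psi x| <= B) ->
  (forall x i (t : R), `|psi (x + t *: delta_mx 0 i) - psi x| <= L * `|t|) ->
  compact K -> open U -> K `<=` U -> (forall x, ~ K x -> psi x = 0) ->
  exists Psi : nat -> E -> R,
  [/\ forall k, test_function U (Psi k) /\ (forall x, 0 <= Psi k x),
      forall k x i, `|'D_(delta_mx 0 i) (Psi k) x| <= L,
      exists M : R, forall k x i, M < `|x| -> 'D_(delta_mx 0 i) (Psi k) x = 0 &
      forall x i l, sderiv psi x (delta_mx 0 i) l ->
        'D_(delta_mx 0 i) (Psi k) x @[k --> \oo] --> l].
Proof.
move=> sp bp px0 mpsi psi0 bpsi psiL cK oU KU psiK.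
have [d d0 dU] := compact_thickening cK oU KU.
(* the factor 2 keeps the closure of the support of each mollification inside [U] *)
pose d_ k := d / 2 / k.+1%:R.
have dk0 k : 0 < d_ k by rewrite !divr_gt0.
have dkd k : 2 * d_ k <= d.
  by rewrite /d_ mulrA mulrCA mulfV// mulr1 ler_pdivrMr// -[leLHS]mulr1 ler_pM2l// ler1n.
have /choice[rho Hrho] k := approximate_identity sp bp px0 (dk0 k).
have [M HM] := compact_norm_bounded cK.
exists (fun k => convolution psi (rho k)); split.
- move=> k; have [r1 r2 r3 r4] := Hrho k; split; last exact: mollify_ge0.
  apply: (mollify_test_function mpsi bpsi cK psiK r1 r3 (dk0 k)) => y x Ky xy.
  by apply: dU Ky _; exact: lt_le_trans (dkd k).
- move=> k x i; have [r1 r2 r3 r4] := Hrho k.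
  exact: (mollify_derive_bound mpsi bpsi psiL cK psiK r1 r2 r3 r4).
- exists (M + d) => k x i Mx; have [r1 r2 r3 r4] := Hrho k.
  apply: (mollify_derive_supp psiK r3 _ HM); apply: le_lt_trans Mx.
  by rewrite lerD2l; apply: le_trans (dkd k); have := dk0 k; lra.
- move=> x i l /sderivP Hs; apply/cvgrPdist_le => e e0.
  have [d' d'0 Hd'] := Hs _ e0.
  near=> k; have [r1 r2 r3 r4] := Hrho k; rewrite distrC.
  apply: (mollify_derive_approx mpsi bpsi cK psiK r1 r2 r3 r4 (dk0 k) _ Hd').
  rewrite /d_ ler_pdivrMr// -ler_pdivrMl//.
  apply: (@le_trans _ _ k%:R); last by rewrite ler_nat.
  by near: k; exact: nbhs_infty_ger.
Unshelve. all: by end_near. Qed.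

End mollification.

(** * The Hardy inequality for test functions *)

Section flux.
Context {R : realType} {n : nat}.
Local Notation E := 'rV[R]_n.
Variable (F : E -> R).
Hypothesis hF : strongly_convex_norm F.
Implicit Types (xi p : E).

Lemma flux_bound xi i : `|F xi * grad F xi 0 i| <= F xi * F (delta_mx 0 i).
Proof.
have [->|xi0] := eqVneq xi 0; first by rewrite (scn0 hF) !mul0r normr0.
rewrite normrM ger0_norm ?scn_ge0// ler_wpM2l ?scn_ge0//.
exact: grad_coord_bound.
Qed.

(** The flux extends continuously by zero to the origin, where the gradient of [F]
  has no meaning: it is bounded by a multiple of [F]. *)
Lemma measurable_flux i : measurable_fun setT (fun xi => F xi * grad F xi 0 i).
Proof.
apply: continuous_measurable_rV => [|xi _]; first exact: openT.
have [xi0|xi0] := eqVneq xi 0.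
  rewrite xi0; have [C C0 HC] := scn_le_norm hF.
  have c0 : 0 < C * (1 + F (delta_mx 0 i)) by rewrite mulr_gt0// ltr_pwDl// scn_ge0.
  apply/continuous_distP => e e0; exists (e / (C * (1 + F (delta_mx 0 i)))) => [|y].
    by rewrite divr_gt0.
  rewrite subr0 (scn0 hF) mul0r subr0 ltr_pdivlMr// => H.
  apply: le_trans (flux_bound y i) _; apply: le_trans (ltW H).
  have F0 := scn_ge0 hF (delta_mx 0 i); have := HC y; have := normr_ge0 y => y0 Hy.
  rewrite mulrA [_ * C]mulrC; apply: ler_pM => //; first exact: scn_ge0.
  by rewrite lerDr.
have cG : {for xi, continuous (fun z => grad F z 0 i)}.
  have [_ /(_ i)[_ [/(_ xi)cD _]]] := scn_C2 hF.
  rewrite (_ : (fun z => _) = 'D_(delta_mx 0 i) F); first by apply: cD; exact/eqP.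
  by apply/funext => z; rewrite mxE.
exact: (continuousM (@scn_continuous _ _ _ hF xi) cG).
Qed.

End flux.

Section grad_continuity.
Context {R : realType} {n : nat}.
Local Notation E := 'rV[R]_n.

Lemma smooth_grad_measurable (f : E -> R) (D : set E) i : measurable D -> smooth f ->
  measurable_fun D (fun x => grad f x 0 i).
Proof.
move=> mD sf; apply: (@measurable_funS _ _ _ _ setT) => //.
rewrite (_ : (fun z => _) = 'D_(delta_mx 0 i) f); last by apply/funext => z; rewrite mxE.
by apply: continuous_measurable_rV => [|x _]; [exact: openT|exact/smooth_continuous/smooth_derive].
Qed.

Lemma lip_max (m a b : R) : `|Num.max a m - Num.max b m| <= `|a - b|.
Proof.
rewrite ler_norml; have := ler_norm (a - b); have := lerNnormlW (lexx `|a - b|).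
by case: (leP a m) => ?; case: (leP b m) => ?; lra.
Qed.

End grad_continuity.

Section core_inequality.
Context {R : realType} {n : nat}.
Local Notation E := 'rV[R]_n.
Local Notation mu := (lebesgue_rV R n).
Variable (F : E -> R).
Hypothesis hF : strongly_convex_norm F.
Hypothesis n_gt0 : (0 < n)%N.
Variable (U : set E).
Hypothesis bd_U : boundary U !=set0.
Hypothesis oU : open U.
Local Notation d := (distF F U).
Hypothesis super : distF_superharmonic F U.
Variable r : R.
Hypothesis dr : forall x, U x -> d x <= r.
Implicit Types (x y z v p xi : E) (phi : E -> R).

(** Here [t] stands for the distance, [a] for [phi], [b] for the derivative of [phi]
  along the flux and [c] for [F (grad phi)]. With [g = 1 / (2 t) - 1 / (2 r)], the
  bracket is [2 g a b + g' a ^ 2], hence at most [b ^ 2 + (g' + g ^ 2) a ^ 2], and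
  [- g' - g ^ 2 >= 1 / (4 t ^ 2) + 1 / (4 r ^ 2)] because [t <= r]. *)
Lemma pointwise_hardy (a b c t : R) : 0 < t -> t <= r -> `|b| <= c ->
  (2 * (t^-1 / 2 - r^-1 / 2) * a * b - a ^+ 2 / (2 * t ^+ 2))
  + (1 / (4 * t ^+ 2) + 1 / (4 * r ^+ 2)) * a ^+ 2 <= c ^+ 2.
Proof.
move=> t0 tr bc; have r0 : 0 < r by exact: lt_le_trans tr.
have b2 : b ^+ 2 <= c ^+ 2.
  by rewrite -(real_normK (num_real b)) lerXn2r ?nnegrE//; exact: le_trans bc.
apply: le_trans b2.
have it0 : 0 < t^-1 by rewrite invr_gt0.
have ir0 : 0 < r^-1 by rewrite invr_gt0.
have irt : r^-1 <= t^-1 by rewrite lef_pV2.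
have e1 : a ^+ 2 / (2 * t ^+ 2) = a ^+ 2 * (t^-1) ^+ 2 / 2 by field; exact: lt0r_neq0.
have e2 : 1 / (4 * t ^+ 2) = (t^-1) ^+ 2 / 4 by field; exact: lt0r_neq0.
have e3 : 1 / (4 * r ^+ 2) = (r^-1) ^+ 2 / 4 by field; exact: lt0r_neq0.
rewrite e1 e2 e3; move: (t^-1) (r^-1) it0 ir0 irt => i j i0 j0 ij.
have H1 := sqr_ge0 (b - (i / 2 - j / 2) * a).
have H2 : 0 <= a ^+ 2 * (j * (i - j)).
  by rewrite mulr_ge0 ?sqr_ge0// mulr_ge0 ?subr_ge0// ltW.
have H3 : 0 <= (b - (i / 2 - j / 2) * a) ^+ 2 + a ^+ 2 * (j * (i - j)) / 2.
  by apply: addr_ge0 => //; rewrite divr_ge0.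
rewrite -subr_ge0; apply: le_trans H3 _.
rewrite le_eqVlt; apply/orP; left; apply/eqP; by field.
Qed.

Variable phi : E -> R.
Hypothesis tphi : test_function U phi.
Variable x0 : E.
Hypothesis phix0 : phi x0 != 0.

Let sphi : smooth phi := test_function_smooth tphi.
Let bphi : bounded_support phi := test_function_bounded_support tphi.
Let K := closure [set x | phi x != 0].
Let cK : compact K. Proof. by case: tphi. Qed.
Let KU : K `<=` U. Proof. by case: tphi. Qed.
Let phiK x : ~ K x -> phi x = 0.
Proof. by move=> nKx; apply/eqP; apply: contrapT => /negP H; apply: nKx; exact: subset_closure. Qed.
Let Kx0 : K x0. Proof. exact: subset_closure. Qed.
Let cd x : {for x, continuous d} := distF_continuous hF n_gt0 bd_U (x:=x).
Let d_gt0 x : U x -> 0 < d x. Proof. exact: distF_gt0. Qed.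
Let r_gt0 : 0 < r.
Proof. exact: lt_le_trans (d_gt0 (KU Kx0)) (dr (KU Kx0)). Qed.

Let m_exists : exists2 m : R, 0 < m & forall x, K x -> m <= d x.
Proof.
have K0 : K !=set0 by exists x0.
have [|x + Hx] := compact_EVT_min K0 cK (f := d).
  by apply: continuous_in_subspaceT => x _; exact: cd.
rewrite inE => Kx; exists (d x); first exact/d_gt0/KU.
by move=> y Ky; apply: Hx; rewrite inE.
Qed.

Let g x := 2^-1 * (d x)^-1 + - (r^-1 / 2).
Let psi x := g x * (phi x * phi x).

Let psi_ge0 x : 0 <= psi x.
Proof.
have [Kx|/phiK H] := pselect (K x); last by rewrite /psi H !mulr0.
rewrite /psi mulr_ge0// -?expr2 ?sqr_ge0// /g.
have : r^-1 <= (d x)^-1 by rewrite lef_pV2 ?posrE ?d_gt0//; [exact: dr (KU Kx)|exact: KU].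
lra.
Qed.

(** On the support of [phi] the distance is at least [m]; replacing it by its maximum
  with [m] makes every factor bounded and Lipschitz on the whole space. *)
Let psi_lip : (exists B : R, forall x, `|psi x| <= B) /\
  exists L : R, forall x y, `|psi x - psi y| <= L * `|x - y|.
Proof.
have [m m0 Hm] := m_exists.
pose G x := 2^-1 * (Num.max (d x) m)^-1 - r^-1 / 2.
have psiE x : psi x = G x * (phi x * phi x).
  have [Kx|/phiK H] := pselect (K x); last by rewrite /psi H !mulr0.
  by rewrite /psi /G max_l// Hm.
have mx x : 0 < Num.max (d x) m by rewrite lt_max m0 orbT.
have im x : (Num.max (d x) m)^-1 <= m^-1 by rewrite lef_pV2 ?posrE// le_max lexx orbT.
have im0 x : 0 < (Num.max (d x) m)^-1 by rewrite invr_gt0.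
have [C C0 HC] := distF_lipschitz hF n_gt0 bd_U.
have [|B B0 HB] := @bounded_of_support _ _ phi _ bphi; first by move=> x; exact: smooth_continuous.
have [L L0 HL] := smooth_lipschitz sphi bphi.
pose BG := m^-1 / 2 + r^-1 / 2.
have ir0 : 0 < r^-1 by rewrite invr_gt0.
have imm : 0 < m^-1 by rewrite invr_gt0.
have HG x : `|G x| <= BG.
  by rewrite ler_norml /G /BG; have := im x; have := im0 x; lra.
have HGL x y : `|G x - G y| <= m^-1 ^+ 2 * C / 2 * `|x - y|.
  have -> : G x - G y = (Num.max (d y) m - Num.max (d x) m) * ((Num.max (d x) m)^-1 * (Num.max (d y) m)^-1 / 2).
    by rewrite /G; field; rewrite !lt0r_neq0.
  rewrite normrM [X in _ * X]ger0_norm; last by rewrite divr_ge0// mulr_ge0// ltW.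
  have h1 : `|Num.max (d y) m - Num.max (d x) m| <= C * `|x - y|.
    by apply: le_trans (lip_max _ _ _) _; rewrite distrC.
  have h2 : (Num.max (d x) m)^-1 * (Num.max (d y) m)^-1 / 2 <= m^-1 ^+ 2 / 2.
    by rewrite ler_wpM2r// expr2 ler_pM// ltW.
  have -> : m^-1 ^+ 2 * C / 2 * `|x - y| = (C * `|x - y|) * (m^-1 ^+ 2 / 2) by ring.
  by apply: ler_pM => //; rewrite divr_ge0// mulr_ge0// ltW.
split.
  exists (BG * (B * B)) => x; rewrite psiE !normrM.
  by apply: ler_pM => //; apply: ler_pM.
exists (m^-1 ^+ 2 * C / 2 * (B * B) + BG * (L * B + B * L)) => x y; rewrite !psiE.
rewrite (_ : _ - _ = (G x - G y) * (phi x * phi x) + G y * ((phi x - phi y) * phi x + phi y * (phi x - phi y))); last by ring.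
rewrite [leRHS]mulrDl; apply: le_trans (ler_normD _ _) _; apply: lerD; rewrite !normrM.
  rewrite [leRHS]mulrAC; apply: ler_pM => //; by apply: ler_pM.
rewrite -[leRHS]mulrA; apply: ler_pM => //; apply: le_trans (ler_normD _ _) _.
rewrite !normrM [leRHS]mulrDl; apply: lerD.
  by rewrite [leRHS]mulrAC; apply: ler_pM.
by rewrite -[leRHS]mulrA; apply: ler_pM.
Qed.

Let psi_measurable : measurable_fun setT psi.
Proof.
apply: continuous_measurable_rV => [|x _]; first exact: openT.
have [_ [L HL]] := psi_lip; apply/continuous_distP => e e0.
have L1 : 0 < 1 + `|L| by rewrite ltr_pwDl.
exists (e / (1 + `|L|)) => [|y]; first by rewrite divr_gt0.
rewrite ltr_pdivlMr// => H; apply: le_trans (HL _ _) _; apply: le_trans (ltW H).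
have := ler_norm L; have := normr_ge0 (y - x); nra.
Qed.

(** The partial derivative of [psi], in the unsimplified form in which the rules of
  strict derivability produce it. *)
Let lpsi x i := (2^-1 * (- grad d x 0 i / d x ^+ 2) + 0) * (phi x * phi x)
  + g x * (grad phi x 0 i * phi x + phi x * grad phi x 0 i).

Let psi_sderiv x i : U x -> sderiv d x (delta_mx 0 i) (grad d x 0 i) ->
  sderiv psi x (delta_mx 0 i) (lpsi x i).
Proof.
move=> Ux Sx; have d0 := lt0r_neq0 (d_gt0 Ux).
have cphi := smooth_continuous (x:=x) sphi.
have dphi : sderiv phi x (delta_mx 0 i) (grad phi x 0 i).
  by rewrite mxE; exact: smooth_sderiv.
have cdx : {for x, continuous d} := distF_continuous hF n_gt0 bd_U (x:=x).
have D1 := sderivD (sderivZ (c := 2^-1) (sderivV cdx d0 Sx)) (sderiv_cst x (delta_mx 0 i) (- (r^-1 / 2))).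
have D2 := sderivM cphi cphi dphi dphi.
have cg : {for x, continuous g}.
  have c2 : {for x, continuous (fun=> 2^-1 : R)} := @continuous_cst_for _ _ _ x.
  have c3 : {for x, continuous (fun=> - (r^-1 / 2) : R)} := @continuous_cst_for _ _ _ x.
  exact: (continuousD (continuousM c2 (continuousV d0 cdx)) c3).
exact: (sderivM cg (continuousM cphi cphi) D1 D2).
Qed.

Let W x := 1 / (4 * d x ^+ 2) + 1 / (4 * r ^+ 2).
Let p x := grad d x.
Let V x i := F (p x) * grad F (p x) 0 i.

(** Superharmonicity is tested with the mollifications of [psi = g phi ^ 2], where
  [g = 1 / (2 d) - 1 / (2 r)]; in the limit the flux pairs nonnegatively with the
  almost everywhere defined gradient of [psi], and the pointwise inequality is
  integrated. *)
Lemma hardy_test_nonzero :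
  (\int[mu]_(x in U) (W x * phi x ^+ 2)%:E <= \int[mu]_(x in U) (F (grad phi x) ^+ 2)%:E)%E.
Proof.
have [S [mS nS dS mg]] := distF_gradient hF n_gt0 bd_U oU.
have [[B HB] [L HL]] := psi_lip.
have psiL x i (t : R) : `|psi (x + t *: delta_mx 0 i) - psi x| <= `|L| * `|t|.
  apply: le_trans (HL _ _) _; rewrite addrC addKr normrZ.
  apply: (@le_trans _ _ (`|L| * (`|t| * `|delta_mx 0 i : E|))).
    by rewrite ler_wpM2r ?ler_norm// mulr_ge0.
  by rewrite ler_wpM2l// -[leRHS]mulr1 ler_wpM2l// norm_delta_mx.
have psiK x : ~ K x -> psi x = 0 by move=> /phiK H; rewrite /psi H !mulr0.
have [Psi [tPsi bPsi [M HM] cPsi]] := mollify_exists sphi bphi phix0 psi_measurable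
  psi_ge0 (ex_intro _ B HB) psiL cK oU KU psiK.
have mU : measurable U by exact: open_measurable_rV.
have mV i : measurable_fun U (fun x => V x i).
  exact: (measurable_fun_comp_rV mU (measurable_flux hF i) mg).
have Fp x : U x -> S x -> F (p x) = 1.
  by move=> Ux Sx; apply: (eikonal hF n_gt0 bd_U oU Ux) => i; exact: dS.
have Vb x i : U x -> S x -> `|V x i| <= F (delta_mx 0 i).
  by move=> Ux Sx; apply: le_trans (flux_bound hF (p x) i) _; rewrite Fp// mul1r.
have mphi : measurable_fun U phi.
  by apply: continuous_measurable_rV => // x _; exact: smooth_continuous.
have mid : measurable_fun U (fun x => (d x)^-1).
  exact: measurable_distF_inv.
have mgphi i : measurable_fun U (fun x => grad phi x 0 i) by exact: smooth_grad_measurable.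
have mlpsi i : measurable_fun U (fun x => lpsi x i).
  pose rhs x := (2^-1 * (- grad d x 0 i * ((d x)^-1 ^+ 2)) + 0) * (phi x * phi x)
    + (2^-1 * (d x)^-1 + - (r^-1 / 2)) * (grad phi x 0 i * phi x + phi x * grad phi x 0 i).
  rewrite (_ : (fun x => lpsi x i) = rhs); last first.
    by apply/funext => x; rewrite /lpsi /rhs exprVn.
  apply: measurable_funD; apply: measurable_funM.
  - apply: measurable_funD => //; apply: measurable_funM => //; apply: measurable_funM => //.
      by apply: measurable_funN; exact: mg.
    exact: measurable_funX.
  - exact: measurable_funM.
  - by apply: measurable_funD => //; exact: measurable_funM.
  - by apply: measurable_funD => //; exact: measurable_funM.
pose f x := \sum_(i < n) V x i * lpsi x i.
pose fk k x := \sum_(i < n) V x i * 'D_(delta_mx 0 i) (Psi k) x.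
have mf : measurable_fun U f.
  by apply: measurable_sum => i; exact: measurable_funM.
have mfk k : measurable_fun U (fk k).
  apply: measurable_sum => i; apply: measurable_funM => //.
  have sP := test_function_smooth (tPsi k).1.
  apply: continuous_measurable_rV => // x _; exact/smooth_continuous/smooth_derive.
pose C := \sum_(i < n) F (delta_mx 0 i) * `|L|.
have C0 : 0 <= C by apply: sumr_ge0 => i _; rewrite mulr_ge0// scn_ge0.
pose ball_M := [set x : E | `|x| <= M].
have mball : measurable ball_M by exact: measurable_norm_ball.
pose dom x := C * \1_ball_M x.
have nae (P : set E) : (forall x, S x -> P x) -> {ae mu, forall x, P x}.
  by move=> SP; exists (~` S); split; [exact: measurableC| |by move=> x /= nPx /SP].
have idom : mu.-integrable U (EFin \o dom).
  apply: bounded_support_integrable => //.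
  - apply: measurable_funM => //; apply: measurable_funTS; exact: measurable_indic.
  - exists C => x _; rewrite /dom normrM ger0_norm// -[leRHS]mulr1 ler_wpM2l//.
    by rewrite indicE; case: (x \in _); rewrite ?normr1 ?normr0.
  - exists M => x _ Mx; rewrite /dom indicE memNset ?mulr0// /ball_M /=.
    by apply/negP; rewrite -ltNge.
have [|||||intf _ cvf] := @dominated_convergence _ _ _ mu U mU
    (fun k x => (fk k x)%:E) (fun x => (f x)%:E) (EFin \o dom).
- by move=> k; exact/measurable_EFinP.
- exact/measurable_EFinP.
- apply: nae => x Sx Ux; apply: cvg_EFin; first exact: nearW.
  apply: cvg_sum => i; apply: cvgM; first exact: cvg_cst.
  by apply: cPsi; apply: psi_sderiv => //; exact: dS.
- exact: idom.
- apply: nae => x Sx k Ux; rewrite /= lee_fin /dom.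
  have [xM|xM] := leP `|x| M; last first.
    have -> : fk k x = 0 by rewrite /fk big1// => i _; rewrite HM// mulr0.
    by rewrite normr0 mulr_ge0// indicE.
  rewrite indicE mem_set// mulr1; apply: le_trans (ler_norm_sum _ _ _) _.
  by apply: ler_sum => i _; rewrite normrM ler_pM// Vb.
(* [psi] itself is not smooth; the sign passes to it in the limit *)
have f0 : (0 <= \int[mu]_(x in U) (f x)%:E)%E.
  rewrite -(cvg_lim (@ereal_hausdorff R) cvf); apply: lime_ge; first by apply/cvg_ex; eexists; exact: cvf.
  apply: nearW => k.
  have := super (tPsi k).1 (tPsi k).2; congr (_ <= _)%E; apply: eq_integral => x _.
  congr EFin; rewrite /dotr mulr_sumr /fk; apply: eq_bigr => i _.
  by rewrite /V mulrA; congr (_ * _); rewrite mxE.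
pose N := ~` S; have mN : measurable N by exact: measurableC.
have mUN : measurable (U `\` N) by exact: measurableD.
have mWphi : measurable_fun U (fun x => W x * phi x ^+ 2).
  pose rhs x := (4^-1 * (d x)^-1 ^+ 2 + 1 / (4 * r ^+ 2)) * phi x ^+ 2.
  rewrite (_ : (fun x => _) = rhs); last by apply/funext => x; congr ((_ + _) * _); rewrite exprVn div1r invfM.
  apply: measurable_funM; last exact: measurable_funX.
  apply: measurable_funD => //; apply: measurable_funM => //; exact: measurable_funX.
have [m m0 Hm] := m_exists.
have [|Bp Bp0 HBp] := @bounded_of_support _ _ phi _ bphi; first by move=> x; exact: smooth_continuous.
have W0 x : 0 <= W x by rewrite addr_ge0// divr_ge0// mulr_ge0// sqr_ge0.
have iW : mu.-integrable U (EFin \o (fun x => W x * phi x ^+ 2)).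
  apply: bounded_support_integrable => //.
  - exists ((1 / (4 * m ^+ 2) + 1 / (4 * r ^+ 2)) * Bp ^+ 2) => x Ux.
    have [Kx|/phiK ->] := pselect (K x); last first.
      rewrite expr0n mulr0 normr0 mulr_ge0 ?sqr_ge0//.
      by rewrite addr_ge0// divr_ge0// mulr_ge0// sqr_ge0.
    rewrite normrM normrX ger0_norm// ler_pM ?sqr_ge0//.
      rewrite lerD2r !div1r lef_pV2 ?posrE ?mulr_gt0 ?exprn_gt0 ?d_gt0//.
      by rewrite ler_pM2l// lerXn2r ?nnegrE ?Hm// ?(ltW m0)// ltW// d_gt0.
    by rewrite lerXn2r ?nnegrE.
  - by have [M' HM'] := bphi; exists M' => x _ /HM' ->; rewrite expr0n mulr0.
have mF : measurable_fun setT F.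
  by apply: continuous_measurable_rV => [|x _]; [exact: openT|exact: scn_continuous].
have mFgrad : measurable_fun U (fun x => F (grad phi x) ^+ 2).
  by apply: measurable_funX; exact: (measurable_fun_comp_rV mU mF mgphi).
have iF : mu.-integrable U (EFin \o (fun x => F (grad phi x) ^+ 2)).
  have [CF CF0 HCF] := scn_le_norm hF.
  have [M' HM'] := bphi.
  have Dphi_bounded i : exists B' : R, forall x, `|grad phi x 0 i| <= B'.
    have [|B' _ HB'] := @bounded_of_support _ _ ('D_(delta_mx 0 i) phi) _ (derive_bounded_support i bphi).
      by move=> x; exact/smooth_continuous/smooth_derive.
    by exists B' => x; rewrite mxE.
  have [D HD] := choice Dphi_bounded.
  pose DS := \sum_(i < n) `|D i|.
  have DS0 : 0 <= DS by apply: sumr_ge0.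
  have gradb x : `|grad phi x| <= DS.
    apply/rV_norm_leP => // i; apply: le_trans (HD i x) _; apply: le_trans (ler_norm _) _.
    by rewrite /DS (bigD1 i)//= lerDl sumr_ge0.
  apply: bounded_support_integrable => //.
  - exists ((CF * DS) ^+ 2) => x _; rewrite ger0_norm ?sqr_ge0//.
    rewrite lerXn2r ?nnegrE ?scn_ge0// ?mulr_ge0// ?(ltW CF0)//.
    by apply: le_trans (HCF _) _; rewrite ler_wpM2l// ltW.
  - have {}HDs i := derive_bounded_support i bphi.
    have [D' HD'] := choice HDs; pose DM := \sum_(i < n) `|D' i|.
    exists DM => x _ Mx; rewrite (_ : grad phi x = 0) ?(scn0 hF) ?expr0n//.
    apply/rowP => i; rewrite mxE HD' ?mxE//; apply: le_lt_trans Mx.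
    apply: le_trans (ler_norm _) _; rewrite /DM (bigD1 i)//= lerDl.
    by apply: sumr_ge0.
rewrite (negligible_integral mN mU iW nS) (negligible_integral mN mU iF nS).
rewrite (negligible_integral mN mU intf nS) in f0.
have sub : U `\` N `<=` U by move=> x [].
apply: (@le_trans _ _ (\int[mu]_(x in U `\` N) (f x + W x * phi x ^+ 2)%:E)%E).
  rewrite integralD_EFin//; [|exact: (integrableS mU mUN sub)|exact: (integrableS mU mUN sub)].
  by rewrite leeDr.
apply: le_integral => //.
- have i1 := integrableS mU mUN sub intf; have i2 := integrableS mU mUN sub iW.
  by have := integrableD mUN i1 i2.
- exact: (integrableS mU mUN sub).
move=> x; rewrite inE => -[Ux /contrapT Sx]; rewrite lee_fin.
have d0 := d_gt0 Ux; have F1 := Fp x Ux Sx.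
have p0 : p x != 0 by apply: contra_eqN F1 => /eqP ->; rewrite (scn0 hF) eq_sym oner_eq0.
pose v := grad F (p x).
have Vv i : V x i = v 0 i by rewrite /V F1 mul1r.
have vp : dotr (p x) v = 1 by rewrite dotr_grad.
pose b := dotr (grad phi x) v.
have bF : `|b| <= F (grad phi x).
  rewrite ler_norml dotr_grad_le// andbT.
  by have := dotr_grad_le hF (- grad phi x) p0; rewrite dotrNl (scnN hF) /b /v; lra.
apply: le_trans (pointwise_hardy (phi x) d0 (dr Ux) bF).
rewrite lerD2r le_eqVlt; apply/orP; left; apply/eqP.
transitivity (- (phi x ^+ 2 / (2 * d x ^+ 2)) * dotr (p x) v + 2 * g x * phi x * b).
  rewrite /f /b /dotr !mulr_sumr -big_split; apply: eq_bigr => i _ /=.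
  by rewrite Vv /lpsi /p; field; exact: lt0r_neq0.
rewrite vp /g; field; by rewrite (lt0r_neq0 d0) (lt0r_neq0 r_gt0).
Qed.

End core_inequality.

(** * The Hardy inequality in H^1_0 *)

Section integral_lincomb.
Context {R : realType} d (T : measurableType d).
Variable mu : {measure set T -> \bar R}.
Local Open Scope ereal_scope.

Lemma ge0_integral_lincomb (D : set T) (f h : T -> R) (a b : R) : measurable D ->
  measurable_fun D f -> measurable_fun D h -> (forall x, D x -> 0 <= f x)%R ->
  (forall x, D x -> 0 <= h x)%R -> (0 <= a)%R -> (0 <= b)%R ->
  \int[mu]_(x in D) (a * f x + b * h x)%:E =
  a%:E * \int[mu]_(x in D) (f x)%:E + b%:E * \int[mu]_(x in D) (h x)%:E.
Proof.
move=> mD mf mh f0 h0 a0 b0.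
rewrite -!ge0_integralZl//; try exact/measurable_EFinP.
rewrite -ge0_integralD//.
- by move=> x Dx; rewrite -EFinM lee_fin mulr_ge0// f0.
- by apply: measurable_funeM; exact/measurable_EFinP.
- by move=> x Dx; rewrite -EFinM lee_fin mulr_ge0// h0.
- by apply: measurable_funeM; exact/measurable_EFinP.
Qed.

Lemma ge0_le_integral_EFin (D : set T) (f h : T -> R) : measurable D ->
  measurable_fun D f -> measurable_fun D h -> (forall x, D x -> 0 <= f x)%R ->
  (forall x, D x -> f x <= h x)%R ->
  \int[mu]_(x in D) (f x)%:E <= \int[mu]_(x in D) (h x)%:E.
Proof.
move=> mD mf mh f0 fh; by apply: ge0_le_integral => //; exact/measurable_EFinP.
Qed.

End integral_lincomb.

Section hardy.
Context {R : realType} {n : nat}.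
Local Notation E := 'rV[R]_n.
Local Notation mu := (lebesgue_rV R n).
Variable (F : E -> R).
Hypothesis hF : strongly_convex_norm F.
Hypothesis n_gt0 : (0 < n)%N.
Variable (U : set E).
Hypothesis bd_U : boundary U !=set0.
Hypothesis oU : open U.
Local Notation d := (distF F U).
Hypothesis super : distF_superharmonic F U.
Variable r : R.
Hypothesis dr : forall x, U x -> d x <= r.
Local Notation W := (fun x => 1 / (4 * d x ^+ 2) + 1 / (4 * r ^+ 2)).

Let W_ge0 x : 0 <= W x.
Proof. by rewrite addr_ge0// divr_ge0// mulr_ge0// sqr_ge0. Qed.

Let mU : measurable U. Proof. exact: open_measurable_rV. Qed.

Lemma hardy_test phi : test_function U phi ->
  (\int[mu]_(x in U) (W x * phi x ^+ 2)%:E <= \int[mu]_(x in U) (F (grad phi x) ^+ 2)%:E)%E.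
Proof.
move=> tphi; have [[x0 phix0]|Hno] := pselect (exists x0, phi x0 != 0).
  exact: (hardy_test_nonzero hF n_gt0 bd_U oU super dr tphi phix0).
have phi0 x : phi x = 0 by apply/eqP; apply: contrapT => /negP H; apply: Hno; exists x.
rewrite integral0_eq; last by move=> x _; rewrite phi0 expr0n mulr0.
by apply: integral_ge0 => x _; rewrite lee_fin sqr_ge0.
Qed.

Lemma measurable_hardy_weight : measurable_fun U W.
Proof.
pose rhs x := 4^-1 * (d x)^-1 ^+ 2 + 1 / (4 * r ^+ 2).
rewrite (_ : W = rhs); last by apply/funext => x; congr (_ + _); rewrite exprVn div1r invfM.
apply: measurable_funD => //; apply: measurable_funM => //.
by apply: measurable_funX; exact: measurable_distF_inv.
Qed.

(** Young's inequality with a constant close to [1] on the main term. *)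
Lemma square_split (a b eta : R) : 0 < eta ->
  a ^+ 2 <= (1 + eta) * b ^+ 2 + (1 + eta^-1) * (b - a) ^+ 2.
Proof.
move=> eta0; rewrite -subr_ge0.
have -> : (1 + eta) * b ^+ 2 + (1 + eta^-1) * (b - a) ^+ 2 - a ^+ 2 =
  eta^-1 * (eta * b + (b - a)) ^+ 2 by field; exact: lt0r_neq0.
by rewrite mulr_ge0 ?sqr_ge0// invr_ge0 ltW.
Qed.

(** On the sets [d >= 1 / (k + 1)] the weight is bounded, so the left-hand side is
  controlled by convergence in [L^2], up to a factor [(1 + eta) ^ 2]; then [eta] tends to [0] and the sets exhaust [U]. *)
Lemma hardy_H10 u g : sobolev_H10 U u g ->
  (\int[mu]_(x in U) (W x * u x ^+ 2)%:E <= \int[mu]_(x in U) (F (g x) ^+ 2)%:E)%E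
  /\ (\int[mu]_(x in U) (F (g x) ^+ 2)%:E < +oo)%E.
Proof.
move=> [[[mu_ _] sg _] [phi tphi cvphi]].
have mg i : measurable_fun U (fun x => g x 0 i) by have [] := sg i.
have mF : measurable_fun setT F.
  by apply: continuous_measurable_rV => [|x _]; [exact: openT|exact: scn_continuous].
have mFg : measurable_fun U (fun x => F (g x) ^+ 2).
  by apply: measurable_funX; exact: (measurable_fun_comp_rV mU mF mg).
have [C C0 HC] := scn_le_norm hF.
have FC x : F x ^+ 2 <= C ^+ 2 * dotr x x.
  apply: (@le_trans _ _ ((C * `|x|) ^+ 2)).
    by rewrite lerXn2r ?nnegrE ?scn_ge0// mulr_ge0// ltW.
  by rewrite exprMn ler_wpM2l ?sqr_ge0// norm_le_dotr.
set A := (\int[mu]_(x in U) (F (g x) ^+ 2)%:E)%E.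
have A0 : (0 <= A)%E by apply: integral_ge0 => x _; rewrite lee_fin sqr_ge0.
have mdotr (v : E -> E) : (forall i, measurable_fun U (fun x => v x 0 i)) ->
    measurable_fun U (fun x => dotr (v x) (v x)).
  by move=> mv; apply: measurable_sum => i; exact: measurable_funM.
have Afin : (A < +oo)%E.
  apply: (@le_lt_trans _ _ (\int[mu]_(x in U) (C ^+ 2 * dotr (g x) (g x) + 0 * 0)%:E)%E).
    apply: ge0_le_integral_EFin => //.
    - apply: measurable_funD => //; apply: measurable_funM => //; exact: mdotr.
    - by move=> x _; rewrite sqr_ge0.
    - by move=> x _; rewrite mul0r addr0.
  rewrite (@ge0_integral_lincomb _ _ _ _ U (fun x => dotr (g x) (g x)) (fun=> 0))//; last 3 first.
  - exact: mdotr.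
  - by move=> x _; exact: dotr_ge0.
  - exact: sqr_ge0.
  rewrite mul0e adde0; apply: lte_mul_pinfty => //; first by rewrite lee_fin sqr_ge0.
  rewrite (_ : (fun x => _) = (fun x => (\sum_(i < n) ((g x 0 i) ^+ 2)%:E)%E)); last first.
    by apply/funext => x; rewrite /dotr sumEFin; congr EFin; apply: eq_bigr => i _; rewrite expr2.
  rewrite ge0_integral_sum//; last 2 first.
  - by move=> i; apply/measurable_EFinP; exact: measurable_funX.
  - by move=> i x _; rewrite lee_fin sqr_ge0.
  by apply: lte_sum_pinfty => i _; have [] := sg i.
split=> //.
pose Ue k := U `&` [set x | k.+1%:R^-1 <= d x].
have md : measurable_fun U d.
  by apply: continuous_measurable_rV => // x _; exact: distF_continuous.
have mUe k : measurable (Ue k).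
  have := md mU `[k.+1%:R^-1, +oo[%classic (measurable_itv _).
  congr measurable; apply/seteqP; split => x /=; rewrite in_itv /= andbT//.
have subUe k : Ue k `<=` U by move=> x [].
have UeU : U = \bigcup_k Ue k.
  apply/seteqP; split => x; last by move=> [k _] [].
  move=> Ux; have d0 := distF_gt0 hF n_gt0 bd_U oU Ux.
  have [k _ Hk] := near_infty_natSinv_lt (PosNum d0).
  by exists k => //; split => //=; exact/ltW/(Hk k (leqnn k)).
have ndUe : nondecreasing_seq Ue.
  move=> k l kl; apply/subsetPset => x [Ux /= kx]; split => //=.
  by apply: le_trans kx; rewrite lef_pV2 ?posrE// ler_nat.
have mW2 : measurable_fun U (fun x => W x * u x ^+ 2).
  by apply: measurable_funM; [exact: measurable_hardy_weight|exact: measurable_funX].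
suff main k : (\int[mu]_(x in Ue k) (W x * u x ^+ 2)%:E <= A)%E.
  have cv : (\int[mu]_(x in Ue k) (W x * u x ^+ 2)%:E)%E @[k --> \oo]
      --> (\int[mu]_(x in \bigcup_k Ue k) (W x * u x ^+ 2)%:E)%E.
    apply: ge0_nondecreasing_set_cvg_integral => //.
    - by move=> k; apply/measurable_EFinP; exact: measurable_funS (subUe k) mW2.
    - by move=> k x _; rewrite lee_fin mulr_ge0// sqr_ge0.
  by rewrite -UeU in cv; apply: (cvge_to_le cv); exact: nearW.
pose c : R := k.+1%:R^-1; have c0 : 0 < c by rewrite invr_gt0.
pose We := 1 / (4 * c ^+ 2) + 1 / (4 * r ^+ 2).
have We0 : 0 <= We by rewrite addr_ge0// divr_ge0// mulr_ge0// sqr_ge0.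
have WWe x : Ue k x -> W x <= We.
  move=> [Ux /= cx]; have d0 := distF_gt0 hF n_gt0 bd_U oU Ux.
  rewrite lerD2r !div1r lef_pV2 ?posrE ?mulr_gt0 ?exprn_gt0//.
  by rewrite ler_pM2l// lerXn2r ?nnegrE// ltW.
pose h m x := (phi m x - u x) ^+ 2 + enorm (grad (phi m) x - g x) ^+ 2.
pose e m := (\int[mu]_(x in U) (h m x)%:E)%E.
have h0 m x : 0 <= h m x by rewrite addr_ge0 ?sqr_ge0.
have mphi m : measurable_fun U (phi m).
  apply: continuous_measurable_rV => // x _; exact/smooth_continuous/(test_function_smooth (tphi m)).
have mgphi m i : measurable_fun U (fun x => grad (phi m) x 0 i).
  apply: smooth_grad_measurable => //; exact: (test_function_smooth (tphi m)).
have mh m : measurable_fun U (h m).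
  apply: measurable_funD; first by apply: measurable_funX; exact: measurable_funB.
  rewrite (_ : (fun x => _) = (fun x => dotr (grad (phi m) x - g x) (grad (phi m) x - g x))).
    apply: mdotr => i; rewrite (_ : (fun x => _) = (fun x => grad (phi m) x 0 i - g x 0 i)).
      exact: measurable_funB.
    by apply/funext => x; rewrite !mxE.
  by apply/funext => x; rewrite enorm_sqr.
have step m eta : 0 < eta -> (\int[mu]_(x in Ue k) (W x * u x ^+ 2)%:E <=
    ((1 + eta) ^+ 2)%:E * A + ((1 + eta^-1) * ((1 + eta) * C ^+ 2 + We))%:E * e m)%E.
  move=> eta0; have eta1 : 0 <= 1 + eta by rewrite addr_ge0// ltW.
  have ieta1 : 0 <= 1 + eta^-1 by rewrite addr_ge0// invr_ge0 ltW.
  pose J := (\int[mu]_(x in U) (W x * phi m x ^+ 2)%:E)%E.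
  have mWphi : measurable_fun U (fun x => W x * phi m x ^+ 2).
    by apply: measurable_funM; [exact: measurable_hardy_weight|exact: measurable_funX].
  have s1 : (\int[mu]_(x in Ue k) (W x * u x ^+ 2)%:E <=
      (1 + eta)%:E * J + ((1 + eta^-1) * We)%:E * e m)%E.
    rewrite -ge0_integral_lincomb//; last 2 first.
    - by move=> x _; rewrite mulr_ge0// sqr_ge0.
    - by rewrite mulr_ge0.
    have mR : measurable_fun U (fun x => (1 + eta) * (W x * phi m x ^+ 2) + (1 + eta^-1) * We * h m x).
      by apply: measurable_funD; exact: measurable_funM.
    apply: (@le_trans _ _ (\int[mu]_(x in Ue k)
        ((1 + eta) * (W x * phi m x ^+ 2) + (1 + eta^-1) * We * h m x)%:E)%E).
      apply: ge0_le_integral_EFin => //.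
      - exact: measurable_funS (subUe k) mW2.
      - exact: measurable_funS (subUe k) mR.
      - by move=> x _; rewrite mulr_ge0// sqr_ge0.
      - move=> x Uex; apply: le_trans (ler_wpM2l (W_ge0 x) (square_split (u x) (phi m x) eta0)) _.
        rewrite mulrDr; apply: lerD; first by rewrite mulrCA.
        rewrite mulrCA -mulrA ler_wpM2l//; apply: ler_pM => //; rewrite ?sqr_ge0//.
          exact: WWe.
        by rewrite lerDl sqr_ge0.
    apply: ge0_subset_integral => //; first exact/measurable_EFinP.
    move=> x _; rewrite lee_fin; apply: addr_ge0; apply: mulr_ge0 => //; last exact: mulr_ge0.
    by apply: mulr_ge0 => //; exact: sqr_ge0.
  have s2 : (J <= (1 + eta)%:E * A + ((1 + eta^-1) * C ^+ 2)%:E * e m)%E.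
    apply: le_trans (hardy_test (tphi m)) _.
    rewrite -ge0_integral_lincomb//; last 2 first.
    - by move=> x _; rewrite sqr_ge0.
    - by rewrite mulr_ge0// sqr_ge0.
    apply: ge0_le_integral_EFin => //.
    - by apply: measurable_funX; exact: (measurable_fun_comp_rV mU mF (mgphi m)).
    - by apply: measurable_funD; exact: measurable_funM.
    - by move=> x _; rewrite sqr_ge0.
    - move=> x _; apply: le_trans (square_split (F (grad (phi m) x)) (F (g x)) eta0) _.
      rewrite lerD2l -mulrA ler_wpM2l//.
      apply: (@le_trans _ _ (F (g x - grad (phi m) x) ^+ 2)).
        by rewrite -(real_normK (num_real (F (g x) - _))) lerXn2r ?nnegrE ?scn_ge0// scn_dist.
      apply: le_trans (FC _) _; rewrite ler_wpM2l ?sqr_ge0// -enorm_sqr.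
      by rewrite -opprB /enorm dotrNl dotrNr opprK lerDr sqr_ge0.
  apply: le_trans s1 _.
  apply: (@le_trans _ _ ((1 + eta)%:E * ((1 + eta)%:E * A + ((1 + eta^-1) * C ^+ 2)%:E * e m)
     + ((1 + eta^-1) * We)%:E * e m)%E).
    by rewrite leeD2r// lee_wpmul2l// lee_fin.
  have e0 : (0 <= e m)%E by apply: integral_ge0 => x _; rewrite lee_fin.
  have k1 : 0 <= (1 + eta^-1) * C ^+ 2 by rewrite mulr_ge0// sqr_ge0.
  have k2 : 0 <= (1 + eta) * ((1 + eta^-1) * C ^+ 2) by exact: mulr_ge0.
  have k3 : 0 <= (1 + eta^-1) * We by exact: mulr_ge0.
  rewrite ge0_muleDr; [|exact: mule_ge0|exact: mule_ge0].
  rewrite !muleA -!EFinM -addeA -ge0_muleDl// -EFinD -expr2.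
  by rewrite mulrCA -mulrDr.
have A_num : A \is a fin_num by rewrite ge0_fin_numE.
pose a := fine A; have Aa : A = a%:E by rewrite fineK.
have a0 : 0 <= a by rewrite fine_ge0.
apply/lee_addgt0Pr => eps eps0.
(* [eta <= 1] gives [(1 + eta) ^ 2 <= 1 + 3 eta], so the excess over [a] is at most
  [eps / 2] *)
pose eta := Num.min 1 (eps / (6 * (a + 1))).
have a1 : 0 < a + 1 by rewrite ltr_wpDl.
have eta0 : 0 < eta by rewrite lt_min ltr01 divr_gt0// mulr_gt0.
have eta1 : eta <= 1 by rewrite ge_min lexx.
have eta2 : eta * (6 * (a + 1)) <= eps by rewrite -ler_pdivlMr ?mulr_gt0// ge_min lexx orbT.
pose Keta := (1 + eta^-1) * ((1 + eta) * C ^+ 2 + We).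
have Keta0 : 0 <= Keta.
  rewrite /Keta; apply: mulr_ge0; first by rewrite addr_ge0// invr_ge0 ltW.
  apply: addr_ge0 => //; apply: mulr_ge0; last exact: sqr_ge0.
  by rewrite addr_ge0// ltW.
have K1 : 0 < 1 + Keta by exact: ltr_pwDl ltr01 Keta0.
have de0 : 0 < eps / 2 / (1 + Keta) by rewrite divr_gt0// divr_gt0.
have [m em] : exists m, (e m <= (eps / 2 / (1 + Keta))%:E)%E.
  have /fine_cvgP[fin_e /cvgrPdist_le/(_ _ de0) near_e] := cvphi.
  have [m _ /(_ m (leqnn m)) [f1 f2]] := filterI fin_e near_e.
  exists m; rewrite -[e m]fineK//; rewrite lee_fin; apply: le_trans f2.
  by rewrite sub0r normrN; exact: ler_norm.
apply: le_trans (step m eta eta0) _.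
rewrite -/Keta Aa -EFinM.
apply: (@le_trans _ _ (((1 + eta) ^+ 2 * a)%:E + (Keta * (eps / 2 / (1 + Keta)))%:E)%E).
  by rewrite leeD2l// [leRHS]EFinM lee_wpmul2l// lee_fin.
rewrite -!EFinD lee_fin.
have : Keta * (eps / 2 / (1 + Keta)) <= eps / 2.
  by rewrite mulrCA ger_pMr ?divr_gt0// ler_pdivrMr// mul1r lerDr.
have : (1 + eta) ^+ 2 * a <= a + 3 * eta * a.
  have p0 : 0 <= eta * a * (1 - eta) by rewrite !mulr_ge0 ?subr_ge0// ltW.
  by rewrite -subr_ge0 (_ : _ - _ = eta * a * (1 - eta))//; ring.
have : 3 * eta * a <= eps / 2 by lra.
by lra.
Qed.

End hardy.

Theorem corollary4p1 (R : realType) (n : nat) (F : 'rV[R]_n -> R)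
    (hF : strongly_convex_norm F) (Omega : set 'rV[R]_n)
    (Omega_open : open Omega) (Omega_connected : connected Omega)
    (Omega_bd : boundary Omega !=set0)
    (d_superharmonic : distF_superharmonic F Omega)
    (r_finite : (inradiusF F Omega < +oo)%E)
    (u : 'rV[R]_n -> R) (gradu : 'rV[R]_n -> 'rV[R]_n)
    (hu : sobolev_H10 Omega u gradu) :
  ((1 / (4 * fine (inradiusF F Omega) ^+ 2))%:E *
     \int[lebesgue_rV R n]_(x in Omega) (`|u x| ^+ 2)%:E
   <= \int[lebesgue_rV R n]_(x in Omega) (F (gradu x) ^+ 2)%:E
      - (1 / 4)%:E * \int[lebesgue_rV R n]_(x in Omega)
          (`|u x| ^+ 2 / distF F Omega x ^+ 2)%:E)%E.
Proof.
have [b [clb nintb]] := Omega_bd.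
have [y0 [Oy0 _]] := clb setT filterT.
(* in dimension zero the only point would be interior, and the boundary empty *)
have n_gt0 : (0 < n)%N.
  rewrite lt0n; apply/eqP => n0; apply: nintb; rewrite (interior_id _).1//.
  suff -> : b = y0 by [].
  by apply/rowP => i; have := ltn_ord i; rewrite {2}n0.
set r := fine (inradiusF F Omega).
have dist_le x : Omega x -> ((distF F Omega x)%:E <= inradiusF F Omega)%E.
  by move=> Ox; apply: ereal_sup_ubound; exists x.
have rE : inradiusF F Omega = r%:E.
  rewrite fineK// fin_real// r_finite andbT.
  exact: lt_le_trans (ltNyr _) (dist_le _ Oy0).
have dr x : Omega x -> distF F Omega x <= r by move=> /dist_le; rewrite rE lee_fin.
have [H Afin] := hardy_H10 hF n_gt0 Omega_bd Omega_open d_superharmonic dr hu.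
have mO : measurable Omega by exact: open_measurable_rV.
have mu_ : measurable_fun Omega u by case: hu => -[[]].
have mid := measurable_distF_inv hF n_gt0 Omega_bd Omega_open.
have mq : measurable_fun Omega (fun x => `|u x| ^+ 2 / distF F Omega x ^+ 2).
  rewrite (_ : (fun x => _) = (fun x => `|u x| ^+ 2 * (distF F Omega x)^-1 ^+ 2)); last first.
    by apply/funext => x; rewrite exprVn.
  apply: measurable_funM; apply: measurable_funX => //; exact: measurableT_comp.
have mu2 : measurable_fun Omega (fun x => `|u x| ^+ 2).
  by apply: measurable_funX; exact: measurableT_comp.
set B := (\int[_]_(x in Omega) (`|u x| ^+ 2 / _)%:E)%E.
set I := (\int[_]_(x in Omega) (`|u x| ^+ 2)%:E)%E.
have B0 : (0 <= B)%E by apply: integral_ge0 => x _; rewrite lee_fin divr_ge0 ?sqr_ge0.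
have I0 : (0 <= I)%E by apply: integral_ge0 => x _; rewrite lee_fin sqr_ge0.
have c0 : 0 <= 1 / (4 * r ^+ 2) by rewrite divr_ge0// mulr_ge0// sqr_ge0.
have {}H : ((1 / (4 * r ^+ 2))%:E * I + (1 / 4)%:E * B <=
    \int[lebesgue_rV R n]_(x in Omega) (F (gradu x) ^+ 2)%:E)%E.
  rewrite -ge0_integral_lincomb//; last first.
    by move=> x _; rewrite divr_ge0 ?sqr_ge0.
  apply: le_trans H; rewrite le_eqVlt; apply/orP; left; apply/eqP.
  apply: eq_integral => x; rewrite inE => Ox; congr EFin.
  rewrite real_normK ?num_real// [RHS]mulrDl [LHS]addrC; congr (_ + _).
  by rewrite !div1r [(4 * _)^-1]invfM [LHS]mulrCA [RHS]mulrC.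
have Bfin : ((1 / 4)%:E * B)%E \is a fin_num.
  rewrite ge0_fin_numE ?mule_ge0 ?lee_fin//; apply: le_lt_trans Afin.
  by apply: le_trans H; rewrite leeDr// mule_ge0// lee_fin.
by rewrite leeBrDr.
Qed.
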